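(* Modulo $11$ (coefficientwise), the following congruences hold: residue $1$: $T_{2,1}\equiv[0,-1,-5,-4,-3;-2]_1$, $T_{4,1}\equiv0$, $T_{6,1}\equiv[0,-1,-4,2,5;3]_1$, $T_{8,1}\equiv[0,5,1,4,-4;-3]_1$; residue $2$: $T_{2,2}\equiv[2,2,-3,-4,4;-1]_2$, $T_{4,2}\equiv[2,5,-1,0,3;1]_2$, $T_{6,2}\equiv[2,4,-2,2,5;3]_2$, $T_{8,2}\equiv[2,-1,2,4,1;5]_2$; residue $3$: $T_{2,3}\equiv[-3,0,-3,1,-4;3]_3$, $T_{4,3}\equiv[-1,-4,2,5,4;5]_3$, $T_{6,3}\equiv[-4,0,3,3,-2;5]_3$, $T_{8,3}\equiv[-5,2,0,4,-5;5]_3$; residue $5$: $T_{2,5}\equiv[-2,5,1,-1,4;-5]_5$, $T_{4,5}\equiv[-4,3,-3,5,-4;-2]_5$, $T_{6,5}\equiv[-5,2,-1,0,2;1]_5$, $T_{8,5}\equiv[4,0,-2,2,5;-3]_5$; residue $6$: $T_{2,6}\equiv\Theta(-4,3,1,5,-2)$, $T_{4,6}\equiv\Theta(-2,-4,-5,-3,-1)$, $T_{6,6}\equiv\Theta(1,5,-5,4,2)$, $T_{8,6}\equiv\Theta(-5,-5,1,-2,-2)$; residue $8$: $T_{2,8}\equiv[-1,-4,-1,5,-3;-4]_8$, $T_{4,8}\equiv[-3,5,-5,-3,-2;-5]_8$, $T_{6,8}\equiv[3,4,3,-3,1;3]_8$, $T_{8,8}\equiv[0,2,-1,5,-1;5]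_8$.
   Context: The rank of a partition is its largest part minus its number of parts; $N(m,n)$ is the number of partitions of $n$ with rank $m$. For even $k\ge 2$, $N_k(n):=\sum_{m\in\mathbb Z}m^kN(m,n)$ and $T_{k,r}(q):=\sum_{n\ge0}N_k(11n+r)q^n$. $(x;q)_\infty=\prod_{i\ge0}(1-xq^i)$; $J_{a,m}:=(q^a;q^m)_\infty(q^{m-a};q^m)_\infty(q^m;q^m)_\infty$, $J_m:=(q^m;q^m)_\infty$, $P_i:=J_{i,11}$. $\Theta(a_1,\dots,a_5):=\frac{J_{11}^6}{J_1^2}\Big[a_1\frac{q^2}{P_4P_5^2}+a_2\frac{1}{P_1^2P_3}+a_3\frac{q}{P_1P_4^2}+a_4\frac{q}{P_2^2P_5}+a_5\frac{q}{P_2P_3^2}\Big]$. $[c_1,\dots,c_5]:=\frac{J_{11}^2}{J_1^3}\big(c_1P_5^2P_4+c_2q^2P_1^2P_3+c_3qP_4^2P_1+c_4qP_2^2P_5+c_5qP_3^2P_2\big)$, and $[c_1,\dots,c_5;c_6]_1:=\frac{P_5}{P_2P_3}[c_1,\dots,c_5]+c_6\frac{J_{11}^2}{J_1^3}\frac{qP_2^2P_4}{P_1}$; $[c_1,\dots,c_5;c_6]_2:=\frac{P_3}{P_1P_4}[c_1,\dots,c_5]+c_6\frac{J_{11}^2}{J_1^3}\frac{q^3P_1^2P_2}{P_5}$; $[c_1,\dots,c_5;c_6]_3:=\frac{P_2}{P_1P_3}[c_1,\dots,c_5]+c_6\frac{J_{11}^2}{J_1^3}\frac{qP_3^2P_5}{P_4}$;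 $[c_1,\dots,c_5;c_6]_5:=\frac{P_4}{P_2P_5}[c_1,\dots,c_5]+c_6\frac{J_{11}^2}{J_1^3}\frac{qP_1P_5^2}{P_3}$; $[c_1,\dots,c_5;c_6]_8:=\frac{qP_1}{P_4P_5}[c_1,\dots,c_5]+c_6\frac{J_{11}^2}{J_1^3}\frac{P_3P_4^2}{P_2}$. *)

(* Defs.v *)
From mathcomp Require Import all_boot all_order all_algebra.
Set Implicit Arguments. Unset Strict Implicit. Unset Printing Implicit Defensive.
Import Order.TTheory GRing.Theory Num.Theory.
Local Open Scope ring_scope.

Definition is_partition_of (n : nat) (s : seq nat) : bool :=
  [&& sorted geq s, all (fun x => 0 < x)%N s & sumn s == n].

Definition prank (s : seq nat) : int :=
  (foldr maxn 0%N s)%:Z - (size s)%:Z.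

(* N(m,n): number of partitions of n with rank m.  Every partition of n has
   at most n parts, each at most n, so it is a k-tuple over 'I_n.+1 for a
   unique k <= n. *)
Definition Nrank (m : int) (n : nat) : nat :=
  \sum_(k < n.+1)
     #|[pred t : k.-tuple 'I_n.+1 |
          is_partition_of n (map val t) && (prank (map val t) == m)]|.

(* N_k(n) = sum_{m in Z} m^k N(m,n); N(m,n) = 0 unless -n <= m <= n. *)
Definition Nmom (k n : nat) : int :=
  \sum_(0 <= i < (2 * n).+1) ((i%:Z - n%:Z) ^+ k) * (Nrank (i%:Z - n%:Z) n)%:Z.

Definition series := nat -> int.

Definition szero : series := fun _ => 0.
Definition sadd (f g : series) : series := fun n => f n + g n.
Definition sscale (c : int) (f : series) : series := fun n => c * f n.
Definition smul (f g : series) : series :=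
  fun n => \sum_(0 <= i < n.+1) f i * g (n - i)%N.
Definition sshift (k : nat) (f : series) : series :=
  fun n => if (k <= n)%N then f (n - k)%N else 0.

(* Multiplicative inverse of a series with constant term 1
   (all denominators below have constant term 1):
   g_0 = 1,  g_n = - sum_{i=1}^{n} f_i g_{n-i}. *)
Fixpoint sinv_seq (f : series) (n : nat) : seq int :=
  match n with
  | 0 => [:: 1]
  | n'.+1 =>
      let s := sinv_seq f n' in
      rcons s (- \sum_(1 <= i < n'.+2) f i * nth 0 s (n'.+1 - i)%N)
  end.
Definition sinv (f : series) : series := fun n => nth 0 (sinv_seq f n) n.
Definition sdiv (f g : series) : series := smul f (sinv g).

Definition sone : series := fun n => if n == 0%N then 1 else 0.
Definition onemq (k : nat) : series :=
  fun n => if n == 0%N then 1 else if n == k then -1 else 0.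

(* (q^a; q^m)_infinity = prod_{i>=0} (1 - q^(a + m i)), for a, m >= 1:
   the factors with i > n do not affect the coefficient of q^n, so the
   n-th coefficient is that of the finite product over i <= n. *)
Definition qpoch (a m : nat) : series :=
  fun n => (\big[smul/sone]_(0 <= i < n.+1) onemq (a + m * i)%N) n.

Definition Jam (a m : nat) : series :=
  smul (smul (qpoch a m) (qpoch (m - a) m)) (qpoch m m).
Definition Jm (m : nat) : series := qpoch m m.
Definition P (i : nat) : series := Jam i 11.

Definition spow (f : series) (k : nat) : series := iter k (smul f) sone.

Definition T (k r : nat) : series := fun n => Nmom k (11 * n + r).

Definition Theta (a1 a2 a3 a4 a5 : int) : series :=
  smul (sdiv (spow (Jm 11) 6) (spow (Jm 1) 2))
   (sadd (sscale a1 (sshift 2 (sinv (smul (P 4) (spow (P 5) 2)))))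
   (sadd (sscale a2 (sinv (smul (spow (P 1) 2) (P 3))))
   (sadd (sscale a3 (sshift 1 (sinv (smul (P 1) (spow (P 4) 2)))))
   (sadd (sscale a4 (sshift 1 (sinv (smul (spow (P 2) 2) (P 5)))))
         (sscale a5 (sshift 1 (sinv (smul (P 2) (spow (P 3) 2))))))))).

Definition pref : series := sdiv (spow (Jm 11) 2) (spow (Jm 1) 3).

Definition br (c1 c2 c3 c4 c5 : int) : series :=
  smul pref
   (sadd (sscale c1 (smul (spow (P 5) 2) (P 4)))
   (sadd (sscale c2 (sshift 2 (smul (spow (P 1) 2) (P 3))))
   (sadd (sscale c3 (sshift 1 (smul (spow (P 4) 2) (P 1))))
   (sadd (sscale c4 (sshift 1 (smul (spow (P 2) 2) (P 5))))
         (sscale c5 (sshift 1 (smul (spow (P 3) 2) (P 2)))))))).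

Definition br1 (c1 c2 c3 c4 c5 c6 : int) : series :=
  sadd (smul (sdiv (P 5) (smul (P 2) (P 3))) (br c1 c2 c3 c4 c5))
       (sscale c6 (smul pref (sshift 1 (sdiv (smul (spow (P 2) 2) (P 4)) (P 1))))).
Definition br2 (c1 c2 c3 c4 c5 c6 : int) : series :=
  sadd (smul (sdiv (P 3) (smul (P 1) (P 4))) (br c1 c2 c3 c4 c5))
       (sscale c6 (smul pref (sshift 3 (sdiv (smul (spow (P 1) 2) (P 2)) (P 5))))).
Definition br3 (c1 c2 c3 c4 c5 c6 : int) : series :=
  sadd (smul (sdiv (P 2) (smul (P 1) (P 3))) (br c1 c2 c3 c4 c5))
       (sscale c6 (smul pref (sshift 1 (sdiv (smul (spow (P 3) 2) (P 5)) (P 4))))).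
Definition br5 (c1 c2 c3 c4 c5 c6 : int) : series :=
  sadd (smul (sdiv (P 4) (smul (P 2) (P 5))) (br c1 c2 c3 c4 c5))
       (sscale c6 (smul pref (sshift 1 (sdiv (smul (P 1) (spow (P 5) 2)) (P 3))))).
Definition br8 (c1 c2 c3 c4 c5 c6 : int) : series :=
  sadd (smul (sshift 1 (sdiv (P 1) (smul (P 4) (P 5)))) (br c1 c2 c3 c4 c5))
       (sscale c6 (smul pref (sdiv (smul (P 3) (spow (P 4) 2)) (P 2)))).

Definition cong11 (f g : series) : Prop := forall n, (11 %| f n - g n)%Z.

(* Main.v *)
Require Import Defs.
From HB Require Import structures.
From Stdlib Require Import BinNat Nnat.
From mathcomp Require Import all_boot all_order all_algebra all_field.
From mathcomp Require Import boolp zify ring.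
Set Implicit Arguments. Unset Strict Implicit. Unset Printing Implicit Defensive.
Import Order.TTheory GRing.Theory Num.Theory.
Local Open Scope ring_scope.

(** Write R(z,q) for the rank generating function, J for (q;q), D for q d/dq, delta for z d/dz, and
    phi for (zq)(q/z)(q).

    The analytic input is the Atkin-Garvan rank-crank equation phi^3 L = 2 z J^8, where L is (1-z)^3
    (6 D + delta + delta^2) applied to R/(1-z) ([lpol_phip]). Expanded in a = z and b = q/z, the
    series phi^3 L / z is invariant under z -> 1/z (conjugation of partitions) and under a <-> b
    (symmetry of Gaussian binomials). A series with non-negative exponents and both symmetries does
    not depend on z, and z = 1 determines it.

    Now reduce modulo 11 and put z = 1 + v. For each pair (r,k) in the theorem, a linear functional
    on the first thirteen Taylor coefficients in v sends the contribution to L of every partition of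
    n = r mod 11 to the k-th power of its rank ([lam_Lam]). So N_k(n) is read off from the Taylor
    coefficients of L = 2 z J^8 / phi^3.

    By the heat equation ([phi_heat]) the Taylor coefficients of phi are J^3 times elements of the
    ring generated by E2, E4, E6. Modulo 11 one has E4 E6 = 1 and E2 = E12, so this ring is
    F_11[x,1/x] with x = E4, and it is stable under D ([Ig_rel]). The recursion degenerates at the
    tenth coefficient, which stays an unknown. It enters L linearly up to order 12, and the chosen
    functionals give its contribution the form (D - r) f, which has no coefficient at n = r mod 11.

    On the product side f(q)^11 = f(q^11). Jacobi's series for J^3 splits into the D-eigenvectors
    q^(a(a+1)/2) P_(5-a)(q^11) up to scalars, so each of these is J^3 times an explicit Laurent
    polynomial in x ([gamE]); moreover q J^24 = x^3 - x^-2 ([delE]). Hence every monomial on the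
    right-hand sides, after q -> q^11 and multiplication by q^r, is J^-1 times a Laurent polynomial
    ([monoE]). Each congruence thus becomes an identity in F_11[x,1/x] modulo (D - r), verified by
    computation on a certificate ([mons_check], [certs_check]). *)

(* @@A *)
Definition ps (L : Type) := nat -> L.
HB.instance Definition _ (L : Type) := gen_eqMixin (ps L).
HB.instance Definition _ (L : Type) := gen_choiceMixin (ps L).

Lemma psP (L : Type) (f g : ps L) : (forall n, f n = g n) -> f = g.
Proof. exact: funext. Qed.

(** * The ring of formal power series, truncated equality, inverses, derivation *)

Section PsRing.
Variable L : comNzRingType.
Implicit Types f g h : ps L.

Definition ps_zero : ps L := fun _ => 0.
Definition ps_one : ps L := fun n => if n == 0%N then 1 else 0.
Definition ps_opp f : ps L := fun n => - f n.
Definition ps_add f g : ps L := fun n => f n + g n.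
Definition ps_mul f g : ps L :=
  fun n => \sum_(0 <= i < n.+1) f i * g (n - i)%N.

Definition ptrunc N f : {poly L} := \poly_(i < N.+1) f i.

Lemma ptruncE N f n : (n <= N)%N -> (ptrunc N f)`_n = f n.
Proof. by move=> h; rewrite coef_poly ltnS h. Qed.

(** Transfers products to [{poly L}], from which the ring axioms are inherited coefficient by
    coefficient. *)
Lemma ps_mulE N f g n :
  (n <= N)%N -> ps_mul f g n = (ptrunc N f * ptrunc N g)`_n.
Proof.
move=> le_nN; rewrite coefM /ps_mul big_mkord; apply: eq_bigr => i _.
by rewrite !ptruncE //; have := ltn_ord i; lia.
Qed.

Fact ps_addA : associative ps_add.
Proof. by move=> f g h; apply: psP => n; exact: addrA. Qed.
Fact ps_addC : commutative ps_add.
Proof. by move=> f g; apply: psP => n; exact: addrC. Qed.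
Fact ps_add0 : left_id ps_zero ps_add.
Proof. by move=> f; apply: psP => n; exact: add0r. Qed.
Fact ps_addN : left_inverse ps_zero ps_opp ps_add.
Proof. by move=> f; apply: psP => n; exact: addNr. Qed.

HB.instance Definition _ :=
  GRing.isZmodule.Build (ps L) ps_addA ps_addC ps_add0 ps_addN.

Fact ps_mulC : commutative ps_mul.
Proof. by move=> f g; apply: psP => n; rewrite !(@ps_mulE n) // mulrC. Qed.

Fact ps_mulA : associative ps_mul.
Proof.
have aux f g h n :
    ps_mul (ps_mul f g) h n = (ptrunc n f * ptrunc n g * ptrunc n h)`_n.
  rewrite coefM {1}/ps_mul big_mkord; apply: eq_bigr => i _.
  have := ltn_ord i; rewrite ltnS => h1.
  by rewrite (@ps_mulE n) // ptruncE // leq_subr.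
move=> f g h; apply: psP => n.
by rewrite ps_mulC !aux mulrC mulrA.
Qed.

Fact ps_mul1 : left_id ps_one ps_mul.
Proof.
move=> f; apply: psP => n; rewrite /ps_mul big_nat_recl //= mul1r subn0.
by rewrite big1 ?addr0 // => i _; rewrite mul0r.
Qed.

Fact ps_mulDl : left_distributive ps_mul ps_add.
Proof.
move=> f g h; apply: psP => n; rewrite /ps_mul /ps_add -big_split.
by apply: eq_bigr => i _; rewrite mulrDl.
Qed.

Fact ps_one_neq0 : ps_one != 0.
Proof.
apply/eqP => /(congr1 (fun f : ps L => f 0%N)); rewrite /ps_one /=.
by move/eqP; rewrite oner_eq0.
Qed.

HB.instance Definition _ := GRing.Zmodule_isComNzRing.Build (ps L)
  ps_mulA ps_mulC ps_mul1 ps_mulDl ps_one_neq0.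

Lemma psD f g n : (f + g) n = f n + g n. Proof. by []. Qed.
Lemma psN f n : (- f) n = - f n. Proof. by []. Qed.
Lemma psB f g n : (f - g) n = f n - g n. Proof. by []. Qed.
Lemma ps0 n : (0 : ps L) n = 0. Proof. by []. Qed.
Lemma ps1 n : (1 : ps L) n = (n == 0%N)%:R.
Proof. by rewrite /GRing.one /= /ps_one; case: eqP. Qed.
Lemma psM f g n : (f * g) n = \sum_(i < n.+1) f i * g (n - i)%N.
Proof. by rewrite -(big_mkord xpredT (fun i => f i * g (n - i)%N)). Qed.
Lemma psM0 f g : (f * g) 0%N = f 0%N * g 0%N.
Proof. by rewrite psM big_ord1. Qed.
Lemma ps_sum (I : Type) (r : seq I) (P : pred I) (F : I -> ps L) n :
  (\sum_(i <- r | P i) F i) n = \sum_(i <- r | P i) F i n.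
Proof. by elim/big_rec2: _ => // i y1 y2 _ <-. Qed.
Lemma psMn f k n : (f *+ k) n = f n *+ k.
Proof. by elim: k => [|k IH]; rewrite ?mulr0n // !mulrS psD IH. Qed.
Lemma psX0 f k : (f ^+ k) 0%N = f 0%N ^+ k.
Proof. by elim: k => [|k IH]; rewrite ?expr0 ?ps1 // !exprS psM0 IH. Qed.
Lemma psnat k n : (k%:R : ps L) n = if n == 0%N then k%:R else 0.
Proof. by rewrite psMn ps1; case: eqP => _ //; rewrite mul0rn. Qed.
Lemma psint k n : (k%:~R : ps L) n = if n == 0%N then k%:~R else 0.
Proof.
case: k => k; first by rewrite -!pmulrn psnat.
by rewrite NegzE !mulrNz psN -!pmulrn psnat; case: eqP; rewrite ?oppr0.
Qed.

Lemma ps_signM k f n : ((-1) ^+ k * f) n = (-1) ^+ k * f n.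
Proof.
elim: k => [|k IH]; first by rewrite !expr0 !mul1r.
by rewrite !exprS -!mulrA !mulN1r psN IH.
Qed.
Lemma ps_natM k f n : (k%:R * f) n = k%:R * f n.
Proof. by rewrite !mulr_natl psMn. Qed.

Definition psc (c : L) : ps L := fun n => if n == 0%N then c else 0.
Lemma pscM c f n : (psc c * f) n = c * f n.
Proof.
rewrite psM big_ord_recl /= subn0 big1 ?addr0 // => i _.
by rewrite /psc /= mul0r.
Qed.

Lemma pscX c k : psc (c ^+ k) = psc c ^+ k.
Proof.
elim: k => [|k IH]; first by apply: psP => -[|k]; rewrite !expr0 ps1.
by apply: psP => n; rewrite !exprS -IH pscM /psc; case: eqP; rewrite ?mulr0.
Qed.

Definition psX (k : nat) : ps L := fun n => (n == k)%:R.
Lemma psXM k f n : (psX k * f) n = if (k <= n)%N then f (n - k)%N else 0.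
Proof.
rewrite psM; case: leqP => h.
  rewrite (bigD1 (Ordinal (h : (k < n.+1)%N))) //= /psX eqxx mul1r big1 ?addr0 //.
  by move=> i; rewrite -val_eqE /= => /negPf->; rewrite mul0r.
rewrite big1 // => i _; rewrite /psX; case: eqP => [e|_]; last by rewrite mul0r.
by have := ltn_ord i; rewrite e; lia.
Qed.
Lemma psXD j k : psX (j + k) = psX j * psX k.
Proof.
apply: psP => n; rewrite psXM /psX; case: leqP => h.
  by congr (nat_of_bool _)%:R; apply/eqP/eqP; lia.
by case: eqP => // e; lia.
Qed.
Lemma psX_0 : psX 0 = 1.
Proof. by apply: psP => n; rewrite ps1. Qed.
Lemma psXX j k : psX j ^+ k = psX (j * k).
Proof.
by elim: k => [|k IH]; rewrite ?muln0 ?psX_0 // exprS IH -psXD mulnS.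
Qed.
Lemma psX_inj k f g : psX k * f = psX k * g -> f = g.
Proof.
move=> e; apply: psP => n; have := congr1 (fun u : ps L => u (k + n)%N) e.
by rewrite !psXM leq_addr addKn.
Qed.

(* Every series is a truncation plus a multiple of a power of q. *)
Lemma ps_split N f : exists g, f = \sum_(i < N) psc (f i) * psX i + psX N * g.
Proof.
exists (fun n => f (N + n)%N); apply: psP => n.
rewrite psD ps_sum psXM; case: leqP => h.
  rewrite big1 ?add0r ?subnKC // => i _; rewrite pscM /psX.
  by case: eqP => [e|_]; rewrite ?mulr0 //; have := ltn_ord i; lia.
rewrite addr0 (bigD1 (Ordinal h)) //= pscM /psX eqxx mulr1 big1 ?addr0 //.
by move=> i; rewrite -val_eqE /= eq_sym pscM => /negPf->; rewrite mulr0.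
Qed.

(** Congruence modulo q^(N+1). Infinite products and sums are only ever compared through it. *)
Definition eqt (N : nat) f g := forall n, (n <= N)%N -> f n = g n.
Lemma eqt_refl N f : eqt N f f. Proof. by []. Qed.
Lemma eqt_sym N f g : eqt N f g -> eqt N g f.
Proof. by move=> h n ?; rewrite h. Qed.
Lemma eqt_trans N f g h : eqt N f g -> eqt N g h -> eqt N f h.
Proof. by move=> h1 h2 n le_n; rewrite h1 ?h2. Qed.
Lemma eqt_mul N f f' g g' : eqt N f f' -> eqt N g g' -> eqt N (f * g) (f' * g').
Proof.
move=> hf hg n le_n; rewrite !psM; apply: eq_bigr => i _.
by rewrite hf ?hg //; have := ltn_ord i; lia.
Qed.
Lemma eqt_add N f f' g g' : eqt N f f' -> eqt N g g' -> eqt N (f + g) (f' + g').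
Proof. by move=> hf hg n le_n; rewrite !psD hf ?hg. Qed.
Lemma eqt_prod N (I : Type) (r : seq I) (P : pred I) (F G : I -> ps L) :
  (forall i, P i -> eqt N (F i) (G i)) ->
  eqt N (\prod_(i <- r | P i) F i) (\prod_(i <- r | P i) G i).
Proof. by move=> h; elim/big_rec2: _ => // i a b /h; apply: eqt_mul. Qed.
Lemma eqt_sum N (I : Type) (r : seq I) (P : pred I) (F G : I -> ps L) :
  (forall i, P i -> eqt N (F i) (G i)) ->
  eqt N (\sum_(i <- r | P i) F i) (\sum_(i <- r | P i) G i).
Proof. by move=> h; elim/big_rec2: _ => // i a b /h; apply: eqt_add. Qed.
Lemma eqt_le M N f g : (N <= M)%N -> eqt M f g -> eqt N f g.
Proof. by move=> le h n le_n; apply: h; apply: leq_trans le. Qed.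
Lemma eqt_all f g : (forall N, eqt N f g) -> f = g.
Proof. by move=> h; apply: psP => n; apply: (h n). Qed.

(* Inverse of a series with constant term 1 (junk otherwise). *)
Fixpoint pinv_seq f (n : nat) : seq L :=
  match n with
  | 0 => [:: 1]
  | n'.+1 => let s := pinv_seq f n' in
      rcons s (- \sum_(1 <= i < n'.+2) f i * nth 0 s (n'.+1 - i)%N)
  end.
Definition pinv f : ps L := fun n => nth 0 (pinv_seq f n) n.

Lemma size_pinv_seq f n : size (pinv_seq f n) = n.+1.
Proof. by elim: n => //= n IH; rewrite size_rcons IH. Qed.
Lemma nth_pinv_seq f m n : (m <= n)%N -> nth 0 (pinv_seq f n) m = pinv f m.
Proof.
elim: n => [|n IH]; first by rewrite leqn0 => /eqP ->.
rewrite leq_eqVlt => /orP[/eqP -> //|]; rewrite ltnS => h.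
by rewrite /= nth_rcons size_pinv_seq ltnS h IH.
Qed.
Lemma pinvP f : f 0%N = 1 -> f * pinv f = 1.
Proof.
move=> f0; apply: psP => -[|n]; first by rewrite psM0 f0 mul1r ps1.
rewrite psM big_ord_recl f0 mul1r subn0 ps1 /=.
rewrite {1}/pinv /= nth_rcons size_pinv_seq ltnn eqxx.
rewrite big_add1 big_mkord addrC; apply/eqP; rewrite subr_eq0; apply/eqP.
by apply: eq_bigr => i _; rewrite nth_pinv_seq //= /bump /=; lia.
Qed.
Lemma pinv0 f : pinv f 0%N = 1. Proof. by []. Qed.
End PsRing.

Arguments psX {L} k.

Section PsMap.
Variables (L M : comNzRingType).

(* [psmapu f u] sends sum p_n q^n to sum f(p_n) (u q)^n. *)
Definition psmapu (f : L -> M) (u : M) (p : ps L) : ps M :=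
  fun n => u ^+ n * f (p n).

Variables (f : {rmorphism L -> M}) (u : M).
Fact psmapu_zmod_morphism : zmod_morphism (psmapu f u).
Proof. by move=> p r; apply: psP => n; rewrite /psmapu psB rmorphB mulrBr. Qed.
Fact psmapu_monoid_morphism : monoid_morphism (psmapu f u).
Proof.
split=> [|p r]; apply: psP => n; rewrite /psmapu.
  by rewrite !ps1; case: n => [|n]; rewrite ?rmorph1 ?expr0 ?mulr1 //= rmorph0 mulr0.
rewrite !psM rmorph_sum big_distrr; apply: eq_bigr => i _ /=.
rewrite rmorphM -{1}(subnKC (_ : i <= n)%N) ?exprD; last by have := ltn_ord i; lia.
by rewrite mulrACA.
Qed.
HB.instance Definition _ :=
  GRing.isZmodMorphism.Build (ps L) (ps M) (psmapu f u) psmapu_zmod_morphism.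
HB.instance Definition _ :=
  GRing.isMonoidMorphism.Build (ps L) (ps M) (psmapu f u) psmapu_monoid_morphism.
End PsMap.

Section PsDer.
Variable L : comNzRingType.
Definition psD1 (f : ps L) : ps L := fun n => f n *+ n.
Fact psD1_zmod_morphism : zmod_morphism psD1.
Proof. by move=> f g; apply: psP => n; rewrite /psD1 !psB mulrnBl. Qed.
HB.instance Definition _ :=
  GRing.isZmodMorphism.Build (ps L) (ps L) psD1 psD1_zmod_morphism.
Lemma psD1M f g : psD1 (f * g) = psD1 f * g + f * psD1 g.
Proof.
apply: psP => n; rewrite psD /psD1 !psM -big_split -sumrMnl.
apply: eq_bigr => i _ /=; rewrite mulrnAl mulrnAr -mulrnDr.
by congr (_ *+ _); have := ltn_ord i; lia.
Qed.
Lemma psD1_nat k : psD1 k%:R = 0.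
Proof. by apply: psP => -[|n]; rewrite /psD1 ?mulr0n // psnat mul0rn. Qed.
Lemma psD1_1 : psD1 1 = 0.
Proof. exact: (psD1_nat 1). Qed.
Lemma psD1_X k : psD1 (psX k) = psX k *+ k.
Proof. by apply: psP => n; rewrite /psD1 psMn /psX; case: eqP => [->|_]; rewrite ?mul0rn. Qed.
Lemma psD1_exp f k : psD1 (f ^+ k.+1) = (f ^+ k * psD1 f) *+ k.+1.
Proof.
elim: k => [|k IH]; first by rewrite expr1 expr0 mul1r.
by rewrite exprS psD1M IH [in RHS]mulrS exprS -mulrnAr; ring.
Qed.
End PsDer.

(** * Triangular numbers, Gaussian binomials, finite triple product *)

(* @@B *)
Fixpoint tri (k : nat) : nat := if k is k'.+1 then (k + tri k')%N else 0%N.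
Lemma triS k : tri k.+1 = (k.+1 + tri k)%N. Proof. by []. Qed.
Lemma tri2 k : (2 * tri k)%N = (k * k.+1)%N.
Proof. by elim: k => // k IH; rewrite triS mulnDr IH; lia. Qed.
Lemma tri_ge k : (k <= tri k)%N.
Proof. by case: k => // k; rewrite triS leq_addr. Qed.
Lemma tri_inj : injective tri.
Proof. by move=> j k e; have := tri2 j; have := tri2 k; rewrite e; nia. Qed.

Section Gauss.
Variable R : comNzRingType.
Variable q : R.

(* The Gaussian binomial coefficient [i + j choose i]. *)
Fixpoint gb (i j : nat) : R :=
  match i with
  | 0 => 1
  | i'.+1 => (fix gbi j := match j with
                           | 0 => 1
                           | j'.+1 => gb i' j + q ^+ i * gbi j' end) j
  end.
#[global] Arguments gb : simpl never.
Lemma gb0n j : gb 0 j = 1. Proof. by []. Qed.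
Lemma gbn0 i : gb i 0 = 1. Proof. by case: i. Qed.
Lemma gbSS i j : gb i.+1 j.+1 = gb i j.+1 + q ^+ i.+1 * gb i.+1 j.
Proof. by []. Qed.
Lemma gbSS' i j : gb i.+1 j.+1 = gb i.+1 j + q ^+ j.+1 * gb i j.+1.
Proof.
have [n] := ubnP (i + j); elim: n i j => // n IH [|i] [|j] h.
- by rewrite gbSS !gb0n !gbn0.
- have h1 := IH 0%N j h; have h2 := gbSS 0 j.
  by rewrite (gbSS 0 j.+1) gb0n [in LHS]h1 [in RHS]h2 !gb0n !exprS; ring.
- have h1 : gb i.+1 1 = gb i.+1 0 + q ^+ 1 * gb i 1 by apply: IH; lia.
  have h2 := gbSS i 0.
  by rewrite gbSS [in LHS]h1 [in RHS]h2 !gbn0 !exprS; ring.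
have hA1 : gb i.+1 j.+2 = gb i.+1 j.+1 + q ^+ j.+2 * gb i j.+2 by apply: IH; lia.
have hB1 : gb i.+2 j.+1 = gb i.+2 j + q ^+ j.+1 * gb i.+1 j.+1 by apply: IH; lia.
have hA2 := gbSS i j.+1; have hB2 := gbSS i.+1 j.
rewrite gbSS [in LHS]hA1 [in LHS]hB1.
by rewrite [in RHS]hB2 [in RHS]hA2 !exprS; ring.
Qed.
Lemma gb_sym i j : gb i j = gb j i.
Proof.
have [n] := ubnP (i + j); elim: n i j => // n IH [|i] [|j] h //.
  by rewrite gbSS gbSS' (IH i j.+1) 1?(IH i.+1 j) //; lia.
Qed.
Lemma gb_mul1 i j : (1 - q ^+ i.+1) * gb i.+1 j = (1 - q ^+ (i + j).+1) * gb i j.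
Proof.
case: j => [|j]; first by rewrite !gbn0 addn0.
rewrite mulrBl mul1r {1}gbSS gbSS'.
by rewrite addnS !exprS exprD; ring.
Qed.
Lemma gb_prod i j :
  gb i j * \prod_(k < i) (1 - q ^+ k.+1) = \prod_(k < i) (1 - q ^+ (k + j).+1).
Proof.
elim: i => [|i IH]; first by rewrite !big_ord0 mul1r.
rewrite !big_ord_recr /= -IH; set P := \prod_(k < i) _.
transitivity (P * ((1 - q ^+ i.+1) * gb i.+1 j)); first by ring.
by rewrite gb_mul1; ring.
Qed.
End Gauss.

Section Jtp.
Variable R : comNzRingType.
Implicit Types a b : R.

(* [jtc a b N s] is (-1)^k a^(k(k+1)/2) b^(k(k-1)/2) for k = s - N. *)
Definition jtc a b (N s : nat) : R :=
  if (N <= s)%N then (-1) ^+ (s - N) * (a ^+ tri (s - N) * b ^+ tri (s - N).-1)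
  else (-1) ^+ (N - s) * (a ^+ tri (N - s).-1 * b ^+ tri (N - s)).

Lemma jtc_sym a b M N s : (s <= M + N)%N -> jtc a b N s = jtc b a M (M + N - s).
Proof.
move=> h; rewrite /jtc; case: leqP => h1; case: leqP => h2.
- have e : s = N by lia.
  by rewrite e addnK !subnn /= !expr0 !mulr1.
- have -> : (M - (M + N - s) = s - N)%N by lia.
  by rewrite [b ^+ _ * _]mulrC.
- have -> : (M + N - s - M = N - s)%N by lia.
  by rewrite [b ^+ _ * _]mulrC.
- lia.
Qed.

(** With k = s - N, the ratio of consecutive theta terms is -a (ab)^k. Multiplying through by
    (ab)^(M-k) keeps exponents non-negative when k < 0. *)
Lemma jtcS a b M N s : (s <= M + N)%N ->
  (a * b) ^+ (M + N - s) * jtc a b N s.+1 = - a * (a * b) ^+ M * jtc a b N s.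
Proof.
move=> h; rewrite /jtc; case: (leqP N s) => h1.
  rewrite leqW // subSn //.
  have [k ek] : {k | s = (N + k)%N} by exists (s - N)%N; lia.
  rewrite {s}ek in h h1 *; rewrite addKn.
  have [m ->] : {m | M = (m + k)%N} by exists (M - k)%N; lia.
  have -> : (m + k + N - (N + k) = m)%N by lia.
  rewrite triS /= exprS exprD [(a * b) ^+ (m + k)]exprD !exprMn_comm; try exact: mulrC.
  rewrite exprS; case: k {h h1} => [|k]; first by rewrite !expr0; ring.
  by rewrite [tri k.+1.-1]/= triS !exprD; ring.
have [k ek] : {k | N = (s + k.+1)%N} by exists (N - s).-1; lia.
rewrite ek in h h1 *; rewrite addKn.
have -> : (M + (s + k.+1) - s = M + k.+1)%N by lia.
have -> : (s + k.+1 <= s.+1)%N = (k == 0%N) by lia.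
rewrite exprD exprMn_comm; last exact: mulrC.
have -> : (s + k.+1 - s.+1 = k)%N by lia.
case: k {ek h h1} => [|k] /=.
  have -> : (s.+1 - (s + 1) = 0)%N by lia.
  by rewrite /= !expr1 !expr0; ring.
by rewrite !exprD !exprMn !exprS; ring.
Qed.

Definition jtp a b M N : R :=
  \sum_(s < (M + N).+1) jtc a b N s * gb (a * b) (M + N - s) s.

Lemma jtp_sym a b M N : jtp a b M N = jtp b a N M.
Proof.
rewrite /jtp [(N + M)%N]addnC (reindex_inj rev_ord_inj) /=; apply: eq_bigr => s _.
have := ltn_ord s; rewrite ltnS => h.
rewrite (@jtc_sym _ _ M) ?subSS ?leq_subr // subKn // gb_sym mulrC [b * a]mulrC.
by rewrite mulrC.
Qed.

(** Pascal's rule [gbSS] splits each Gaussian binomial, and [jtcS] turns one half into the product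
    with the new factor. *)
Lemma jtpS a b M N : jtp a b M.+1 N = (1 - a * (a * b) ^+ M) * jtp a b M N.
Proof.
rewrite /jtp addSn; set L := (M + N)%N.
rewrite big_ord_recl /= subn0 gbn0 mulr1.
rewrite (eq_bigr (fun s : 'I_L.+1 => jtc a b N s.+1 * gb (a * b) (L - s.+1) s.+1 *+ (s < L)%N
   + - a * (a * b) ^+ M * (jtc a b N s * gb (a * b) (L - s) s))).
  rewrite big_split /= -big_distrr /= mulrBl mul1r addrA; congr (_ + _); last first.
    by rewrite !mulNr.
  rewrite [in RHS]big_ord_recl /= subn0 gbn0 mulr1; congr (_ + _).
  rewrite big_ord_recr /= ltnn mulr0n addr0; apply: eq_bigr => s _.
  by rewrite ltn_ord mulr1n /bump /= add1n.
move=> s _; rewrite /bump /= add1n subSS.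
have := ltn_ord s; rewrite ltnS => hs.
rewrite [in RHS]mulrA -(jtcS _ _ hs); case: ltnP => h.
  have -> : (L - s = (L - s.+1).+1)%N by lia.
  by rewrite gbSS mulr1n; ring.
have -> : (L - s = 0)%N by lia.
by rewrite !gb0n mulr0n expr0; ring.
Qed.

(** The finite form of Jacobi's triple product. [jtpS] adds the factors in [a], and through the
    symmetry [jtp_sym] also those in [b]. *)
Lemma jtp_prod a b M N :
  \prod_(i < M) (1 - a * (a * b) ^+ i) * \prod_(i < N) (1 - b * (a * b) ^+ i) =
  jtp a b M N.
Proof.
elim: M => [|M IH].
  rewrite big_ord0 mul1r jtp_sym; elim: N => [|N IH].
    by rewrite big_ord0 /jtp big_ord1 /jtc /= !expr0 !mulr1.
  by rewrite big_ord_recr /= jtpS -IH mulrC [b * a]mulrC.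
by rewrite big_ord_recr /= jtpS -IH; ring.
Qed.
End Jtp.

(** * Infinite products, Jacobi's triple product and cube identity *)

(* @@C *)
Section Products.
Variable L : comNzRingType.
Implicit Types f g h : ps L.

Lemma eqt_shift N k f g : eqt N f g -> eqt (k + N) (psX k * f) (psX k * g).
Proof. by move=> h n hn; rewrite !psXM; case: leqP => // hk; apply: h; lia. Qed.
Lemma eqt_psX0 N k f : (N < k)%N -> eqt N (psX k * f) 0.
Proof. by move=> h n hn; rewrite psXM; case: leqP => //; lia. Qed.
Lemma eqt_1BX N k : (N < k)%N -> eqt N (1 - psX k : ps L) 1.
Proof.
by move=> h n hn; rewrite psB /psX; case: eqP => [e|_]; [lia | rewrite subr0].
Qed.
Lemma eqt_prod1 N (I : Type) (r : seq I) (P : pred I) (F : I -> ps L) :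
  (forall i, P i -> eqt N (F i) 1) -> eqt N (\prod_(i <- r | P i) F i) 1.
Proof.
move=> h; apply: eqt_trans (eqt_prod (G := fun=> 1) _ h) _.
by rewrite big1_eq.
Qed.

(** The product (q^a;q^m), each coefficient taken from a finite product long enough to have
    stabilised. *)
Definition prodq (a m : nat) : ps L :=
  fun n => (\prod_(i < n.+1) (1 - psX (a + m * i))) n.

Lemma prodq_eqt a m N M : (0 < a)%N -> (0 < m)%N -> (N < M)%N ->
  eqt N (prodq a m) (\prod_(i < M) (1 - psX (a + m * i))).
Proof.
move=> a0 m0 h n hn; rewrite /prodq.
have [d ->] : {d | M = (n.+1 + d)%N} by exists (M - n.+1)%N; lia.
clear h hn; elim: d => [|d IH]; first by rewrite addn0.
rewrite addnS [in RHS]big_ord_recr /= IH.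
have h1 : eqt n (1 - psX (a + m * (n.+1 + d)) : ps L) 1 by apply: eqt_1BX; nia.
by have := eqt_mul (@eqt_refl _ n (\prod_(i < n.+1 + d) (1 - psX (a + m * i)))) h1;
   rewrite mulr1 => /(_ n (leqnn n)) ->.
Qed.

Lemma prodq0 a m : (0 < a)%N -> prodq a m 0%N = 1.
Proof.
move=> h; rewrite /prodq big_ord1 muln0 addn0 psB ps1 /psX /=.
by case: a h => // a _; rewrite subr0.
Qed.

Lemma psX_expM (k m : nat) : psX k ^+ m = psX (k * m) :> ps L.
Proof. exact: psXX. Qed.

(** A central Gaussian binomial tends to 1/(q^m;q^m). By [gb_prod] only factors 1 - q^e with e > N
    remain. *)
Lemma gb_lim (m i j N : nat) : (0 < m)%N -> (N <= i)%N -> (N <= j)%N ->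
  eqt N (gb (psX m : ps L) i j * \prod_(k < i + j) (1 - psX m ^+ k.+1)) 1.
Proof.
move=> m0 hi hj; rewrite big_split_ord /= mulrA gb_prod.
rewrite -[X in eqt _ _ X]mulr1.
by apply: eqt_mul; apply: eqt_prod1 => k _; rewrite psXX; apply: eqt_1BX; nia.
Qed.

(** The two-sided theta series cut at |k| <= N: first k >= 0, then the index -(k+1). *)
Definition thetaN (N al be : nat) : ps L :=
  \sum_(k < N.+1) (-1) ^+ k * psX (al * tri k + be * tri k.-1) +
  \sum_(k < N) (-1) ^+ k.+1 * psX (al * tri k + be * tri k.+1).

Lemma jtc_sum (R : comNzRingType) (a b : R) M N (F : nat -> R) :
  \sum_(s < (M + N).+1) jtc a b N s * F s =
  \sum_(k < M.+1) (-1) ^+ k * (a ^+ tri k * b ^+ tri k.-1) * F (k + N)%N +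
  \sum_(k < N) (-1) ^+ k.+1 * (a ^+ tri k * b ^+ tri k.+1) * F (N - k.+1)%N.
Proof.
rewrite -(big_mkord xpredT (fun s => jtc a b N s * F s)).
rewrite (@big_cat_nat _ _ _ N) //=; last by lia.
rewrite addrC; congr (_ + _).
  rewrite -{1}[N]add0n big_addn -addSn addnK big_mkord; apply: eq_bigr => k _.
  by rewrite /jtc leq_addl addnK.
rewrite big_nat_rev /= add0n big_mkord; apply: eq_bigr => k _.
have h := ltn_ord k; rewrite /jtc.
have -> : (N <= N - k.+1)%N = false by lia.
by have -> : (N - (N - k.+1) = k.+1)%N by lia.
Qed.

Theorem jacobi_triple n N al be : (0 < al)%N -> (0 < be)%N -> (n < N)%N ->
  eqt n (prodq al (al + be) * prodq be (al + be) * prodq (al + be) (al + be))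
        (thetaN N al be).
Proof.
move=> a0 b0 h; set m := (al + be)%N; have m0 : (0 < m)%N by rewrite /m; lia.
set q := psX m : ps L.
have eq : psX al * psX be = q by rewrite -psXD.
have e1 c : (0 < c)%N ->
    eqt n (prodq c m) (\prod_(i < N) (1 - psX c * (psX al * psX be) ^+ i)).
  move=> c0; apply: eqt_trans (prodq_eqt c0 m0 h) _.
  by apply: eqt_prod => i _; rewrite eq psXX -psXD.
have e2 : eqt n (prodq m m) (\prod_(k < N + N) (1 - q ^+ k.+1)).
  apply: eqt_trans (prodq_eqt m0 m0 (_ : n < N + N)%N) _; first by lia.
  by apply: eqt_prod => i _; rewrite psXX mulnS.
have e3 := jtp_prod (psX al : ps L) (psX be) N N.
have e4 : \prod_(i < N) (1 - psX be * (psX al * psX be) ^+ i) =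
          \prod_(i < N) (1 - psX be * (psX al * psX be) ^+ i) :> ps L by [].
apply: eqt_trans (eqt_mul (eqt_mul (e1 _ a0) (e1 _ b0)) e2) _.
rewrite e3 /jtp big_distrl /=.
have -> : thetaN N al be = \sum_(s < (N + N).+1) jtc (psX al) (psX be) N s.
  have := @jtc_sum _ (psX al : ps L) (psX be) N N (fun=> 1).
  under eq_bigr do rewrite mulr1.
  move=> ->; rewrite /thetaN; congr (_ + _); apply: eq_bigr => k _;
    by rewrite mulr1 !psXX -psXD.
apply: eqt_sum => s _; rewrite -mulrA eq -[X in eqt _ _ X]mulr1.
(* The term at distance k from the centre is divisible by q^k, which makes up for its binomial being
   known only to order N - k. *)
have [k [hk1 hk2] ] : exists k, (k <= N /\ (nat_of_ord s = N + k \/ N = s + k))%N /\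
    exists e u, (k <= e)%N /\ jtc (psX al : ps L) (psX be) N s = psX e * u.
  have := ltn_ord s; rewrite /jtc ltnS => hs; case: leqP => hN.
    exists (s - N)%N; split; first by split; [lia | left; lia].
    exists (al * tri (s - N) + be * tri (s - N).-1)%N, ((-1) ^+ (s - N)).
    by split; [have := tri_ge (s - N); nia | rewrite !psXX -psXD mulrC].
  exists (N - s)%N; split; first by split; [lia | right; lia].
  exists (al * tri (N - s).-1 + be * tri (N - s))%N, ((-1) ^+ (N - s)).
  by split; [have := tri_ge (N - s); nia | rewrite !psXX -psXD mulrC].
have := ltn_ord s; rewrite ltnS => hs.
case: hk2 => e [u [he ->]]; rewrite -!mulrA.
apply: (@eqt_le _ (e + (N - k)) n); first by case: hk1; lia.
apply: eqt_shift; apply: eqt_mul => //.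
have := @gb_lim m (N + N - s) s (N - k) m0; rewrite subnK //.
by apply; case: hk1; lia.
Qed.

Lemma eqt_psX_1 N e f c : eqt (N - e) f 1 -> eqt N (c * psX e * f) (c * psX e).
Proof.
move=> h; rewrite -mulrA -[X in eqt _ _ X]mulr1 -[X in eqt _ _ X]mulrA.
apply: eqt_mul => //; apply: (@eqt_le _ (e + (N - e))); first by lia.
exact: eqt_shift.
Qed.

(** The derivative at z = 1 of the finite triple product with a = z and b = q/z. The factor 1 - z
    vanishes there, so only its own derivative survives. Differentiation means taking the
    coefficient of [ep] over the base ring [ps L], with z = 1 + ep. *)
Theorem jacobi_cube n N : (n < N)%N ->
  eqt n (prodq 1 1 ^+ 3)
        (\sum_(k < N.+1) (-1) ^+ k * k.*2.+1%:R * psX (tri k)).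
Proof.
move=> h; set q := psX 1 : ps L.
pose ep := psX 1 : ps (ps L); pose z := 1 + ep; pose zi := pinv z.
have z0 : z 0%N = 1 by rewrite /z psD ps1 /= /ep /psX addr0.
have zzi : z * zi = 1 by exact: pinvP.
have zi0 : zi 0%N = 1 by [].
have ab : z * (psc q * zi) = psc q by rewrite mulrCA zzi mulr1.
have M1 (f g : ps (ps L)) : (f * g) 1%N = f 0%N * g 1%N + f 1%N * g 0%N.
  by rewrite psM !big_ord_recl big_ord0 addr0.
have E1 (f : ps (ps L)) k : f 0%N = 1 -> (f ^+ k) 1%N = f 1%N *+ k.
  move=> f0; elim: k => [|k IH]; first by rewrite !expr0 ps1.
  by rewrite exprS M1 IH f0 psX0 f0 expr1n mul1r mulr1 mulrS addrC.
have z1 : z 1%N = 1 by rewrite /z psD ps1 /= /ep /psX add0r.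
have zi1 : zi 1%N = -1.
  have := congr1 (fun f : ps (ps L) => f 1%N) zzi.
  rewrite M1 z0 z1 zi0 ps1 mul1r mulr1 => e.
  by apply/eqP; rewrite -addr_eq0 e.
have gbc i j : gb (psc q) i j = psc (gb q i j).
  have pscD c d : psc (c + d) = psc c + psc d :> ps (ps L).
    by apply: psP => -[|k]; rewrite psD /psc //= addr0.
  have pscMM c d : psc (c * d) = psc c * psc d :> ps (ps L).
    by apply: psP => k; rewrite pscM /psc; case: eqP; rewrite ?mulr0.
  have pscE c k : psc (c ^+ k) = psc c ^+ k :> ps (ps L).
    elim: k => [|k IH]; first by apply: psP => -[|k]; rewrite !expr0 ps1.
    by rewrite !exprS pscMM IH.
  have psc1 : psc 1 = 1 :> ps (ps L) by apply: psP => -[|k]; rewrite ps1.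
  elim: i j => [|i IHi] j; first by rewrite !gb0n psc1.
  elim: j => [|j IHj]; first by rewrite !gbn0 psc1.
  by rewrite !gbSS IHi IHj pscD pscMM pscE.
(* The derivative at z = 1 of z^i (q/z)^j u. *)
have C1 i j (u : ps L) :
    (z ^+ i * (psc q * zi) ^+ j * psc u) 1%N = (i%:R - j%:R) * q ^+ j * u.
  rewrite mulrC pscM exprMn M1 psX0 z0 expr1n mul1r (E1 z) // z1.
  have -> : psc q ^+ j * zi ^+ j = psc (q ^+ j) * zi ^+ j.
    congr (_ * _); elim: j => [|j IH]; first by apply: psP => -[|k]; rewrite !expr0 ps1.
    by rewrite exprS IH; apply: psP => k; rewrite pscM exprS /psc; case: eqP; rewrite ?mulr0.
  by rewrite !pscM (E1 zi) // zi1 psX0 zi0 expr1n mulr1 mulNrn; ring.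
pose u j : ps L := (-1) ^+ j * j.*2.+1%:R * psX (tri j).
have fin : \prod_(i < N) (1 - psX i.+1) ^+ 2 =
    \sum_(j < N.+1) u j * gb q (N - j) (N.+1 + j).
  have := congr1 (fun f : ps (ps L) => f 1%N) (jtp_prod z (psc q * zi) N.+1 N).
  rewrite big_ord_recl expr0 mulr1.
  have -> : 1 - z = - ep by rewrite /z opprD addNKr.
  rewrite -mulrA mulNr psN psXM /=.
  have P0 (I : Type) (r : seq I) (F : I -> ps (ps L)) :
      (\prod_(i <- r) F i) 0%N = \prod_(i <- r) (F i 0%N).
    by elim/big_rec2: _ => [|i a b _ <-]; rewrite ?ps1 ?psM0.
  rewrite psM0 !P0 -big_split /= => e.
  rewrite (eq_bigr (fun i : 'I_N => (1 - psX i.+1) ^+ 2)) in e; last first.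
    move=> i _; rewrite !psB !ps1 /= !psM0 !psX0 z0 mul1r ab /bump /= add1n.
    by rewrite zi0 mulr1 /psc /= -exprS psXX mul1n expr2.
  rewrite -[LHS]opprK e /jtp ab.
  rewrite (eq_bigr (fun s : 'I_(N.+1 + N).+1 => jtc z (psc q * zi) N s *
    psc (gb q (N.+1 + N - s) s))); last by move=> s _; rewrite gbc.
  rewrite (jtc_sum _ _ _ _ (fun s => psc (gb q (N.+1 + N - s) s))) psD !ps_sum.
  (* The theta terms of index j+1 and -j carry the same power of q and the same binomial; their
     derivatives j+1 and j add up to 2j+1. *)
  pose A1 j := (-1) ^+ j.+1 * (j.+1%:R * psX (tri j)) * gb q (N - j) (N.+1 + j).
  pose B1 j := (-1) ^+ j * (- j%:R * psX (tri j)) * gb q (N - j) (N.+1 + j).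
  rewrite big_ord_recl -mulrA ps_signM C1 subrr !mul0r mulr0 add0r.
  rewrite [X in - (X + _)](eq_bigr (fun j : 'I_N.+1 => A1 j)); last first.
    move=> j _; rewrite -mulrA ps_signM C1 lift0 /A1 -!mulrA.
    congr (_ * _); rewrite psXX mul1n triS natrD addrK.
    by congr (_ * (_ * gb _ _ _)); have := ltn_ord j; lia.
  rewrite [X in - (_ + X)](_ : _ = \sum_(j < N.+1) B1 j); last first.
    have B10 : B1 (@ord0 N) = 0 by rewrite /B1 oppr0 mul0r mulr0 mul0r.
    rewrite big_ord_recl B10 add0r.
    apply: eq_bigr => j _; rewrite -mulrA ps_signM C1 lift0 /B1 -!mulrA.
    congr (_ * _); rewrite psXX mul1n triS natrD opprD addrCA subrr addr0.
    by rewrite gb_sym; congr (_ * (_ * gb _ _ _)); have := ltn_ord j; lia.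
  rewrite -big_split /= -sumrN; apply: eq_bigr => j _.
  by rewrite /A1 /B1 /u exprS -addnn -addSn natrD; ring.
have Q1 : eqt n (prodq 1 1) (\prod_(k < N) (1 - psX k.+1)).
  apply: eqt_trans (prodq_eqt _ _ h) _ => //.
  by apply: eqt_prod => k _; rewrite mul1n add1n.
have Q2 : eqt n (prodq 1 1) (\prod_(k < N.+1 + N) (1 - q ^+ k.+1)).
  apply: eqt_trans (prodq_eqt _ _ (_ : (n < N.+1 + N)%N)) _ => //; first by lia.
  by apply: eqt_prod => k _; rewrite psXX !mul1n add1n.
have -> : prodq 1 1 ^+ 3 = prodq 1 1 * prodq 1 1 * prodq 1 1.
  by rewrite !exprS expr0 mulr1 mulrA.
apply: eqt_trans (eqt_mul (eqt_mul Q1 Q1) Q2) _.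
rewrite -big_split /=; under eq_bigr do rewrite -expr2.
rewrite fin big_distrl; apply: eqt_sum => j _ /=.
rewrite -mulrA /u; apply: eqt_psX_1; have hj := ltn_ord j.
have := @gb_lim 1 (N - j) (N.+1 + j) (n - tri j) isT.
have -> : (N - j + (N.+1 + j) = N.+1 + N)%N by lia.
by apply; have := tri_ge j; lia.
Qed.

Lemma prodq_split m : (0 < m)%N -> prodq 1 1 = \prod_(a < m) prodq a.+1 m.
Proof.
move=> m0; apply: eqt_all => n.
have h1 : (n < m * n.+1)%N by nia.
apply: eqt_trans (prodq_eqt _ _ h1) _ => //.
apply: eqt_sym; apply: (@eqt_trans _ _ _
  (\prod_(a < m) \prod_(i < n.+1) (1 - psX (a.+1 + m * i)))).
  by apply: eqt_prod => a _; exact: prodq_eqt.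
suff -> : \prod_(a < m) \prod_(i < n.+1) (1 - psX (a.+1 + m * i) : ps L) =
          \prod_(i < m * n.+1) (1 - psX (1 + 1 * i)) by [].
elim: n.+1 => [|k IH].
  by rewrite muln0 big_ord0 big1 // => i _; rewrite big_ord0.
rewrite mulnS addnC big_split_ord /= -IH -big_split.
apply: eq_bigr => a _; rewrite big_ord_recr /=.
by congr (_ * (1 - psX _)); lia.
Qed.
End Products.

(** * Partitions by rank, and the symmetries of the rank numbers *)

(* @@R *)
(* The partitions with exactly [k] parts, all parts at most [M]. *)
Fixpoint boxp (k M : nat) : seq (seq nat) :=
  if k is k'.+1 then
    flatten [seq [seq m.+1 :: s | s <- boxp k' m.+1] | m <- iota 0 M]
  else [:: [::]].

Lemma boxpS k M :
  boxp k.+1 M.+1 = boxp k.+1 M ++ [seq M.+1 :: s | s <- boxp k M.+1].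
Proof.
have e : iota 0 M.+1 = iota 0 M ++ [:: M] by rewrite -addn1 iotaD add0n.
by rewrite [LHS]/boxp -/boxp e map_cat flatten_cat /= cats0.
Qed.

Lemma boxp_pos k M s : s \in boxp k.+1 M -> exists h t,
  [/\ s = h.+1 :: t, (h < M)%N & t \in boxp k h.+1].
Proof.
case/flatten_mapP => m; rewrite mem_iota add0n => /andP[_ hm] /mapP[t ht ->].
by exists m, t.
Qed.

Lemma mem_boxp k M s :
  (s \in boxp k M) = [&& size s == k, sorted geq s, all (fun x => 0 < x)%N s
                        & all (fun x => x <= M)%N s].
Proof.
elim: k M s => [|k IH] M s; first by case: s.
apply/idP/idP => [/boxp_pos[h [t [-> hM]]]|].
  rewrite IH => /and4P[/eqP e1 e2 e3 e4] /=; rewrite e1 eqxx e3 hM /=.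
  rewrite path_sortedE; last by move=> a b c; rewrite /geq => *; lia.
  rewrite e4 e2 /=; apply: sub_all e4 => x; lia.
case: s => [|[|h] t]; rewrite ?andbF // => /and4P[/= /eqP[e1]].
rewrite path_sortedE; last by move=> a b c; rewrite /geq => *; lia.
move=> /andP[e2 e3] e4 /andP[hM e5].
apply/flatten_mapP; exists h; rewrite ?mem_iota ?add0n //.
by apply: map_f; rewrite IH e1 eqxx e3 e4 e2.
Qed.

Lemma uniq_boxp k M : uniq (boxp k M).
Proof.
elim: k M => // k IH; elim=> // M IHM; rewrite boxpS cat_uniq IHM /=.
rewrite map_inj_uniq ?IH ?andbT; last by move=> a b [].
apply/hasPn => s /mapP[t ht ->].
change (M.+1 :: t \notin boxp k.+1 M); rewrite mem_boxp /=.
by rewrite ltnn !andbF.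
Qed.

Lemma boxp_head k M s : s \in boxp k M -> (foldr maxn 0 s <= M)%N.
Proof.
rewrite mem_boxp => /and4P[_ _ _]; elim: s => //= x s IH /andP[h /IH h2].
by rewrite geq_max h.
Qed.
Lemma boxp_max k h s : s \in boxp k h -> foldr maxn 0%N (h :: s) = h.
Proof. by move/boxp_head => /=; lia. Qed.

Definition cnt (k M n : nat) : nat := count (fun s => sumn s == n) (boxp k M).

Lemma cntS k M n : cnt k.+1 M.+1 n =
  (cnt k.+1 M n + if (M.+1 <= n)%N then cnt k M.+1 (n - M.+1) else 0)%N.
Proof.
rewrite /cnt boxpS count_cat count_map; congr (_ + _)%N; case: leqP => h.
  by apply/eqP; rewrite -leqn0 leqNgt -has_count; apply/hasPn => s _ /=; lia.
by apply: eq_count => s /=; apply/eqP/eqP; lia.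
Qed.

Lemma cnt0 M n : cnt 0 M n = (n == 0%N).
Proof. by rewrite /cnt /= addn0 eq_sym. Qed.
Lemma cntS0 k n : cnt k.+1 0 n = 0%N. Proof. by []. Qed.

Lemma cnt_sat k M n : (n <= M)%N -> cnt k M n = cnt k n n.
Proof.
case: k => [|k] h; first by rewrite !cnt0.
rewrite -(subnKC h); elim: (M - n)%N => [|d IH]; first by rewrite addn0.
by rewrite addnS cntS IH ifF ?addn0 //; lia.
Qed.

Definition PL n : seq (seq nat) :=
  flatten [seq [seq s <- boxp k n | sumn s == n] | k <- iota 0 n.+1].

Lemma count_flatten_iota (U : Type) (F : nat -> seq U) N (p : pred U) :
  count p (flatten [seq F k | k <- iota 0 N]) = (\sum_(k < N) count p (F k))%N.
Proof.
rewrite -(big_mkord xpredT (fun k => count p (F k))) /index_iota subn0.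
by elim: (iota 0 N) => [|x r IH] /=; rewrite ?big_nil // count_cat IH big_cons.
Qed.

Lemma Nrank_count m n : Nrank m n = count (fun s => prank s == m) (PL n).
Proof.
rewrite /PL count_flatten_iota /Nrank.
apply: eq_bigr => k _; rewrite count_filter.
set P := [pred t | _].
rewrite cardE -(size_map (fun t : k.-tuple 'I_n.+1 => map val t)) -size_filter.
apply: perm_size; apply: uniq_perm.
- rewrite map_inj_uniq ?enum_uniq // => t u e; apply: val_inj.
  exact: (inj_map val_inj) e.
- by rewrite filter_uniq ?uniq_boxp.
move=> s; rewrite mem_filter; apply/mapP/andP => [[t]|[/= /andP[h1 h2] h3]].
  rewrite mem_enum !inE => /andP[/and3P[h1 h2 h3] h4] ->; rewrite /= h3 h4.
  split=> //; rewrite mem_boxp size_map size_tuple eqxx h1 h2 /=.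
  by apply/allP => x /mapP[y _ ->]; have := ltn_ord y; rewrite ltnS.
move: h3; rewrite mem_boxp => /and4P[e1 e2 e3 e4].
have es : map val [seq inord x : 'I_n.+1 | x <- s] = s.
  rewrite -map_comp -[RHS]map_id; apply/eq_in_map => x hx /=.
  by rewrite inordK // ltnS; apply: (allP e4).
have sz : size [seq inord x : 'I_n.+1 | x <- s] == k by rewrite size_map.
exists (Tuple sz); last by rewrite /= es.
by rewrite mem_enum !inE /= es /is_partition_of e2 e3 h1 h2.
Qed.

(* Splitting off the largest part [a.+1]. *)
Lemma Nrank_head m n : Nrank m n = (((n == 0) && (m == 0%R)) +
  \sum_(b < n) \sum_(a < n) ((a%:Z - b%:Z)%R == m) *
     (if a < n then cnt b a.+1 (n - a.+1) else 0))%N.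
Proof.
rewrite Nrank_count /PL count_flatten_iota.
rewrite big_ord_recl; congr (_ + _)%N.
  rewrite count_filter /= addn0 /prank /= subr0 [0 == n]eq_sym [0%Z == m]eq_sym.
  by rewrite andbC.
apply: eq_bigr => b _; rewrite lift0 count_filter.
rewrite [boxp _ _]/boxp -/boxp count_flatten_iota.
apply: eq_bigr => a _; rewrite ltn_ord count_map.
case: (_ =P m) => [<-|ne]; rewrite ?mul1n ?mul0n /cnt.
  apply: eq_in_count => s hs /=; have hm := boxp_max hs.
  move: hs; rewrite mem_boxp => /and4P[/eqP e _ _ _].
  rewrite /prank hm /= e; apply/andP/eqP => [[_ /eqP h]|h]; first by lia.
  by split; [apply/eqP; lia | apply/eqP; have := ltn_ord a; lia].
apply/eqP; rewrite -leqn0 leqNgt -has_count; apply/hasPn => s hs /=.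
have hm := boxp_max hs.
move: hs; rewrite mem_boxp => /and4P[/eqP e _ _ _].
apply/negP => /andP[/eqP h _]; apply: ne; rewrite -h /prank hm /= e; lia.
Qed.

(* The number of partitions of n with rank at most i - n. *)
Definition rkle (n i : nat) : nat := (\sum_(l < n.+1) cnt l (l + i - n) n)%N.

Lemma Nrank_cumul n i : (\sum_(i' < i.+1) Nrank (i'%:Z - n%:Z) n)%N = rkle n i.
Proof.
transitivity (count (fun s => prank s <= i%:Z - n%:Z) (PL n)).
  have H s : s \in PL n -> - n%:Z <= prank s.
    move/flatten_mapP => [k]; rewrite mem_iota add0n => /andP[_ hk].
    rewrite mem_filter mem_boxp => /andP[_ /and4P[/eqP e _ _ _]].
    by rewrite /prank e; lia.
  under eq_bigr do rewrite Nrank_count.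
  elim: (PL n) H => [|s r IH] H; first by rewrite big1.
  rewrite /= big_split /= IH; last by move=> t ht; apply: H; rewrite inE ht orbT.
  congr (_ + _)%N; have := H s; rewrite inE eqxx => /(_ isT) h.
  case: lerP => h2.
    have hj : (`|(prank s + n%:Z)%R|%N < i.+1)%N by lia.
    rewrite (bigD1 (Ordinal hj)) //= (_ : _ == _ = true) ?big1 //; last by apply/eqP; lia.
    by move=> j; rewrite -val_eqE /= => /eqP hne; apply/eqP; rewrite eqb0; apply/eqP; lia.
  by rewrite big1 // => j _; apply/eqP; rewrite eqb0; apply/eqP; have := ltn_ord j; lia.
rewrite /PL count_flatten_iota.
apply: eq_bigr => l _; rewrite count_filter /cnt.
rewrite -!size_filter; apply: perm_size; apply: uniq_perm; rewrite ?filter_uniq ?uniq_boxp //.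
move=> s; rewrite !mem_filter !mem_boxp /=.
case: eqP => [hs|_]; rewrite ?andbF //=; case: eqP => [e|_]; rewrite ?andbF //=.
case: (sorted _ _); rewrite ?andbF //=; case: (all _ s); rewrite ?andbF //=.
have F M : all (fun x => x <= M)%N s = (foldr maxn 0%N s <= M)%N.
  by elim: (s) => //= x t ->; rewrite geq_max.
have hm : (foldr maxn 0%N s <= n)%N.
  rewrite -hs; elim: (s) => //= x t IH; rewrite geq_max leq_addr /=.
  by apply: leq_trans IH _; rewrite leq_addl.
(* Needed when l + i < n: the natural subtraction [l + i - n] is then 0, and a largest part 0 would
   force n = 0. *)
have hq : (n <= l * foldr maxn 0 s)%N.
  suff : (sumn s <= size s * foldr maxn 0 s)%N by rewrite hs e.
  elim: (s) => //= x t IH; rewrite mulSn leq_add ?leq_maxl //.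
  by apply: leq_trans IH _; rewrite leq_mul2l leq_maxr orbT.
rewrite !F hm andbT /prank e; move: (foldr _ _ _) hm hq => f hm hq.
by apply/idP/idP => h; nia.
Qed.

Section RankSeries.
Variable L : comNzRingType.
Local Notation gbq := (gb (psX 1 : ps L)).

(** Lowering each of the l parts by 1 leaves a partition in an l by M box; the proof compares the
    recurrences. *)
Lemma cnt_gb l M n : (cnt l M.+1 n)%:R = (psX l * gbq M l) n :> L.
Proof.
elim: l M n => [|l IHl] M n; first by rewrite cnt0 gbn0 mulr1 /psX.
elim: M n => [|M IHM] n.
  rewrite cntS cntS0 add0n gb0n mulr1 (psXD _ 1 l) psXM; case: leqP => //.
  by rewrite IHl gb0n mulr1.
rewrite cntS natrD IHM gbSS mulrDr psD psXX mul1n; congr (_ + _).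
have -> : psX l.+1 * (psX M.+1 * gbq M.+1 l) = psX M.+2 * (psX l * gbq M.+1 l).
  by rewrite !mulrA -!psXD; congr (psX _ * _); lia.
by rewrite psXM; case: leqP; rewrite ?IHl.
Qed.

(** The summation index is r = n - l with l the number of parts. In this form the sum is symmetric
    in n and i. *)
Lemma rkle_gb n i : (rkle n i.+1)%:R =
  \sum_(r < (n + i).+1 | (r <= n)%N && (r <= i)%N) gbq (i - r) (n - r) r.
Proof.
rewrite /rkle natr_sum (reindex_inj rev_ord_inj) /=.
rewrite (big_mkcond (fun r : 'I_(n + i).+1 => _)) /=.
rewrite -(big_mkord xpredT (fun r => (cnt (n.+1 - r.+1) (n.+1 - r.+1 + i.+1 - n) n)%:R)).
rewrite -(big_mkord xpredT (fun r => if (r <= n)%N && (r <= i)%N then gbq (i - r) (n - r) r else 0)).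
rewrite [RHS](@big_cat_nat _ _ _ n.+1) //=; last by lia.
rewrite [X in _ = _ + X]big_nat_cond [X in _ = _ + X]big1 ?addr0; last first.
  by move=> r /andP[/andP[h _] _]; rewrite ifF //; lia.
rewrite big_nat_cond [RHS]big_nat_cond; apply: eq_bigr => r /andP[/andP[_ h] _].
rewrite subSS; have -> /= : (r <= n)%N by lia.
case: leqP => hi.
  have -> : (n - r + i.+1 - n = (i - r).+1)%N by lia.
  by rewrite cnt_gb psXM leq_subr subKn //; lia.
have -> : (n - r + i.+1 - n = 0)%N by lia.
case e : (n - r)%N => [|k]; last by rewrite cntS0.
by rewrite cnt0; have -> : n == 0%N = false by lia.
Qed.

(** With a = z and b = q/z, [rkle n i] is the coefficient of a^i b^n in R/(1-z). So R/(1-z) is 1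
    plus a times a series symmetric under z -> q/z. *)
Lemma rkle_sym n i : (rkle n i.+1)%:R = (rkle i n.+1)%:R :> L.
Proof.
rewrite !rkle_gb addnC; apply: eq_big => [r|r _]; first by rewrite andbC.
by rewrite gb_sym.
Qed.

Lemma rkle0 n : rkle n 0 = (n == 0%N).
Proof.
case: n => [|n]; first by rewrite /rkle big_ord1.
rewrite /rkle big_ord_recr /= addn0 subnn cntS0 addn0 big1 // => l _.
have := ltn_ord l; rewrite ltnS => h; have -> : (l + 0 - n.+1 = 0)%N by lia.
by case: (nat_of_ord l) => [|k]; rewrite ?cnt0 ?cntS0.
Qed.

Lemma rkle_all n : (rkle n (2 * n))%:R = pinv (prodq L 1 1) n.
Proof.
have J0 : prodq L 1 1 0%N = 1 by exact: prodq0.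
have -> : (rkle n (2 * n))%:R = gbq n n n.
  rewrite /rkle natr_sum; case: n => [|n].
    by rewrite big_ord1 cnt0 gb0n ps1.
  transitivity ((\sum_(l < n.+2) psX l * gbq n l) n.+1).
    rewrite ps_sum; apply: eq_bigr => l _; rewrite -cnt_gb (@cnt_sat l) //; lia.
  have E k : \sum_(l < k.+1) psX l * gbq n l = gbq n.+1 k.
    elim: k => [|k IH]; first by rewrite big_ord1 psX_0 mul1r !gbn0.
    by rewrite big_ord_recr /= IH [RHS]gbSS' psXX mul1n.
  by rewrite E.
have h1 : eqt n (gbq n n * prodq L 1 1) 1.
  apply: eqt_trans (@gb_lim L 1 n n n isT (leqnn n) (leqnn n)).
  apply: eqt_mul => //; case: n => [|n].
    by move=> [|k] // _; rewrite J0 big_ord0 ps1.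
  apply: eqt_trans (prodq_eqt _ _ _ (_ : n.+1 < n.+1 + n.+1)%N) _ => //; first by lia.
  by apply: eqt_prod => i _; rewrite psXX !mul1n add1n.
have h2 : eqt n (gbq n n * prodq L 1 1 * pinv (prodq L 1 1)) (1 * pinv (prodq L 1 1)).
  by apply: eqt_mul.
by rewrite -mulrA pinvP // mulr1 mul1r in h2; apply: h2.
Qed.

(** Conjugation of partitions, seen on Gaussian binomials: with largest part a+1 and b+1 parts, the
    rest is counted by a binomial symmetric in a and b. *)
Lemma Nrank_sym m n : (Nrank m n)%:R = (Nrank (- m) n)%:R :> L.
Proof.
have H m' : (Nrank m' n)%:R = ((n == 0) && (m' == 0%R))%:R +
    \sum_(b < n) \sum_(a < n) ((a%:Z - b%:Z)%R == m')%:R *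
       (psX (a + b).+1 * gbq a b) n :> L.
  rewrite Nrank_head natrD natr_sum; congr (_ + _); apply: eq_bigr => b _.
  rewrite natr_sum; apply: eq_bigr => a _; rewrite natrM ltn_ord cnt_gb.
  by congr (_ * _); rewrite -addSn psXD -mulrA [RHS]psXM ltn_ord.
rewrite !H oppr_eq0; congr (_ + _); rewrite exchange_big /=; apply: eq_bigr => a _.
apply: eq_bigr => b _; rewrite addnC gb_sym; congr (_%:R * _).
by congr (nat_of_bool _); apply/eqP/eqP; lia.
Qed.
End RankSeries.

(** * The rank-crank differential equation from its two symmetries *)

(* @@G *)
Section PolySeries.
Variable L : comNzRingType.

Definition poly_ps (p : {poly L}) : ps L := fun i => p`_i.
Fact poly_ps_zmod_morphism : zmod_morphism poly_ps.
Proof. by move=> p r; apply: psP => n; rewrite /poly_ps coefB. Qed.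
Fact poly_ps_monoid_morphism : monoid_morphism poly_ps.
Proof.
split=> [|p r]; apply: psP => n; rewrite /poly_ps; first by rewrite coef1 ps1.
by rewrite coefM psM.
Qed.
HB.instance Definition _ :=
  GRing.isZmodMorphism.Build {poly L} (ps L) poly_ps poly_ps_zmod_morphism.
HB.instance Definition _ :=
  GRing.isMonoidMorphism.Build {poly L} (ps L) poly_ps poly_ps_monoid_morphism.

(* Writing a = z and b = q/z, the series sum p_n(a) b^n is symmetric under
   z -> 1/z, up to the factor z^w, when every p_n is palindromic of
   degree 2n + w. *)
Definition palin (d : nat) (p : {poly L}) :=
  forall i, p`_i = if (i <= d)%N then p`_(d - i) else 0.
Definition zsym (w : nat) (F : ps {poly L}) := forall n, palin (2 * n + w) (F n).

Lemma palin_sum d p : palin d p -> p = \sum_(i < d.+1) p`_i *: 'X^i.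
Proof.
move=> h; rewrite -poly_def; apply/polyP => j; rewrite coef_poly ltnS.
by case: leqP => hj //; rewrite h leqNgt hj.
Qed.

Lemma palin_rev d p : palin d p -> p = \sum_(i < d.+1) p`_i *: 'X^(d - i).
Proof.
move=> h; rewrite [LHS](palin_sum h) [RHS](reindex_inj rev_ord_inj) /=.
apply: eq_bigr => i _; have hi := ltn_ord i; rewrite ltnS in hi.
by rewrite subSS subKn // h hi.
Qed.

Lemma palin_mul d e p r : palin d p -> palin e r -> palin (d + e) (p * r).
Proof.
move=> hp hr k.
have E1 j : (p * r)`_j =
    \sum_(i < d.+1) \sum_(i' < e.+1) p`_i * r`_i' * (j == i + i')%N%:R.
  rewrite [in LHS](palin_sum hp) [in LHS](palin_sum hr) mulr_suml coef_sum.
  apply: eq_bigr => i _; rewrite mulr_sumr coef_sum; apply: eq_bigr => i' _.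
  by rewrite -scalerAl -scalerAr scalerA -exprD coefZ coefXn.
have E2 j : (p * r)`_j = \sum_(i < d.+1) \sum_(i' < e.+1)
    p`_i * r`_i' * (j == (d - i) + (e - i'))%N%:R.
  rewrite [in LHS](palin_rev hp) [in LHS](palin_rev hr) mulr_suml coef_sum.
  apply: eq_bigr => i _; rewrite mulr_sumr coef_sum; apply: eq_bigr => i' _.
  by rewrite -scalerAl -scalerAr scalerA -exprD coefZ coefXn.
case: leqP => hk.
  rewrite E1 E2; apply: eq_bigr => i _; apply: eq_bigr => i' _.
  congr (_ * _%:R); congr (nat_of_bool _).
  by have hi := ltn_ord i; have hi' := ltn_ord i'; apply/eqP/eqP; lia.
rewrite E1 big1 // => i _; rewrite big1 // => i' _.
have -> : (k == i + i')%N = false by have := ltn_ord i; have := ltn_ord i'; lia.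
by rewrite mulr0.
Qed.

Lemma palinD d p r : palin d p -> palin d r -> palin d (p + r).
Proof. by move=> hp hr i; rewrite !coefD hp hr; case: leqP; rewrite ?addr0. Qed.

Lemma zsymM w x F H : zsym w F -> zsym x H -> zsym (w + x) (F * H).
Proof.
move=> hF hH n; rewrite psM; elim/big_rec: _ => [|i p _ hp].
  by move=> k; rewrite !coef0 if_same.
apply: palinD hp; have -> : (2 * n + (w + x) = (2 * i + w) + (2 * (n - i) + x))%N.
  by have := ltn_ord i; lia.
exact: palin_mul.
Qed.

(* Symmetry under z -> q/z. *)
Definition absym (F : ps (ps L)) := forall i j, F i j = F j i.
Lemma absymM F H : absym F -> absym H -> absym (F * H).
Proof.
have E (F1 H1 : ps (ps L)) i j : (F1 * H1) i j =
    \sum_(k < i.+1) \sum_(l < j.+1) F1 k l * H1 (i - k)%N (j - l)%N.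
  by rewrite psM ps_sum; apply: eq_bigr => k _; rewrite psM.
move=> hF hH i j; rewrite !E exchange_big; apply: eq_bigr => k _.
by apply: eq_bigr => l _; rewrite hF hH.
Qed.

(* A series with both symmetries reduces to its z-term. *)
Lemma zsym_absym_term (F : ps {poly L}) (S : ps (ps L)) :
  zsym 2 F -> absym S -> (forall n i, (F n)`_i.+1 = S n i) ->
  (forall n, (F n)`_0 = 0) -> forall n, F n = (F n)`_n.+1 *: 'X^(n.+1).
Proof.
move=> hz hS hFS h0.
have shift n i : (F n)`_i.+1 = (F i)`_n.+1 by rewrite !hFS.
(* Swapping a and b, then reflecting, moves index n - e of row n to index n' - e of row n' = n - e -
   1; descent ends at index 0. *)
have low n : forall e, (F n)`_(n - e) = 0.
  elim/ltn_ind: n => n IH e; case: (leqP n e) => he.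
    by have -> : (n - e = 0)%N by lia.
  have -> : (n - e = (n - e).-1.+1)%N by lia.
  rewrite shift hz; case: leqP => // h.
  have -> : (2 * (n - e).-1 + 2 - n.+1 = (n - e).-1 - e)%N by lia.
  by apply: IH; lia.
move=> n; apply/polyP => i; rewrite coefZ coefXn.
case: ltngtP => hi; last by rewrite hi mulr1.
  by rewrite mulr0; have -> : (i = n - (n - i))%N by lia.
rewrite mulr0 hz; case: leqP => // h.
by have -> : (2 * n + 2 - i = n - (i - n - 2))%N by lia.
Qed.
End PolySeries.

Lemma sum_window (V : zmodType) (n : nat) (f : int -> V) (c : int) :
  (forall d : int, (n%:Z < d)%R -> f d = 0) ->
  (forall d : int, (d < - n%:Z)%R -> f d = 0) -> c \in [:: -1; 0; 1] ->
  \sum_(i < (2 * n).+3) f (i%:Z - 1 - n%:Z + c) =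
  \sum_(i < (2 * n).+1) f (i%:Z - n%:Z).
Proof.
move=> h1 h2; rewrite !inE => /or3P[] /eqP ->.
- rewrite 2!big_ord_recl [X in X + _]h2 /=; last by lia.
  rewrite [X in _ + (X + _)]h2 /=; last by rewrite /bump; lia.
  by rewrite !add0r; apply: eq_bigr => i _; congr f; rewrite /bump; lia.
- rewrite big_ord_recl [X in X + _]h2 /=; last by lia.
  rewrite big_ord_recr [X in _ + (_ + X)]h1 /=; last by rewrite /bump; lia.
  by rewrite add0r addr0; apply: eq_bigr => i _; congr f; rewrite /bump; lia.
rewrite 2!big_ord_recr /= [f ((2 * n).+2%:Z - 1 - n%:Z + 1)]h1; last by lia.
rewrite [f ((2 * n).+1%:Z - 1 - n%:Z + 1)]h1; last by lia.
by rewrite !addr0; apply: eq_bigr => i _; congr f; lia.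
Qed.

Section RankPde.
Variable L : comNzRingType.
Local Notation J := (prodq L 1 1).

(* phi = (zq)(q/z)(q) = sum_k (-1)^k (z^-k + ... + z^k) q^(k(k+1)/2). *)
Definition phip : ps {poly L} := fun n =>
  \sum_(k < n.+1 | tri k == n) (-1) ^+ k * \sum_(j < k.*2.+1) 'X^(n - k + j).

Definition NrL (d : int) (n : nat) : L := (Nrank d n)%:R.
Lemma NrL_sym d n : NrL (- d) n = NrL d n.
Proof. by rewrite /NrL -Nrank_sym. Qed.
Lemma NrL_big (d : int) n : n%:Z < d -> NrL d n = 0.
Proof.
move=> h; rewrite /NrL Nrank_head; have -> : (d == 0%R) = false by lia.
rewrite andbF add0n big1 // => b _; rewrite big1 // => a _.
by have -> : ((a%:Z - b%:Z)%R == d) = false by have := ltn_ord a; lia.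
Qed.
Lemma NrL_small (d : int) n : d < - n%:Z -> NrL d n = 0.
Proof. by move=> h; rewrite -NrL_sym NrL_big //; lia. Qed.

(* Up to a factor 2, (1-z)^3 times 3D + (1/2)delta + (1/2)delta^2 applied to
   R(z,q)/(1-z), where D = q d/dq and delta = z d/dz; [lcoef n d] is the
   coefficient of z^(d+1) q^n. *)
Definition lcoef (n : nat) (d : int) : L :=
  (6 * n%:Z + (d + 1) * (d + 2))%:~R * NrL (d + 1) n +
  (2 - 12 * n%:Z - 2 * d * d)%:~R * NrL d n +
  (6 * n%:Z + (d - 1) * (d - 2))%:~R * NrL (d - 1) n.
Definition lpol : ps {poly L} := fun n =>
  \poly_(i < (2 * n).+3) lcoef n (i%:Z - 1 - n%:Z).

Lemma lcoef_sym n d : lcoef n (- d) = lcoef n d.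
Proof.
rewrite /lcoef [LHS]addrC [X in _ + X = _]addrC addrA; congr (_ + _ + _).
- have -> : - d - 1 = - (d + 1) by ring.
  by rewrite NrL_sym; congr (_%:~R * _); ring.
- by rewrite NrL_sym; congr (_%:~R * _); ring.
- have -> : - d + 1 = - (d - 1) by ring.
  by rewrite NrL_sym; congr (_%:~R * _); ring.
Qed.
Lemma lcoef_big n d : (n%:Z + 1 < d) -> lcoef n d = 0.
Proof. by move=> h; rewrite /lcoef !NrL_big ?mulr0 ?addr0 //; lia. Qed.
Lemma lpolE n i : (lpol n)`_i = lcoef n (i%:Z - 1 - n%:Z).
Proof. by rewrite coef_poly; case: ltnP => // h; rewrite lcoef_big //; lia. Qed.

Lemma zsym_lpol : zsym 2 lpol.
Proof.
move=> n i; rewrite lpolE; case: leqP => h; last by rewrite lcoef_big //; lia.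
by rewrite lpolE -lcoef_sym; congr (lcoef _ _); lia.
Qed.

Lemma zsym_phip : zsym 0 phip.
Proof.
move=> n; rewrite addn0 /phip; elim/big_rec: _ => [|k p hk hp].
  by move=> i; rewrite !coef0 if_same.
apply: palinD hp => i.
have hkn : (k <= n)%N by have := ltn_ord k.
have E j : ((-1) ^+ k * \sum_(j < k.*2.+1) 'X^(n - k + j) : {poly L})`_j =
    (-1) ^+ k * ((n - k <= j)%N && (j <= n + k)%N)%:R.
  rewrite -[-1]/(- 1%:P) -rmorphN -rmorphXn /= coefCM; congr (_ * _).
  rewrite coef_sum; case: (boolP (_ && _)) => hj.
    have hj' : (j - (n - k) < k.*2.+1)%N by lia.
    rewrite (bigD1 (Ordinal hj')) //= coefXn subnKC ?eqxx; last by lia.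
    rewrite big1 ?addr0 // => j'; rewrite -val_eqE /= coefXn => h.
    by have -> : (j == n - k + j')%N = false by lia.
  rewrite big1 // => j' _; rewrite coefXn.
  by have -> : (j == n - k + j')%N = false by have := ltn_ord j'; lia.
rewrite !E; case: (leqP i (2 * n)) => h.
  by congr (_ * _%:R); congr nat_of_bool; lia.
have -> : (n - k <= i)%N && (i <= n + k)%N = false by lia.
by rewrite mulr0.
Qed.

(** The theta function (1 - z) phi = (z)(q/z)(q). Unlike phi, it is invariant under z -> q/z. *)
Definition theta2 : ps (ps L) := fun n i =>
  \sum_(k < n.+1 | tri k == n) (-1) ^+ k * ((i == n - k)%N%:R - (i == n + k.+1)%N%:R).

Lemma theta2E : psc (1 - psX 1) * psmapu (@poly_ps L) 1 phip = theta2.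
Proof.
apply: psP => n; rewrite pscM /psmapu expr1n mul1r /phip rmorph_sum mulr_sumr.
apply: psP => i; rewrite ps_sum; apply: eq_bigr => k hk.
have hkn : (k <= n)%N by have := ltn_ord k.
rewrite rmorphM rmorphXn rmorphN1 mulrCA.
rewrite ps_signM; congr (_ * _); rewrite rmorph_sum.
have eX m : poly_ps ('X^m) = psX m :> ps L.
  by apply: psP => j; rewrite /poly_ps coefXn.
rewrite (eq_bigr (fun j : 'I_k.*2.+1 => psX (n - k) * psX j)); last first.
  by move=> j _; rewrite -psXD -eX.
rewrite -mulr_sumr mulrCA.
have -> : (1 - psX 1) * \sum_(j < k.*2.+1) psX j = 1 - psX k.*2.+1 :> ps L.
  elim: k.*2.+1 => [|m IH]; first by rewrite big_ord0 psX_0 mulr0 subrr.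
  by rewrite big_ord_recr mulrDr IH mulrBl mul1r -psXD add1n addrA subrK.
have e : (n - k + k.*2.+1 = n + k.+1)%N by lia.
by rewrite mulrBr mulr1 -psXD psB e.
Qed.

Lemma absym_theta2 : absym theta2.
Proof.
pose F n i : L := \sum_(k < (n + i).+1) (-1) ^+ k.+1 *
  ((tri k.+1 == n) && (tri k == i))%:R.
have E n i : theta2 n i = ((n == 0) && (i == 0))%N%:R + F n i + F i n.
  have -> : theta2 n i = \sum_(k < (n + i).+2) (-1) ^+ k *
      ((tri k == n) && (i == n - k)%N)%:R +
      \sum_(k < (n + i).+1) (-1) ^+ k.+1 * ((tri k == n) && (i == n + k.+1)%N)%:R.
    have ext (f : nat -> L) N : (forall k, (n < k)%N -> f k = 0) -> (n < N)%N ->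
        \sum_(k < N) f k = \sum_(k < n.+1) f k.
      move=> hf hN; rewrite -!(big_mkord xpredT f) (@big_cat_nat _ _ _ n.+1) //=.
      rewrite [X in _ + X]big_nat_cond [X in _ + X]big1 ?addr0 // => k.
      by move=> /andP[/andP[h _] _]; apply: hf.
    have hk k : (n < k)%N -> (tri k == n) = false by have := tri_ge k; lia.
    rewrite (ext (fun k => (-1) ^+ k * ((tri k == n) && (i == n - k)%N)%:R));
      [|by move=> k /hk ->; rewrite mulr0|by lia].
    rewrite (ext (fun k => (-1) ^+ k.+1 * ((tri k == n) && (i == n + k.+1)%N)%:R));
      [|by move=> k /hk ->; rewrite mulr0|by lia].
    rewrite -big_split /theta2 big_mkcond; apply: eq_bigr => k _ /=.
    case: eqP => _ /=; last by rewrite !mulr0 addr0.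
    by rewrite mulrBr exprS; ring.
  rewrite big_ord_recl /= mul1r; congr (_ + _ + _).
  - by congr (nat_of_bool _)%:R; lia.
  - apply: eq_bigr => k _; rewrite /bump add1n ?add0n; congr (_ * (nat_of_bool _)%:R).
    by apply/andP/andP => -[/eqP h1 /eqP h2]; split; apply/eqP; move: h1 h2;
      rewrite ?triS; lia.
  rewrite /F addnC; apply: eq_bigr => k _; congr (_ * (nat_of_bool _)%:R).
  by apply/andP/andP => -[/eqP h1 /eqP h2]; split; apply/eqP; move: h1 h2;
    rewrite ?triS; lia.
by move=> n i; rewrite !E andbC addrAC.
Qed.

(** The eigenvalue of 6 D + delta + delta^2 on a^i b^n = z^(i-n) q^n. *)
Definition wt (n i : nat) : int :=
  6 * n%:Z + (i%:Z - n%:Z) * (i%:Z - n%:Z + 1).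
Definition Hser : ps (ps L) := fun n i => (wt n i)%:~R * (rkle n i)%:R.
Definition Hser' : ps (ps L) := fun n i => Hser n i.+1.

(** [wt n i.+1] is symmetric in n and i; this is where the coefficient 6 of D matters. *)
Lemma absym_Hser' : absym Hser'.
Proof.
move=> i j; rewrite /Hser' /Hser rkle_sym; congr (_%:~R * _).
by rewrite /wt; lia.
Qed.

Lemma HserE : Hser = psc (psX 1) * Hser'.
Proof.
apply: psP => n; rewrite pscM; apply: psP => -[|i]; rewrite psXM //=; last first.
  by rewrite subn1.
by rewrite /Hser rkle0; case: n => [|n]; rewrite ?mulr0 // /wt; ring.
Qed.

(** Identifies [lpol] with (1-z)^3 (6 D + delta + delta^2) R/(1-z): rank numbers are first
    differences of [rkle], so the coefficients on both sides agree. *)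
Lemma lpol_Hser : psc ((1 - psX 1) ^+ 3) * Hser = psmapu (@poly_ps L) 1 lpol.
Proof.
apply: psP => n; rewrite pscM /psmapu expr1n mul1r.
have rk i : NrL (i.+1%:Z - n%:Z) n = (rkle n i.+1)%:R - (rkle n i)%:R.
  rewrite -!Nrank_cumul big_ord_recr /= natrD addrAC subrr add0r //.
have rk0 : NrL (0%:Z - n%:Z) n = (rkle n 0)%:R.
  by rewrite -Nrank_cumul big_ord1.
have -> : (1 - psX 1) ^+ 3 * Hser n = Hser n - (psX 1 * Hser n) *+ 3 +
    (psX 2 * Hser n) *+ 3 - psX 3 * Hser n.
  by rewrite (psXD L 1 2) (psXD L 1 1); ring.
apply: psP => i; rewrite [RHS]/poly_ps lpolE !(psB, psD, psMn, psXM).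
have rkS j d : d = j.+1%:Z - n%:Z -> NrL d n = (rkle n j.+1)%:R - (rkle n j)%:R.
  by move=> ->; exact: rk.
have rkZ d : d = - n%:Z -> NrL d n = (rkle n 0)%:R.
  by move=> ->; rewrite -rk0 sub0r.
rewrite /lcoef /Hser /wt.
case: i => [|[|[|i]]] /=.
- rewrite rkZ; last by lia.
  rewrite !(@NrL_small _ n) ?mulr0; [|by lia|by lia].
  by rewrite !mul0rn !addr0 !subr0; congr (_%:~R * _); ring.
- rewrite (@rkS 0%N); last by lia.
  rewrite rkZ; last by lia.
  rewrite (@NrL_small _ n) ?mulr0; last by lia.
  by rewrite subnn; ring.
- rewrite (@rkS 1%N); last by lia.
  rewrite (@rkS 0%N); last by lia.
  rewrite rkZ; last by lia.
  by rewrite !subSS !subn0; ring.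
rewrite (@rkS i.+2); last by lia.
rewrite (@rkS i.+1); last by lia.
rewrite (@rkS i); last by lia.
rewrite !subSS !subn0.
have -> : i.+3%:Z = i%:Z + 3 by lia.
have -> : i.+2%:Z = i%:Z + 2 by lia.
have -> : i.+1%:Z = i%:Z + 1 by lia.
by ring.
Qed.

Lemma phip_one : psmapu (horner_eval (1 : L)) 1 phip = J ^+ 3.
Proof.
apply: eqt_all => N; apply: eqt_sym.
apply: eqt_trans (@jacobi_cube L N N.+1 (ltnSn N)) _ => n hn.
rewrite ps_sum /psmapu expr1n mul1r /phip rmorph_sum [RHS]big_mkcond /=.
rewrite -!(big_mkord xpredT (fun k => if tri k == n then horner_eval 1
  ((-1) ^+ k * \sum_(j < k.*2.+1) 'X^(n - k + j)) else (0 : L))).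
rewrite -!(big_mkord xpredT (fun k => ((-1) ^+ k * k.*2.+1%:R * psX (tri k) : ps L) n)).
rewrite (@big_cat_nat _ _ _ n.+1) //=; last by lia.
rewrite [X in _ + X]big_nat_cond [X in _ + X]big1 ?addr0; last first.
  move=> k /andP[/andP[h _] _]; rewrite -mulrA ps_signM ps_natM /psX.
  have -> : (n == tri k) = false by have := tri_ge k; lia.
  by rewrite !mulr0.
apply: eq_bigr => k _; rewrite -mulrA ps_signM ps_natM /psX eq_sym.
case: eqP => _; last by rewrite !mulr0.
rewrite mulr1 rmorphM rmorphXn rmorphN1; congr (_ * _).
rewrite rmorph_sum; under eq_bigr do rewrite /= /horner_eval hornerXn expr1n.
by rewrite sumr_const card_ord.
Qed.

(** At z = 1 the three weights attached to one rank add up to 2, so L(1) = 2 sum p(n) q^n. *)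
Lemma lpol_one : psmapu (horner_eval (1 : L)) 1 lpol = pinv J *+ 2.
Proof.
apply: psP => n; rewrite /psmapu expr1n mul1r psMn -rkle_all.
rewrite /horner_eval -Nrank_cumul natr_sum.
have -> : (lpol n).[1] = \sum_(i < (2 * n).+3) lcoef n (i%:Z - 1 - n%:Z).
  rewrite /lpol poly_def horner_sum; apply: eq_bigr => i _.
  by rewrite hornerZ hornerXn expr1n mulr1.
rewrite /lcoef !big_split /=.
pose f1 (d : int) := (6 * n%:Z + d * (d + 1))%:~R * NrL d n.
pose f2 (d : int) := (2 - 12 * n%:Z - 2 * d * d)%:~R * NrL d n.
pose f3 (d : int) := (6 * n%:Z + d * (d - 1))%:~R * NrL d n.
have Fz (g : int -> L) : (forall d : int, (n%:Z < d)%R -> g d * NrL d n = 0) /\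
    (forall d : int, (d < - n%:Z)%R -> g d * NrL d n = 0).
  by split=> d h; rewrite ?(NrL_big h) ?(NrL_small h) mulr0.
rewrite (eq_bigr (fun i : 'I_(2 * n).+3 => f1 (i%:Z - 1 - n%:Z + 1))); last first.
  by move=> i _; rewrite /f1; congr (_%:~R * _); ring.
rewrite [X in _ + X + _](eq_bigr (fun i : 'I_(2 * n).+3 => f2 (i%:Z - 1 - n%:Z + 0)));
  last by move=> i _; rewrite addr0.
rewrite [X in _ + _ + X](eq_bigr (fun i : 'I_(2 * n).+3 => f3 (i%:Z - 1 - n%:Z - 1)));
  last by move=> i _; rewrite /f3; congr (_%:~R * _); ring.
rewrite !sum_window; try by [apply: (Fz _).1 | apply: (Fz _).2 | rewrite !inE].
rewrite -!big_split -sumrMnl; apply: eq_bigr => i _ /=.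
by rewrite /f1 /f2 /f3 /NrL; ring.
Qed.

(** The Atkin-Garvan equation phi^3 L = 2 z J^8. The symmetries leave only z c(q), and z = 1 gives c
    = J^9 times 2/J. *)
Lemma lpol_phip n :
  (phip ^+ 3 * lpol) n = ((J ^+ 8) n *+ 2) *: 'X^(n.+1).
Proof.
have J0 : J 0%N = 1 by exact: prodq0.
set G := phip ^+ 3 * lpol.
(* The factor (1-z)^3 in L turns phi^3 into theta2^3, which makes the symmetry in a and b
   visible. *)
have GS : psmapu (@poly_ps L) 1 G = psc (psX 1) * (theta2 ^+ 3 * Hser').
  rewrite /G rmorphM rmorphXn /= -lpol_Hser HserE -theta2E exprMn.
  have -> : psc ((1 - psX 1) ^+ 3) = psc (1 - psX 1) ^+ 3 :> ps (ps L).
    by apply: psP => k; rewrite !exprS expr0 !mulr1 !pscM /psc; case: eqP; rewrite ?mulr0.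
  by ring.
have GE m i : (G m)`_i = (psX 1 * (theta2 ^+ 3 * Hser') m) i.
  by rewrite -pscM -GS /psmapu expr1n mul1r.
have Gt : forall m, G m = (G m)`_m.+1 *: 'X^(m.+1).
  apply: (@zsym_absym_term _ _ (theta2 ^+ 3 * Hser')).
  - by rewrite /G; apply: (@zsymM _ 0 2) zsym_lpol; rewrite !exprS expr0 mulr1;
      do !apply: (@zsymM _ 0 0); exact: zsym_phip.
  - apply: absymM absym_Hser'; rewrite !exprS expr0 mulr1.
    by do !apply: absymM; exact: absym_theta2.
  - by move=> m i; rewrite GE psXM /= subn1.
  - by move=> m; rewrite GE psXM.
have G1 : psmapu (horner_eval (1 : L)) 1 G = J ^+ 8 *+ 2.
  rewrite /G rmorphM rmorphXn /= phip_one lpol_one mulrnAr; congr (_ *+ 2).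
  by rewrite -exprM (exprS J 8) mulrAC pinvP // mul1r.
rewrite Gt; congr (_ *: _).
have := congr1 (fun f : ps L => f n) G1; rewrite /psmapu expr1n mul1r psMn => <-.
by rewrite [in RHS]Gt /horner_eval hornerZ hornerXn expr1n mulr1.
Qed.
End RankPde.

(** * Ramanujan's differential relations modulo 11 *)

(* @@X *)
Section Closure.
Variable R : comNzRingType.
Variable D : {additive R -> R}.
Hypothesis c11 : 11%:R = 0 :> R.
Hypothesis DM : forall a b, D (a * b) = D a * b + a * D b.
Variable e : R.
(** For e = E2 this is E4, as 12 D E2 = E2^2 - E4 and 12 = 1 modulo 11. Likewise [cl_s] is E6, from
    3 D E4 = E2 E4 - E6, and [y] below is E4^2, from 2 D E6 = E2 E6 - E4^2. *)
Definition cl_x : R := e * e - D e.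
Definition cl_s : R := e * cl_x - 3%:R * D cl_x.

(** The explicit quotient [W] lets [ring] decide congruences modulo 11. *)
Lemma mod11 (W a b : R) : a = b + 11%:R * W -> a = b.
Proof. by rewrite c11 mul0r addr0. Qed.

Lemma mod11_mod (W c p q a b : R) :
  p = q -> a = b + c * (p - q) + 11%:R * W -> a = b.
Proof. by move=> ->; rewrite subrr mulr0 addr0; exact: mod11. Qed.

Lemma D_nat k : D k%:R = 0.
Proof.
have D1 : D 1 = 0.
  have := DM 1 1; rewrite !mulr1 mul1r => h.
  by apply/(addrI (D 1)); rewrite addr0 -h.
by elim: k => [|k IH]; rewrite ?raddf0 // -addn1 natrD raddfD /= IH D1 addr0.
Qed.

Local Notation x := cl_x.
Local Notation s := cl_s.
Local Notation y := (e * s - 2%:R * D s).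

(* Weight-10 and weight-12 relations coming from Jacobi's and Euler's series. *)
Hypothesis jac : iter 5 (fun F => 8%:R * D F + e * F) 1 = 1.
Hypothesis eul : iter 6 (fun F => 2%:R * D F + e * F) 1 = e.
Hypothesis reg : forall a,
  a * (3%:R * x * x * x * s + 7%:R * x * x + 9%:R * s * s * s) = 0 -> a = 0.

(** These are E10 = E4 E6 = 1 and E2 = E12 modulo 11, obtained by pure differential algebra. The
    weight-10 relation gives D y, the weight-12 relation then expresses e through x, s and y, and
    two further differentiations yield a regular multiple of x s - 1 that vanishes. *)
Lemma closure : x * s = 1 /\ e = 5%:R * x * x * x + 7%:R * s * s.
Proof.
have De : D e = e * e - x by rewrite /cl_x; ring.
have Dx : D x = 4%:R * (e * x - s).
  by apply: (@mod11 (- D x)); rewrite /cl_s; ring.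
have Ds : D s = 6%:R * (e * s - y).
  by apply: (@mod11 (- D s)); ring.
move: jac eul reg Ds; move: y => y0.
move: De Dx; move: (cl_x) (cl_s) => X S De Dx jac' eul' reg' Ds.
have [w Dy] : exists w, D y0 = w by exists (D y0).
have [u Dw] : exists u, D w = u by exists (D w).
pose rules := (raddfD D, raddfB D, raddfN D, DM, D_nat, De, Dx, Ds, Dy, Dw).
(* Each rewriting is one more iterate of 8 D + e on 1, brought to normal form modulo 11. *)
have J5 : 9%:R * e * y0 + 3%:R * X * S + 3%:R * w = 1.
  apply: etrans jac'; rewrite /=.
  have D1 : D 1 = 0 by exact: (D_nat 1).
  have -> : 8%:R * D 1 + e * 1 = e by rewrite D1; ring.
  have -> : 8%:R * D e + e * e = 9%:R * e * e + 3%:R * X.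
    by apply: (@mod11 (- X)); rewrite De; ring.
  have -> : 8%:R * D (9%:R * e * e + 3%:R * X) + e * (9%:R * e * e + 3%:R * X) =
      10%:R * e * e * e + 10%:R * e * X + 3%:R * S.
    apply: (@mod11 (13%:R * e * e * e - 5%:R * e * X - 9%:R * S)).
    by rewrite !rules; ring.
  set F3 := 10%:R * _ * _ * _ + _ + _.
  have -> : 8%:R * D F3 + e * F3 = 8%:R * e * e * e * e + 5%:R * e * e * X +
      3%:R * e * S + 8%:R * X * X + 10%:R * y0.
    apply: (@mod11 (22%:R * e * e * e * e + 15%:R * e * e * X - 16%:R * e * S -
      8%:R * X * X - 14%:R * y0)).
    by rewrite /F3 !rules; ring.
  set F4 := 8%:R * _ * _ * _ * _ + _ + _ + _ + _.
  symmetry; apply: (@mod11 (24%:R * e * e * e * e * e - 1%:R * e * e * e * X +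
    1%:R * e * e * S + 40%:R * e * X * X - 13%:R * e * y0 - 49%:R * X * S + 7%:R * w)).
  by rewrite /F4 !rules; ring.
have wE : w = 8%:R * e * y0 - X * S + 4%:R.
  by apply: (mod11_mod (W := - (4%:R * e * y0) - X * S - w) (c := 4%:R) J5); ring.
have uE : u = 72%:R * e * e * y0 - 18%:R * e * X * S + 32%:R * e - 2%:R * X * y0 +
    4%:R * S * S.
  by rewrite -Dw {1}wE !rules wE; ring.
have E6 : e * e * y0 + 8%:R * e * w + X * X * X + X * y0 + 9%:R * S * S + 2%:R * u = e.
  rewrite -[RHS]eul' /=.
  have D1 : D 1 = 0 by exact: (D_nat 1).
  have -> : 2%:R * D 1 + e * 1 = e by rewrite D1; ring.
  have -> : 2%:R * D e + e * e = 3%:R * e * e + 9%:R * X.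
    by apply: (@mod11 (- X)); rewrite De; ring.
  have -> : 2%:R * D (3%:R * e * e + 9%:R * X) + e * (3%:R * e * e + 9%:R * X) =
      4%:R * e * e * e + 3%:R * e * X + 5%:R * S.
    apply: (@mod11 (e * e * e + 6%:R * e * X - 7%:R * S)).
    by rewrite !rules; ring.
  set F3 := 4%:R * _ * _ * _ + _ + _.
  have -> : 2%:R * D F3 + e * F3 = 6%:R * e * e * e * e + 9%:R * e * e * X +
      8%:R * e * S + 5%:R * X * X + 6%:R * y0.
    apply: (@mod11 (2%:R * e * e * e * e + 3%:R * e * S - X * X - 6%:R * y0)).
    by rewrite /F3 !rules; ring.
  set F4 := 6%:R * _ * _ * _ * _ + _ + _ + _ + _.
  have -> : 2%:R * D F4 + e * F4 = 10%:R * e * e * e * e * e + 3%:R * e * e * e * X +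
      4%:R * e * e * S + 5%:R * e * X * X + 9%:R * e * y0 + 3%:R * X * S + w.
    apply: (@mod11 (4%:R * e * e * e * e * e + 6%:R * e * e * e * X +
      4%:R * e * e * S + 4%:R * e * X * X - 9%:R * e * y0 - 9%:R * X * S + w)).
    by rewrite /F4 !rules; ring.
  set F5 := 10%:R * _ * _ * _ * _ * _ + _ + _ + _ + _ + _ + _.
  symmetry; apply: (@mod11 (10%:R * e * e * e * e * e * e - 5%:R * e * e * e * e * X +
    4%:R * e * e * e * S + 7%:R * e * e * X * X - 2%:R * e * e * y0 -
    3%:R * e * X * S + e * w - X * X * X - 5%:R * X * y0 - 3%:R * S * S)).
  by rewrite /F5 !rules; ring.
have eE : e = 3%:R * X * X * X + 2%:R * X * y0 + 7%:R * S * S.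
  rewrite uE wE in E6.
  by apply: (mod11_mod (W := 57%:R * e * e * y0 - 12%:R * e * X * S + 26%:R * e -
    X * y0 + 4%:R * S * S) (c := - 3%:R) E6); ring.
(* Differentiate the formula [eE] and compare with D e = e^2 - X. *)
have R1 : S * y0 = 5%:R * X + 7%:R * X * X * S.
  have h : e * e - X = 9%:R * X * X * (4%:R * (e * X - S)) + 2%:R *
     (4%:R * (e * X - S) * y0 + X * w) + 14%:R * S * (6%:R * (e * S - y0)).
    by rewrite -De {1}eE !rules; ring.
  rewrite wE eE in h.
  apply: (mod11_mod (c := 3%:R) (W := 27%:R * X * X * X * X * X * X +
    36%:R * X * X * X * X * y0 + 126%:R * X * X * X * S * S - 11%:R * X * X * S +
    12%:R * X * X * y0 * y0 + 84%:R * X * S * S * y0 + 2%:R * X +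
    147%:R * S * S * S * S - 25%:R * S * y0) h).
  by ring.
have DR1 : 6%:R * (e * S - y0) * y0 + S * w = 5%:R * (4%:R * (e * X - S)) +
    7%:R * (2%:R * X * S * (4%:R * (e * X - S)) + X * X * (6%:R * (e * S - y0))).
  have := congr1 D R1; rewrite !rules => ->; ring.
(* Differentiate [R1], multiply by S^2 and eliminate [y0] through [R1]: what remains is X S - 1
   times the regular factor of [reg]. *)
have xs1 : X * S = 1.
  apply/eqP; rewrite -subr_eq0; apply/eqP; apply: reg'.
  rewrite wE eE in DR1.
  have DR2 : S * S * (6%:R * ((3%:R * X * X * X + 2%:R * X * y0 + 7%:R * S * S) * S - y0) * y0 + S * (8%:R * (3%:R * X * X * X + 2%:R * X * y0 + 7%:R * S * S) * y0 - X * S + 4%:R)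
    - (5%:R * (4%:R * ((3%:R * X * X * X + 2%:R * X * y0 + 7%:R * S * S) * X - S)) +
    7%:R * (2%:R * X * S * (4%:R * ((3%:R * X * X * X + 2%:R * X * y0 + 7%:R * S * S) * X - S)) + X * X * (6%:R * ((3%:R * X * X * X + 2%:R * X * y0 + 7%:R * S * S) * S - y0))))) = 0.
    by rewrite DR1; ring.
  apply: (mod11_mod (c := 1) (W := - (77%:R * X * X * X * X * S * S +
    26%:R * X * X * X * S - 13%:R * X * X + 36%:R * X * S * S * S * S +
    3%:R * S * S * S)) DR2).
  apply: (mod11_mod (c := - (42%:R * X * X * X * S * S + 100%:R * X * X * S +
    28%:R * X * S * S * y0 - 30%:R * X + 98%:R * S * S * S * S - 6%:R * S * y0))
    (W := 0) R1).
  by ring.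
split=> //.
have yE : y0 = X * X.
  have sy : S * y0 = X.
    by rewrite R1 -[7%:R * X * X * S]mulrA xs1; apply: (@mod11 X); ring.
  by rewrite -[LHS]mul1r -xs1 -mulrA sy.
rewrite eE yE; ring.
Qed.
End Closure.

(** * E2, E4 and E6 as q-series modulo 11 *)

(* @@Y *)
Local Notation K := 'F_11.
Local Notation D := (@psD1 K).
Definition J : ps K := prodq K 1 1.
Definition Ji : ps K := pinv J.
(** E2 = 1 + 24 D J / J, with 24 = 2 modulo 11. Accordingly [x4] and [s4] are the reductions of E4
    and E6. *)
Definition e2 : ps K := 1 + 2%:R * D J * Ji.
Definition x4 : ps K := cl_x D e2.
Definition s4 : ps K := cl_s D e2.

Lemma K11 : 11%:R = 0 :> K.
Proof. by apply: pcharf0; rewrite pchar_Fp. Qed.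
Lemma c11 : 11%:R = 0 :> ps K.
Proof. by apply: psP => n; rewrite psnat K11; case: ifP. Qed.
Lemma natK_mod m : (m %% 11)%:R = m%:R :> K.
Proof. by rewrite [in RHS](divn_eq m 11) natrD natrM K11 mulr0 add0r. Qed.
Lemma natF_mod m : (m %% 11)%:R = m%:R :> ps K.
Proof. by rewrite [in RHS](divn_eq m 11) natrD natrM c11 mulr0 add0r. Qed.
Lemma fermat11 (a : K) : a ^+ 11 = a.
Proof. by have := expf_card a; rewrite card_Fp. Qed.

Lemma J0 : J 0%N = 1. Proof. exact: prodq0. Qed.
Lemma JJi : J * Ji = 1. Proof. exact: pinvP J0. Qed.
Lemma DJ : D J = 6%:R * J * (e2 - 1).
Proof.
have -> : 6%:R * J * (e2 - 1) = 12%:R * D J * (J * Ji) by rewrite /e2; ring.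
by rewrite JJi mulr1; apply: (mod11 (W := - D J) c11); ring.
Qed.

Lemma unit_inj (R : comNzRingType) (u v a b : R) : v * u = 1 -> u * a = u * b -> a = b.
Proof. by move=> h e; rewrite -[a]mul1r -h -mulrA e mulrA h mul1r. Qed.

Lemma ps_reg (f a : ps K) : f 0%N != 0 -> a * f = 0 -> a = 0.
Proof.
move=> f0 h; have u0 : (psc (f 0%N)^-1 * f) 0%N = 1 by rewrite pscM mulVf.
by rewrite -[a]mulr1 -(pinvP u0) mulrA mulrCA h mulr0 mul0r.
Qed.

Lemma D0 (f : ps K) : D f 0%N = 0. Proof. by rewrite /psD1 mulr0n. Qed.
Lemma e2_0 : e2 0%N = 1.
Proof. by rewrite /e2 psD ps1 !psM0 D0 mulr0 mul0r addr0. Qed.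
Lemma x4_0 : x4 0%N = 1.
Proof. by rewrite /x4 /cl_x psB psM0 e2_0 /= D0 subr0 mulr1. Qed.
Lemma s4_0 : s4 0%N = 1.
Proof. by rewrite /s4 /cl_s psB !psM0 e2_0 /= D0 -/x4 x4_0 mulr0 subr0 mulr1. Qed.

(** Conjugation by M turns c D + e into c D + 1, which multiplies q^k by ck + 1. *)
Lemma iter_conj (c : nat) (M e : ps K) n : c%:R * D M = M * (e - 1) ->
  iter n (fun f => c%:R * D f + f) M = M * iter n (fun F => c%:R * D F + e * F) 1.
Proof.
move=> h; elim: n => [|n IH]; first by rewrite mulr1.
rewrite !iterS IH; set F := iter n _ 1; rewrite psD1M mulrDr mulrA h; ring.
Qed.
Lemma iter_coef c (f : ps K) n k :
  iter n (fun f => c%:R * D f + f) f k = (c * k).+1%:R ^+ n * f k.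
Proof.
elim: n => [|n IH]; first by rewrite mul1r.
by rewrite iterS psD ps_natM /psD1 IH exprS -mulrnAl -[_ *+ k]mulr_natr -[(c * k).+1]addn1 natrD natrM; ring.
Qed.

(** On Jacobi's series for J^3, 8 D + 1 multiplies the j-th term by 8 j(j+1)/2 + 1 = (2j+1)^2. Five
    iterations turn its coefficient 2j+1 into (2j+1)^11, and Fermat applies. *)
Lemma jac_rel : iter 5 (fun F => 8%:R * D F + e2 * F) 1 = 1.
Proof.
have DJ3 : 8%:R * D (J ^+ 3) = J ^+ 3 * (e2 - 1).
  by rewrite psD1_exp DJ; apply: (mod11 (W := 13%:R * J ^+ 3 * (e2 - 1)) c11); ring.
have J3 : pinv (J ^+ 3) * J ^+ 3 = 1.
  by rewrite mulrC; apply: pinvP; rewrite psX0 J0 expr1n.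
apply: (unit_inj J3); rewrite -(iter_conj _ DJ3) mulr1; apply: eqt_all => n k hk.
rewrite iter_coef (jacobi_cube K (ltnSn n) hk) ps_sum mulr_sumr.
apply: eq_bigr => j _; rewrite -mulrA ps_signM ps_natM /psX.
case: eqP => [->|_]; last by rewrite !mulr0.
have -> : (8 * tri j).+1 = (j.*2.+1 ^ 2)%N by have := tri2 j; nia.
rewrite natrX -exprM mulr1 mulrCA; congr (_ * _).
by rewrite mulrC -exprS fermat11.
Qed.

(** For a pentagonal exponent w, 24 w + 1 is a square, so 2 w + 1 is a square modulo 11 and equals
    its own sixth power: on Euler's series six iterations act as one. *)
Lemma eul_rel : iter 6 (fun F => 2%:R * D F + e2 * F) 1 = e2.
Proof.
have DJ1 : 2%:R * D J = J * (e2 - 1).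
  by rewrite DJ; apply: (mod11 (W := J * (e2 - 1)) c11); ring.
have h : iter 6 (fun f => 2%:R * D f + f) J = iter 1 (fun f => 2%:R * D f + f) J.
  apply: eqt_all => n k hk; rewrite !iter_coef.
  have -> : J = prodq K 1 3 * prodq K 2 3 * prodq K 3 3.
    by rewrite /J (@prodq_split _ 3) // !big_ord_recl big_ord0 mulr1 mulrA.
  rewrite (@jacobi_triple K n n.+1 1 2 isT isT (ltnSn n) k hk) /thetaN.
  have P (y m : nat) : (24 * m).+1 = (y ^ 2)%N ->
      (2 * m).+1%:R ^+ 6 = (2 * m).+1%:R :> K.
    move=> e; have -> : (2 * m).+1%:R = y%:R ^+ 2 :> K.
      rewrite -natrX -e -[RHS]natK_mod -[LHS]natK_mod; congr _%:R.
      by rewrite -(modnMDl (2 * m) (2 * m).+1); congr (_ %% _)%N; lia.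
    by rewrite -exprM -[(2 * 6)%N]/(11.+1) exprS fermat11 expr2.
  rewrite expr1 psD !ps_sum !mulrDr !mulr_sumr; congr (_ + _); apply: eq_bigr => j _;
    rewrite ps_signM /psX; (case: eqP => [->|_]; last by rewrite !mulr0);
    congr (_ * _).
    case: (nat_of_ord j) => [|i]; first by rewrite /= muln0 expr1n.
    by apply: (P (6 * i + 5)%N); rewrite triS /=; have := tri2 i; nia.
  by apply: (P (6 * j + 7)%N); rewrite triS; have := tri2 j; nia.
have u : J * Ji = 1 by exact: JJi.
rewrite !(iter_conj _ DJ1) in h.
have {}h := unit_inj (etrans (mulrC _ _) u) h.
have D1 : D 1 = 0 by exact: psD1_1.
by rewrite h /= D1; ring.
Qed.

(** Regularity holds because the factor has constant term 3 + 7 + 9 = 19, a unit modulo 11. *)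
Lemma Ig_rel : x4 * s4 = 1 /\ e2 = 5%:R * x4 * x4 * x4 + 7%:R * s4 * s4.
Proof.
apply: (closure c11 (@psD1M K) jac_rel eul_rel) => a.
by apply: ps_reg; rewrite !psD !psM0 !psnat -/x4 -/s4 x4_0 s4_0 !mulr1.
Qed.
Lemma x4s4 : x4 * s4 = 1. Proof. by case: Ig_rel. Qed.
Lemma e2E : e2 = 5%:R * x4 * x4 * x4 + 7%:R * s4 * s4. Proof. by case: Ig_rel. Qed.
(** D E4 = (E2 E4 - E6)/3 with E2 eliminated; so F_11[x,1/x] is stable under D. *)
Lemma Dx4 : D x4 = s4 * (9%:R * x4 ^+ 5 + 2%:R).
Proof.
have h : D x4 = 4%:R * (e2 * x4 - s4).
  by apply: (mod11 (W := - D x4) c11); rewrite [s4]/cl_s -/x4; ring.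
rewrite h e2E.
have -> : 4%:R * ((5%:R * x4 * x4 * x4 + 7%:R * s4 * s4) * x4 - s4) =
  20%:R * x4 ^+ 4 + 28%:R * s4 * (x4 * s4) - 4%:R * s4 by ring.
have -> : s4 * (9%:R * x4 ^+ 5 + 2%:R) = 9%:R * (x4 * s4) * x4 ^+ 4 + 2%:R * s4 by ring.
by rewrite x4s4; apply: (mod11 (W := x4 ^+ 4 + 2%:R * s4) c11); ring.
Qed.

(** * Verified computation with Laurent polynomials in E4 *)

(* @@W *)
(* Computation in F_11[x, 1/x]: [(k, p)] stands for x^-k sum_i p_i x^i. *)
Definition rd (c : N) : N := N.modulo c 11.
Fixpoint nadd (p r : seq N) : seq N :=
  match p, r with
  | [::], _ => r
  | _, [::] => p
  | a :: p', b :: r' => rd (N.add a b) :: nadd p' r'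
  end.
Definition nscale (c : N) (p : seq N) : seq N := [seq rd (N.mul c a) | a <- p].
Fixpoint nmul (p r : seq N) : seq N :=
  if p is a :: p' then nadd (nscale a r) (0%num :: nmul p' r) else [::].
(** The operator x d/dx on x^c p, with the factor x^c left out. *)
Fixpoint nth0 (c : N) (p : seq N) : seq N :=
  if p is a :: p' then rd (N.mul c a) :: nth0 (rd (N.succ c)) p' else [::].
Definition nzero (p : seq N) : bool := all (fun c => N.eqb (rd c) 0) p.

Definition lp : Type := nat * seq N.
Definition ladd (a b : lp) : lp :=
  let k := maxn a.1 b.1 in
  (k, nadd (ncons (k - a.1) 0%num a.2) (ncons (k - b.1) 0%num b.2)).
Definition lscale (c : N) (a : lp) : lp := (a.1, nscale c a.2).
Definition lmul (a b : lp) : lp := ((a.1 + b.1)%N, nmul a.2 b.2).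
Definition lone : lp := (0%N, [:: 1%num]).
Definition lpow (a : lp) (n : nat) : lp := iter n (lmul a) lone.
(** D is D x / x = x^-2 (9 x^5 + 2) times x d/dx; the starting index 10 k stands for -k. *)
Definition lD (a : lp) : lp :=
  (a.1.+2, nmul [:: 2; 0; 0; 0; 0; 9]%num (nth0 (N.mul 10 (N.of_nat a.1)) a.2)).
Definition leqb (a b : lp) : bool := nzero (ladd a (lscale 10 b)).2.

Section Eval.
Variable R : comNzRingType.
Hypothesis R11 : 11%:R = 0 :> R.
Variables x s : R.
Hypothesis xs : x * s = 1.

Definition cN (c : N) : R := (N.to_nat c)%:R.
Fixpoint nev (p : seq N) : R := if p is a :: p' then cN a + x * nev p' else 0.
Definition lev (a : lp) : R := s ^+ a.1 * nev a.2.

Lemma cN_rd c : cN (rd c) = cN c.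
Proof.
have e : c = N.add (N.mul 11 (N.div c 11)) (rd c) by rewrite /rd -N.Div0.div_mod.
rewrite /cN [in RHS]e N2Nat.inj_add N2Nat.inj_mul plusE multE natrD natrM.
have -> : (N.to_nat 11)%:R = 0 :> R by rewrite -R11.
by rewrite mul0r add0r.
Qed.
Lemma cND a b : cN (N.add a b) = cN a + cN b.
Proof. by rewrite /cN N2Nat.inj_add plusE natrD. Qed.
Lemma cNM a b : cN (N.mul a b) = cN a * cN b.
Proof. by rewrite /cN N2Nat.inj_mul multE natrM. Qed.
Lemma cNS a : cN (N.succ a) = cN a + 1.
Proof. by rewrite -N.add_1_r cND. Qed.

Lemma nev_add p r : nev (nadd p r) = nev p + nev r.
Proof.
elim: p r => [|a p IH] [|b r] /=; rewrite ?add0r ?addr0 //.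
by rewrite IH cN_rd cND; ring.
Qed.
Lemma nev_scale c p : nev (nscale c p) = cN c * nev p.
Proof. by elim: p => [|a p IH] /=; rewrite ?mulr0 // IH cN_rd cNM; ring. Qed.
Lemma nev_mul p r : nev (nmul p r) = nev p * nev r.
Proof.
elim: p => [|a p IH] /=; first by rewrite mul0r.
by rewrite nev_add nev_scale /= IH /cN /=; ring.
Qed.
Lemma nev_zero p : nzero p -> nev p = 0.
Proof.
elim: p => //= a p IH /andP[/N.eqb_spec h /IH ->].
by rewrite -cN_rd h /cN /= mulr0 addr0.
Qed.
Lemma nev_ncons n p : nev (ncons n 0%num p) = x ^+ n * nev p.
Proof.
elim: n => [|n IH] /=; first by rewrite mul1r.
by rewrite IH exprS /cN /=; ring.
Qed.

Lemma xs_exp k m : (k <= m)%N -> s ^+ m * x ^+ (m - k) = s ^+ k.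
Proof.
move=> h; rewrite -{1}(subnKC h) exprD -mulrA -exprMn [s * x]mulrC xs.
by rewrite expr1n mulr1.
Qed.
Lemma lev_add a b : lev (ladd a b) = lev a + lev b.
Proof.
rewrite /lev /ladd /= nev_add !nev_ncons mulrDr !mulrA.
by rewrite !xs_exp // leq_max leqnn ?orbT.
Qed.
Lemma lev_scale c a : lev (lscale c a) = cN c * lev a.
Proof. by rewrite /lev /lscale /= nev_scale; ring. Qed.
Lemma lev_mul a b : lev (lmul a b) = lev a * lev b.
Proof. by rewrite /lev /lmul /= nev_mul exprD; ring. Qed.
Lemma lev_one : lev lone = 1.
Proof. by rewrite /lev /= mulr0 addr0 mulr1. Qed.
Lemma lev_pow a n : lev (lpow a n) = lev a ^+ n.
Proof. by elim: n => [|n IH]; rewrite ?lev_one // /lpow iterS lev_mul IH exprS. Qed.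
Lemma lev_eq a b : leqb a b -> lev a = lev b.
Proof.
move=> /nev_zero h; have : lev (ladd a (lscale 10 b)) = 0 by rewrite /lev h mulr0.
rewrite lev_add lev_scale => e; rewrite -[RHS]addr0 -e.
have c : cN 10 + 1 = 0 by rewrite /cN /= -[1]/(1%:R) -natrD R11.
have -> : lev b + (lev a + cN 10 * lev b) = lev a + (cN 10 + 1) * lev b by ring.
by rewrite c mul0r addr0.
Qed.
End Eval.

Notation ev := (lev x4 s4).

Lemma evD a b : ev (ladd a b) = ev a + ev b. Proof. exact: (lev_add c11 x4s4). Qed.
Lemma evZ c a : ev (lscale c a) = cN _ c * ev a. Proof. exact: (lev_scale c11). Qed.
Lemma evM a b : ev (lmul a b) = ev a * ev b. Proof. exact: (lev_mul c11). Qed.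
Lemma evX a n : ev (lpow a n) = ev a ^+ n. Proof. exact: (lev_pow c11). Qed.
Lemma ev1 : ev lone = 1. Proof. exact: lev_one. Qed.
Lemma ev_eq a b : leqb a b -> ev a = ev b. Proof. exact: (lev_eq c11 x4s4). Qed.

Lemma Ds4 : D s4 = s4 ^+ 3 * (2%:R * x4 ^+ 5 + 9%:R).
Proof.
have h : D x4 * s4 + x4 * D s4 = 0 by rewrite -psD1M x4s4 psD1_1.
have : s4 * (D x4 * s4 + x4 * D s4) = 0 by rewrite h mulr0.
have -> : s4 * (D x4 * s4 + x4 * D s4) = D s4 * (x4 * s4) + s4 ^+ 2 * D x4 by ring.
rewrite x4s4 mulr1 Dx4 => {}h.
apply: (mod11_mod (W := - (s4 ^+ 3 * (x4 ^+ 5 + 1))) (c := 1) c11 h).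
by ring.
Qed.
Local Notation nevx := (nev x4).
Lemma nev_nth0 c p : nevx (nth0 c p) = cN _ c * nevx p + nevx (nth0 0 p).
Proof.
elim: p c => [|a p IH] c /=; first by rewrite !mulr0 addr0.
rewrite IH (IH 1%num) !(cN_rd c11) cNM cNS.
have -> : cN (ps K) 1 = 1 by []. have -> : cN (ps K) 0 = 0 by [].
by ring.
Qed.
Lemma DcN c : D (cN _ c) = 0. Proof. exact: psD1_nat. Qed.
Lemma D_nev p :
  D (nevx p) = s4 ^+ 2 * (9%:R * x4 ^+ 5 + 2%:R) * nevx (nth0 0 p).
Proof.
elim: p => [|a p IH] /=; first by rewrite raddf0 mulr0.
rewrite raddfD /= DcN psD1M IH Dx4 (cN_rd c11) /cN /= ?mul0r !add0r.
transitivity (s4 * (9%:R * x4 ^+ 5 + 2%:R) * nevx p * (x4 * s4) + x4 * (s4 ^+ 2 *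
  (9%:R * x4 ^+ 5 + 2%:R) * nevx (nth0 0 p))); last first.
  by rewrite -[rd 1]/1%num (nev_nth0 1%num) -[cN _ 1]/1; ring.
by rewrite x4s4 mulr1.
Qed.
Lemma lev_D a : D (ev a) = ev (lD a).
Proof.
case: a => k p; have -> : ev (k, p) = s4 ^+ k * nevx p by [].
have -> : ev (lD (k, p)) = s4 ^+ k.+2 * nevx (nmul [:: 2; 0; 0; 0; 0; 9]%num
  (nth0 (N.mul 10 (N.of_nat k)) p)) by [].
rewrite (nev_mul c11) nev_nth0 psD1M D_nev cNM.
have -> : cN (ps K) (N.of_nat k) = k%:R by rewrite /cN Nat2N.id.
have -> : nevx [:: 2; 0; 0; 0; 0; 9]%num = 9%:R * x4 ^+ 5 + 2%:R.
  by rewrite /nev -[cN _ 2]/(2%:R) -[cN _ 9]/(9%:R) -[cN _ 0]/0; ring.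
have -> : cN (ps K) 10 = 10%:R by [].
have -> : D (s4 ^+ k) = 10%:R * k%:R * s4 ^+ k.+2 * (9%:R * x4 ^+ 5 + 2%:R).
  case: k => [|k]; first by rewrite expr0 psD1_1 mulr0 !mul0r.
  rewrite psD1_exp Ds4; apply: (mod11 (W := - k.+1%:R * (8%:R * x4 ^+ 5 + 1) *
     s4 ^+ k.+3) c11).
  by rewrite !exprS; ring.
by rewrite !exprS; ring.
Qed.

(* [lDk c F] represents J^-c D(J^c F), since D J = 6 J (e - 1). *)
Definition le2 : lp := (2%N, [:: 7; 0; 0; 0; 0; 5]%num).
Definition lDk (c : N) (a : lp) : lp :=
  ladd (lD a) (lscale (N.mul 6 c) (lmul (ladd le2 (lscale 10 lone)) a)).
Lemma ev_le2 : ev le2 = e2.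
Proof.
rewrite e2E /lev /= -[cN _ 7]/(7%:R) -[cN _ 5]/(5%:R) -[cN _ 0]/0.
have -> : 5%:R * x4 * x4 * x4 = 5%:R * x4 * x4 * x4 * (x4 * s4) * (x4 * s4).
  by rewrite x4s4 !mulr1.
by ring.
Qed.
Lemma ev_sub1 : ev (ladd le2 (lscale 10 lone)) = e2 - 1.
Proof.
rewrite evD evZ ev1 ev_le2 -[cN _ 10]/(10%:R).
by apply: (mod11 (W := 1) c11); ring.
Qed.
Lemma ev_lDk (c : nat) a (M : ps K) : D M = (6 * c)%:R * M * (e2 - 1) ->
  D (M * ev a) = M * ev (lDk (N.of_nat c) a).
Proof.
move=> h; rewrite psD1M h lev_D /lDk evD evZ evM ev_sub1 cNM.
have -> : cN (ps K) (N.of_nat c) = c%:R by rewrite /cN Nat2N.id.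
have -> : cN (ps K) 6 = 6%:R by [].
by rewrite natrM; ring.
Qed.
Lemma DJk k : D (J ^+ k) = (6 * k)%:R * J ^+ k * (e2 - 1).
Proof.
case: k => [|k]; first by rewrite expr0 psD1_1 !mul0r.
by rewrite psD1_exp DJ exprS; ring.
Qed.
Lemma DJi : D Ji = (6 * 10)%:R * Ji * (e2 - 1).
Proof.
have h : D J * Ji + J * D Ji = 0 by rewrite -psD1M JJi psD1_1.
apply: (unit_inj (etrans (mulrC _ _) JJi)); rewrite -[LHS]add0r.
apply: (mod11_mod (W := - (6%:R * (J * Ji) * (e2 - 1))) (c := 1) c11 h).
by rewrite DJ; ring.
Qed.

(** * Frobenius and the splitting of Jacobi's series by residues modulo 11 *)

(* @@P *)
Lemma pchar_ps : 11%N \in [pchar (ps K)].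
Proof. by apply/andP; split=> //; apply/eqP; exact: c11. Qed.
Lemma frobD (f g : ps K) : (f + g) ^+ 11 = f ^+ 11 + g ^+ 11.
Proof. by have := pFrobenius_autD_comm pchar_ps (mulrC f g); rewrite !pFrobenius_autE. Qed.
Lemma frobN (f : ps K) : (- f) ^+ 11 = - f ^+ 11.
Proof. by rewrite exprNn; ring. Qed.
Lemma frob_sum (I : Type) (r : seq I) (P : pred I) (F : I -> ps K) :
  (\sum_(i <- r | P i) F i) ^+ 11 = \sum_(i <- r | P i) F i ^+ 11.
Proof. by elim/big_rec2: _ => [|i a b _ <-]; rewrite ?expr0n // frobD. Qed.
Lemma frob_psc (c : K) : psc c ^+ 11 = psc c.
Proof.
by rewrite -pscX fermat11.
Qed.

(** The identity f(q)^11 = f(q^11). Additivity of Frobenius handles a truncation; the tail becomes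
    divisible by q^(11(n+1)). *)
Lemma frobE (f : ps K) n :
  (f ^+ 11) n = if (11 %| n)%N then f (n %/ 11)%N else 0.
Proof.
have [g e] := ps_split n.+1 f.
rewrite {1}e frobD frob_sum exprMn psXX psD ps_sum psXM.
have -> : (n.+1 * 11 <= n)%N = false by lia.
rewrite addr0.
have E i : ((psc (f i) * psX i) ^+ 11) n = f i * (n == i * 11)%N%:R.
  by rewrite exprMn frob_psc psXX pscM.
rewrite (eq_bigr _ (fun (i : 'I_n.+1) _ => E i)); case: dvdnP => [[k hk]|h].
  have kn : (k < n.+1)%N by lia.
  have -> : (n %/ 11 = k)%N by rewrite hk mulnK.
  rewrite (bigD1 (Ordinal kn)) //= (_ : (n == k * 11)%N) ?hk // mulr1.
  rewrite big1 ?addr0 // => i; rewrite -val_eqE /= => hi.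
  have -> : (n == i * 11)%N = false by lia.
  by rewrite mulr0.
rewrite big1 // => i _; case: eqP => [hi|]; last by rewrite mulr0.
by case: h; exists i.
Qed.

Lemma frob_eqt N (f g : ps K) : eqt N f g -> eqt N (f ^+ 11) (g ^+ 11).
Proof.
by move=> h n hn; rewrite !frobE; case: ifP => // _; apply: h; apply: leq_trans hn; exact: leq_div.
Qed.

Lemma J11E : prodq K 11 11 = J ^+ 11.
Proof.
apply: eqt_all => n; apply: eqt_trans (prodq_eqt _ _ _ (ltnSn n)) _ => //.
apply: eqt_sym; apply: eqt_trans (frob_eqt (prodq_eqt _ _ _ (ltnSn n))) _ => //.
rewrite -prodrXl; apply: eqt_prod => i _.
by rewrite frobD frobN expr1n psXX mulnDl mul1n mulnAC mul1n mulnC.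
Qed.

Definition PK (i : nat) : ps K := prodq K i 11 * prodq K (11 - i) 11 * prodq K 11 11.

Lemma PK0 i : (0 < i < 11)%N -> PK i 0%N = 1.
Proof. by move=> h; rewrite /PK !psM0 !prodq0 ?mulr1 //; lia. Qed.

Lemma PK_prod : PK 1 * PK 2 * PK 3 * PK 4 * PK 5 = J * (J ^+ 11) ^+ 4.
Proof.
have R (F : nat -> ps K) : F 1%N * F 10%N * F 11%N * (F 2%N * F 9%N * F 11%N) *
    (F 3%N * F 8%N * F 11%N) * (F 4%N * F 7%N * F 11%N) * (F 5%N * F 6%N * F 11%N) =
    \prod_(a < 11) F a.+1 * F 11%N ^+ 4.
  rewrite !big_ord_recr big_ord0 /=.
  move: (F 1%N) (F 2%N) (F 3%N) (F 4%N) (F 5%N) (F 6%N) (F 7%N) (F 8%N) (F 9%N) => a b c d e f g h k.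
  by move: (F 10%N) (F 11%N) => l m; ring.
have h := R (fun i => prodq K i 11).
rewrite -J11E.
by rewrite /J (@prodq_split _ 11).
Qed.

(** The triple product for P_(5-a) at q^11; its exponents are those of [tri11_l] and [tri11_r]. *)
Lemma PK_eqt n a : (a < 5)%N ->
  eqt n (PK (5 - a) ^+ 11) (thetaN K n.+1 (11 * (6 + a)) (11 * (5 - a))).
Proof.
move=> ha; have h : eqt n (PK (5 - a)) (thetaN K n.+1 (6 + a) (5 - a)).
  have := @jacobi_triple K n n.+1 (6 + a) (5 - a) isT _ (ltnSn n).
  have -> : (6 + a + (5 - a) = 11)%N by lia.
  rewrite [prodq K (6 + a) 11 * _]mulrC /PK; have -> : (11 - (5 - a) = 6 + a)%N by lia.
  by apply; lia.
apply: eqt_trans (frob_eqt h) _.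
have S k : ((-1) ^+ k) ^+ 11 = (-1) ^+ k :> ps K.
  by rewrite -(signr_odd _ k); case: (odd k); rewrite ?expr1n // expr1 frobN expr1n.
rewrite /thetaN frobD !frob_sum => m _; congr ((_ + _ : ps K) m);
  apply: eq_bigr => k _; rewrite exprMn S psXX; congr (_ * psX _); lia.
Qed.

(** The indices 11M + b and 11M + 10 - b have triangular numbers congruent to [tri b] modulo 11, and
    the excess is a theta exponent of P_(5-b)(q^11). *)
Lemma tri11_l b M : (b < 5)%N ->
  tri (11 * M + b) = (tri b + (11 * (6 + b) * tri M + 11 * (5 - b) * tri M.-1))%N.
Proof.
move=> hb; case: M => [|m]; first by rewrite /= muln0 add0n !muln0 !addn0.
have := tri2 (11 * m.+1 + b); have := tri2 m; have := tri2 b; rewrite -[m.+1.-1]/m triS.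
move: (tri _) (tri b) (tri m) => x y z.
case: b hb => [|[|[|[|[|b]]]]]; last by [].
all: lia.
Qed.
Lemma tri11_r b M : (b < 5)%N ->
  tri (11 * M + (10 - b)) = (tri b + (11 * (6 + b) * tri M + 11 * (5 - b) * tri M.+1))%N.
Proof.
move=> hb; have := tri2 (11 * M + (10 - b)); have := tri2 M; have := tri2 b; rewrite triS.
move: (tri _) (tri b) (tri M) => x y z.
case: b hb => [|[|[|[|[|b]]]]]; last by [].
all: lia.
Qed.

(* Modulo 11, Jacobi's series splits into eigenvectors of D. *)
Lemma J3_split : J ^+ 3 = \sum_(a < 5) (-1) ^+ a * a.*2.+1%:R *
  (psX (tri a) * PK (5 - a) ^+ 11).
Proof.
apply: eqt_all => n.
have hN : (n < 11 * n.+1 - 1)%N by lia.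
apply: eqt_trans (jacobi_cube K hN) _.
have -> : ((11 * n.+1 - 1).+1 = 11 * n.+1)%N by lia.
(* Pairs both halves of the theta series index by index; the one term of [thetaN] left over lies
   beyond q^n. *)
pose th M a : ps K := \sum_(k < M) ((-1) ^+ k * psX (11 * (6 + a) * tri k + 11 * (5 - a) * tri k.-1) +
  (-1) ^+ k.+1 * psX (11 * (6 + a) * tri k + 11 * (5 - a) * tri k.+1)).
apply: (@eqt_trans _ _ _ (\sum_(a < 5) (-1) ^+ a * a.*2.+1%:R * (psX (tri a) * th n.+1 a))); last first.
  apply: eqt_sum => a _; apply: eqt_mul; first exact: eqt_refl.
  apply: eqt_mul; first exact: eqt_refl.
  apply: eqt_sym.
  apply: eqt_trans (PK_eqt (ltn_ord a)) _.
  rewrite /thetaN /th big_split big_ord_recr /= => m hm; rewrite !psD; congr (_ + _).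
  rewrite ps_signM /psX; case: eqP => [e|_]; last by rewrite mulr0 addr0.
  by have := tri_ge n.+1; have := ltn_ord a; nia.
suff -> : forall M, \sum_(k < 11 * M) (-1) ^+ k * k.*2.+1%:R * psX (tri k) =
   \sum_(a < 5) (-1) ^+ a * a.*2.+1%:R * (psX (tri a) * th M a) by [].
elim=> [|M IH].
  by rewrite big_ord0 big1 // => a _; rewrite /th big_ord0 !mulr0.
have fold (F : nat -> ps K) : \sum_(b < 11) F b = F 5%N + \sum_(a < 5) (F a + F (10 - a)%N).
  by rewrite !big_ord_recr !big_ord0 /=; ring.
rewrite mulnS addnC big_split_ord /= IH.
rewrite (fold (fun b => (-1) ^+ (11 * M + b) * (11 * M + b).*2.+1%:R * psX (tri (11 * M + b)))).
(* The middle class k = 5 mod 11 drops out because 11 divides 2k + 1. *)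
have -> : (11 * M + 5).*2.+1%:R = 0 :> ps K.
  by rewrite (_ : (11 * M + 5).*2.+1 = M.*2.+1 * 11)%N ?natrM ?c11 ?mulr0 //; lia.
rewrite mulr0 mul0r add0r -big_split; apply: eq_bigr => a _ /=.
have ha := ltn_ord a; set b := (nat_of_ord a) in ha *; rewrite /th big_ord_recr /= -/b.
have e1 : psX (tri (11 * M + b)) = psX (tri b) * psX (11 * (6 + b) * tri M + 11 * (5 - b) * tri M.-1) :> ps K.
  by rewrite -psXD tri11_l.
have e2 : psX (tri (11 * M + (10 - b))) = psX (tri b) * psX (11 * (6 + b) * tri M + 11 * (5 - b) * tri M.+1) :> ps K.
  by rewrite -psXD tri11_r.
have s1 : (-1) ^+ (11 * M + b) = (-1) ^+ M * (-1) ^+ b :> ps K.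
  by rewrite -exprD -signr_odd -[RHS]signr_odd; congr (_ ^+ _); lia.
have s2 : (-1) ^+ (11 * M + (10 - b)) = (-1) ^+ M * (-1) ^+ b :> ps K.
  by rewrite -exprD -signr_odd -[RHS]signr_odd; congr (_ ^+ _); lia.
have n1 : (11 * M + b).*2.+1%:R = b.*2.+1%:R :> ps K.
  by rewrite -natF_mod -[RHS]natF_mod; congr _%:R; lia.
have n2 : (11 * M + (10 - b)).*2.+1%:R = - b.*2.+1%:R :> ps K.
  apply: (mod11 (W := (M.*2 + 2)%:R) c11).
  have -> : 11%:R * (M.*2 + 2)%:R = (11 * M + (10 - b)).*2.+1%:R + b.*2.+1%:R :> ps K.
    by rewrite -natrM -natrD; congr _%:R; lia.
  by ring.
rewrite e1 e2 s1 s2 n1 n2 exprS; ring.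
Qed.

(** * The products P_i(q^11) as Laurent polynomials in E4 *)

(* @@Q *)
Definition gam (i : nat) : lp := (8%N, nth [::] [:: [::];
[:: 8; 0; 1; 0; 9; 1; 10; 1; 1; 10; 1; 4; 1; 0; 1; 3; 0; 2; 0; 0; 2];
  [:: 6; 0; 3; 0; 9; 9; 7; 3; 5; 10; 9; 5; 3; 0; 1; 5; 0; 6; 0; 0; 7];
  [:: 2; 0; 5; 0; 9; 3; 2; 5; 4; 10; 3; 3; 5; 0; 1; 9; 0; 10; 0; 0; 6];
  [:: 1; 0; 2; 0; 2; 7; 5; 2; 8; 1; 7; 2; 2; 0; 10; 10; 0; 4; 0; 0; 3];
  [:: 7; 0; 4; 0; 9; 5; 8; 4; 9; 10; 5; 1; 4; 0; 1; 4; 0; 8; 0; 0; 10]]%num i).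

Lemma D_frob (f : ps K) : D (f ^+ 11) = 0.
Proof. by rewrite psD1_exp -mulr_natr c11 mulr0. Qed.

Lemma natK_inj m n : m%:R = n%:R :> K -> (m = n %[mod 11])%N.
Proof.
by move=> h; have := congr1 (fun a : K => a : nat) h; rewrite !(val_Fp_nat (isT : prime 11)).
Qed.

Lemma eigen_coef c (f : ps K) n : D f = c%:R * f -> f n != 0 -> (n = c %[mod 11])%N.
Proof.
move=> /(congr1 (fun g : ps K => g n)); rewrite ps_natM /psD1 -(mulr_natl (f n)) => h f0.
exact: natK_inj (mulIf f0 h).
Qed.

(** The numbers 0, 1, 3, 6, 10 are distinct modulo 11, so the eigenvectors live on disjoint residue
    classes of exponents. *)
Lemma eigen_unique (F G : 'I_5 -> ps K) :
  (forall a, D (F a) = (tri a)%:R * F a) -> (forall a, D (G a) = (tri a)%:R * G a) ->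
  \sum_a F a = \sum_a G a -> forall a, F a = G a.
Proof.
move=> hF hG e a; apply: psP => n.
have inj (b c : 'I_5) : (tri b = tri c %[mod 11])%N -> b = c.
  by case: b c => [[|[|[|[|[|?]]]]] ?] [[|[|[|[|[|?]]]]] ?] //= _; exact: val_inj.
case: (eqVneq (tri a %% 11)%N (n %% 11)%N) => h; last first.
  have Z H : (forall a : 'I_5, D (H a) = (tri a)%:R * H a) -> H a n = 0.
    move=> hH; apply/eqP; apply: contraNT h => /(eigen_coef (hH a)) ->.
    exact: eqxx.
  by rewrite !Z.
have S H : (forall a : 'I_5, D (H a) = (tri a)%:R * H a) -> (\sum_a H a) n = H a n.
  move=> hH; rewrite ps_sum (bigD1 a) //= big1 ?addr0 // => b ne.
  apply/eqP; apply: contraNT ne => /(eigen_coef (hH b)) hb.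
  by apply/eqP/inj; rewrite -hb h.
by rewrite -(S F) // -(S G) // e.
Qed.

Definition jc (a : nat) : N := nth 0%num [:: 1; 8; 5; 4; 9]%num a.
Lemma jcE a : (a < 5)%N -> cN (ps K) (jc a) = (-1) ^+ a * a.*2.+1%:R.
Proof.
move=> ha; pose M (n : nat) : ps K := n%:R.
have c (m : nat) : cN (ps K) (N.of_nat m) = m%:R by rewrite /cN Nat2N.id.
have neg (m n : nat) : (m + n = 11)%N -> m%:R = - n%:R :> ps K.
  by move=> e; apply/eqP; rewrite -addr_eq0 -natrD e c11.
case: a ha => [|[|[|[|[|a]]]]] // _.
- by rewrite (c 1%N) mul1r.
- by rewrite (c 8%N) (neg 8%N 3%N) // expr1 mulN1r.
- by rewrite (c 5%N) sqrrN expr1n mul1r.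
- by rewrite (c 4%N) (neg 4%N 7%N) // exprS sqrrN expr1n mulr1 mulN1r.
- by rewrite (c 9%N) exprS exprS sqrrN expr1n !mulN1r !opprK mul1r.
Qed.

Fact ev_foldr z s : ev (foldr ladd z s) = \sum_(a <- s) ev a + ev z.
Proof. by elim: s => [|a s IH] /=; rewrite ?big_nil ?add0r // big_cons -addrA -IH evD. Qed.

Fact eigen_mono (c f : ps K) t : D c = 0 -> D f = 0 ->
  D (c * (psX t * f)) = t%:R * (c * (psX t * f)).
Proof.
by move=> hc hf; rewrite !psD1M hc hf psD1_X -(mulr_natl (psX t)); ring.
Qed.

Definition jgam (a : nat) : lp := lscale (jc a) (gam (5 - a)).

(** The two properties that pin down the table [gam]: with their Jacobi coefficients the entries sum
    to 1, and J^3 times each is an eigenvector of D for [tri a]. *)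
Lemma gam_check :
  leqb (foldr ladd lone [seq lscale 10 (jgam a) | a <- iota 0 5]) (0%N, [::]) &&
  all (fun a => leqb (lDk 3 (jgam a)) (lscale (N.of_nat (tri a)) (jgam a))) (iota 0 5).
Proof. by vm_compute. Qed.

(** Both sides, scaled by (-1)^a (2a+1), are the D-eigencomponents of J^3, by [J3_split] and
    [gam_check]; [eigen_unique] matches them and the scalar is invertible. *)
Lemma gamE a : (a < 5)%N ->
  psX (tri a) * PK (5 - a) ^+ 11 = J ^+ 3 * ev (gam (5 - a)).
Proof.
move=> ha; have /andP[s1 /allP s2] := gam_check.
pose G (a : 'I_5) := J ^+ 3 * ev (jgam a).
pose F (a : 'I_5) := (-1) ^+ a * a.*2.+1%:R * (psX (tri a) * PK (5 - a) ^+ 11).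
have hF b : D (F b) = (tri b)%:R * F b.
  rewrite /F -(jcE (ltn_ord b)).
  by apply: eigen_mono; [exact: DcN | exact: D_frob].
have hG b : D (G b) = (tri b)%:R * G b.
  rewrite /G (ev_lDk _ (DJk 3)) (ev_eq (s2 b _)) ?mem_iota ?ltn_ord //.
  by rewrite evZ /cN Nat2N.id mulrCA.
have e : \sum_b F b = \sum_b G b.
  rewrite -J3_split -mulr_sumr -[LHS]mulr1; congr (_ * _).
  have := ev_eq s1; rewrite ev_foldr big_map ev1.
  have z : ev (0%N, [::]) = 0 by rewrite /lev /= mulr0.
  have -> : \sum_(a <- iota 0 5) ev (lscale 10 (jgam a)) = 10%:R * \sum_(a < 5) ev (jgam a).
    rewrite -(big_mkord xpredT (fun a => ev (jgam a))) mulr_sumr.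
    by apply: eq_bigr => b _; exact: evZ.
  rewrite z; move: (\sum_(a < 5) _) => S h.
  by apply: (mod11_mod (W := - S) (c := 1) c11 h); ring.
have := eigen_unique hF hG e (Ordinal ha); rewrite /F /G /= /jgam evZ (jcE ha).
have u : (psc (((-1) ^+ a * a.*2.+1%:R) ^-1) : ps K) * ((-1) ^+ a * a.*2.+1%:R) = 1.
  apply: psP => n; rewrite pscM ps_signM psnat ps1.
  case: eqP => _; rewrite ?mulr0 // mulVf //.
  by case: a ha {F G hF hG e s1 s2} => [|[|[|[|[|]]]]].
by rewrite [in X in _ = X -> _]mulrCA; apply: unit_inj u.
Qed.

(** * The discriminant q J^24 modulo 11 *)

(* @@S *)
Lemma psM1 (f g : ps K) : (f * g) 1%N = f 0%N * g 1%N + f 1%N * g 0%N.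
Proof. by rewrite psM !big_ord_recr big_ord0 /= add0r. Qed.

Lemma J_1 : J 1%N = -1.
Proof.
rewrite /J (@prodq_eqt K 1 1 1 2) // big_ord_recl big_ord1 psM1 !psB !ps1 /psX /=.
by rewrite !subr0 sub0r mulr0 add0r mulr1.
Qed.

Lemma x4_1 : x4 1%N = - 2%:R.
Proof.
have e1 : e2 1%N = - 2%:R.
  rewrite /e2 psD ps1 add0r psM1 -[Ji 0%N]/1 psM0 psM1 !psnat D0 mulr0 mul0r add0r mul0r addr0.
  by rewrite /psD1 mulr1n J_1 mulr1 mulrN1.
by rewrite /x4 /cl_x psB psM1 -[X in _ - X]/(e2 1%N *+ 1) mulr1n e1 e2_0; apply/eqP.
Qed.

Opaque x4 s4 e2 J Ji.

(* q J^24 and (x^5 - 1) / x^2 have the same 20th power. *)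
Definition del : lp := (2%N, [:: 10; 0; 0; 0; 0; 1]%num).

Lemma del_check : leqb (foldr lmul lone [seq gam i | i <- iota 1 5]) (lpow del 20).
Proof. by vm_compute. Qed.

Lemma ev_prod z s : ev (foldr lmul z s) = (\prod_(a <- s) ev a) * ev z.
Proof. by elim: s => [|a s IH] /=; rewrite ?big_nil ?mul1r // big_cons -mulrA -IH evM. Qed.

(** The product of the five identities [gamE]: the q-exponents add up to 0+1+3+6+10 = 20, and
    [PK_prod] to the power 11 gives J^495 = J^15 J^480. *)
Lemma del20 : (psX 1 * J ^+ 24) ^+ 20 = ev del ^+ 20.
Proof.
have e := congr1 (fun f : ps K => f ^+ 11) PK_prod.
have g a : (a < 5)%N -> PK (5 - a) ^+ 11 * psX (tri a) = J ^+ 3 * ev (gam (5 - a)).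
  by move=> ha; rewrite mulrC gamE.
have h : (PK 1 * PK 2 * PK 3 * PK 4 * PK 5) ^+ 11 * psX 20 = J ^+ 15 * ev del ^+ 20.
  rewrite -evX -(ev_eq del_check) ev_prod ev1 mulr1.
  rewrite (_ : psX 20 = psX (tri 0) * psX (tri 1) * psX (tri 2) * psX (tri 3) * psX (tri 4)); last first.
    by rewrite -!psXD.
  move: (g 0%N isT) (g 1%N isT) (g 2%N isT) (g 3%N isT) (g 4%N isT).
  rewrite !subSS !subn0.
  move: (psX (tri 0)) (psX (tri 1)) (psX (tri 2)) (psX (tri 3)) (psX (tri 4)) => q0 q1 q2 q3 q4.
  move: (PK 1) (PK 2) (PK 3) (PK 4) (PK 5) => p1 p2 p3 p4 p5 h1 h2 h3 h4 h5.
  rewrite !exprMn.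
  transitivity ((p5 ^+ 11 * q0) * (p4 ^+ 11 * q1) * (p3 ^+ 11 * q2) * (p2 ^+ 11 * q3) * (p1 ^+ 11 * q4)).
    by move: (p1 ^+ 11) (p2 ^+ 11) (p3 ^+ 11) (p4 ^+ 11) (p5 ^+ 11) => *; ring.
  rewrite h1 h2 h3 h4 h5 /= !big_cons big_nil.
  by move: (ev _) (ev _) (ev _) (ev _) (ev _) => *; ring.
rewrite e in h.
have {}h : J ^+ 15 * (psX 1 * J ^+ 24) ^+ 20 = J ^+ 15 * ev del ^+ 20.
  apply: etrans h; rewrite exprMn psXX.
  by move: (psX _) => q; ring.
apply: (unit_inj _ h).
by rewrite mulrC; apply: pinvP; rewrite psX0 J0 expr1n.
Qed.

(** In the factorisation of f^(n+1) - g^(n+1) the cofactor of f - g has constant term n+1, a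
    unit. *)
Lemma root_unique (n : nat) (f g : ps K) :
  n.+1%:R != 0 :> K -> f 0%N = 1 -> g 0%N = 1 -> f ^+ n.+1 = g ^+ n.+1 -> f = g.
Proof.
move=> n0 f0 g0 e; apply/eqP; rewrite -subr_eq0; apply/eqP.
apply: (@ps_reg (\sum_(i < n.+1) f ^+ (n - i) * g ^+ i)); last first.
  by have := subrXX f g n.+1; rewrite e subrr => h; rewrite [RHS]h.
rewrite ps_sum (eq_bigr (fun _ => 1)) ?sumr_const ?card_ord //.
by move=> i _; rewrite psM0 !psX0 f0 g0 !expr1n mulr1.
Qed.

Fact psX1_exp (f : ps K) n : (psX 1 * f) ^+ n = psX n * f ^+ n.
Proof. by rewrite exprMn psXX mul1n. Qed.

(** 1728 Delta = E4^3 - E6^2 with 1728 = 1 modulo 11. The 20th roots agree because both sides are q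
    times a series with constant term 1; on the right this uses E4 = 1 - 2q + ... . *)
Lemma delE : psX 1 * J ^+ 24 = ev del.
Proof.
have w0 : ev del = s4 ^+ 2 * (x4 ^+ 5 + 10%:R).
  by rewrite /lev /= -[cN _ 10]/(10%:R) -[cN _ 1]/(1%:R) -[cN _ 0]/0; ring.
move: del20 w0; move: (ev del) => W del20 w0; pose w : ps K := fun n => W n.+1.
have c0 : (x4 ^+ 5 + 10%:R) 0%N = 0 :> K.
  by rewrite psD psX0 x4_0 psnat expr1n -mulrS K11.
have ew : W = psX 1 * w.
  apply: psP => -[|n]; rewrite psXM; last by rewrite subn1.
  by rewrite w0 psM0 c0 mulr0.
have w1 : w 0%N = 1.
  rewrite /w w0 psM1 c0 mulr0 addr0 psX0 s4_0 expr1n mul1r psD psnat /= addr0.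
  by rewrite !exprS expr0 !(psM1, psM0) !x4_0 !x4_1 !ps1; apply/eqP.
have u0 : (J ^+ 24) 0%N = 1 by rewrite psX0 J0 expr1n.
have n0 : 20%:R != 0 :> K by [].
have e : (J ^+ 24) ^+ 20 = w ^+ 20.
  exact: psX_inj (etrans (esym (psX1_exp (J ^+ 24) 20)) (etrans del20
    (etrans (congr1 (fun f => f ^+ 20) ew) (psX1_exp w 20)))).
by rewrite ew (root_unique n0 u0 w1 e).
Qed.

(** * Monomials in q, J, J_11 and the P_i as Laurent polynomials *)

(* @@S2 *)
Definition Gam (l : seq nat) : lp := foldr lmul lone [seq gam i | i <- l].
Definition ord5 (l : seq nat) : nat := sumn [seq tri (5 - i) | i <- l].
Definition in5 (i : nat) : bool := (0 < i <= 5)%N.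

Lemma GamE l : all in5 l ->
  psX (ord5 l) * \prod_(i <- l) PK i ^+ 11 = J ^+ (3 * size l) * ev (Gam l).
Proof.
elim: l => [|i l IH] /=; first by rewrite big_nil psX_0 muln0 expr0 !mul1r ev1.
move=> /andP[/andP[i0 i5] /IH{}IH]; rewrite big_cons.
have a5 : (5 - i < 5)%N by lia.
have := gamE a5; have -> : (5 - (5 - i) = i)%N by lia.
rewrite /ord5 /= psXD -/(ord5 l) -[Gam _]/(lmul (gam i) (Gam l)) evM mulnS exprD.
move: IH; move: (psX _) (psX _) (\prod_(_ <- _) _) (PK i ^+ 11) (ev _) (ev _) (J ^+ 3) (J ^+ (3 * _)).
move=> a b c d e f g h h1 h2; transitivity ((a * d) * (b * c)); first by ring.
by rewrite h2 h1; ring.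
Qed.

Definition mono (s a b : nat) (pos neg : seq nat) : ps K :=
  psX s * (J ^+ 11) ^+ a * Ji ^+ b * \prod_(i <- pos) PK i * \prod_(i <- neg) pinv (PK i).

(** The two numeric equations balance the powers of q and of J, where [m] factors q J^24 are traded
    for [del]; what is left is an identity of Laurent polynomials. *)
Definition mono_cond (r s a b : nat) (pos neg : seq nat) (B : lp) (m : nat) : bool :=
  [&& all in5 pos, all in5 neg, r + 11 * s + ord5 neg == m + ord5 pos,
   1 + 3 * size pos + 121 * a == 24 * m + 3 * size neg + 11 * b &
   leqb (lmul B (Gam neg)) (lmul (lpow del m) (Gam pos))]%N.

Lemma PKi i : in5 i -> PK i * pinv (PK i) = 1.
Proof. by move=> h; apply: pinvP; apply: PK0; move: h; rewrite /in5; lia. Qed.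

(* All the quotients below become elements of F_11[x,1/x] after the Frobenius,
   since q^T(5-i) P_i(q^11) = J^3 gam_i and q J^24 = del. *)
Lemma monoE r s a b pos neg B m : mono_cond r s a b pos neg B m ->
  psX r * mono s a b pos neg ^+ 11 = Ji * ev B.
Proof.
case/and5P=> hp hn /eqP e1 /eqP e2 /ev_eq; rewrite !evM evX -delE => h.
have gp := GamE hp; have gn := GamE hn.
have n1 : (\prod_(i <- neg) PK i ^+ 11) * (\prod_(i <- neg) pinv (PK i) ^+ 11) = 1.
  rewrite -big_split /= big_seq big1 // => i /(allP hn) hi.
  by rewrite -exprMn PKi // expr1n.
have -> : mono s a b pos neg ^+ 11 = psX (11 * s) * J ^+ (121 * a) * Ji ^+ (11 * b) *
   (\prod_(i <- pos) PK i ^+ 11) * (\prod_(i <- neg) pinv (PK i) ^+ 11).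
  rewrite /mono !prodrXl; move: (\prod_(i <- pos) PK i) (\prod_(i <- neg) pinv (PK i)) => u v.
  have aux (f g k : ps K) : (f * g * k * u * v) ^+ 11 =
    f ^+ 11 * g ^+ 11 * k ^+ 11 * u ^+ 11 * v ^+ 11 by rewrite !exprMn.
  by rewrite aux psXX -!(exprM J) -(exprM Ji) (mulnC s) (mulnC b) mulnAC.
move: (\prod_(i <- pos) PK i ^+ 11) gp => Ppos gp.
move: (\prod_(i <- neg) PK i ^+ 11) gn n1 => N gn.
move: (\prod_(i <- neg) pinv (PK i) ^+ 11) => Nv n1.
have jj n : J ^+ n * Ji ^+ n = 1 by rewrite -exprMn JJi expr1n.
have f1 : psX r * psX (11 * s) * psX (ord5 neg) = psX m * psX (ord5 pos) :> ps K.
  by rewrite -(psXD _ r) -(psXD _ (r + 11 * s)) e1 psXD.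
have f2 : J * J ^+ (3 * size pos) * J ^+ (121 * a) =
    J ^+ (24 * m) * J ^+ (3 * size neg) * J ^+ (11 * b).
  by rewrite -exprS -(exprD J _ (121 * a)) [X in J ^+ X]e2 (exprD J (24 * m + _)) (exprD J (24 * m)).
move: h; rewrite exprMn psXX mul1n -exprM => h.
have {e1 e2 hp hn} : psX (ord5 neg) * (N * J ^+ (11 * b) * J *
   (psX r * (psX (11 * s) * J ^+ (121 * a) * Ji ^+ (11 * b) * Ppos * Nv))) =
   psX (ord5 neg) * (N * J ^+ (11 * b) * J * (Ji * ev B)).
  move: (psX (ord5 neg)) (psX r) (psX (11 * s)) (psX m) (psX (ord5 pos)) f1 gp gn h => x1 x2 x3 x4 x5.
  move: (J ^+ (11 * b)) (Ji ^+ (11 * b)) (jj (11 * b)%N) f2 => j1 j2 j12.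
  move: (J ^+ (24 * m)) (J ^+ (121 * a)) (J ^+ (3 * size pos)) (J ^+ (3 * size neg)) => j3 j4 j5 j6 f2.
  move: (ev (Gam pos)) (ev (Gam neg)) (ev B) => v1 v2 v3 f1 gp gn h.
  transitivity ((x2 * x3 * x1) * (j1 * j2) * (N * Nv) * J * j4 * Ppos); first by ring.
  rewrite f1 j12 n1 !mulr1.
  transitivity (x4 * J * j4 * (x5 * Ppos)); first by ring.
  rewrite gp; transitivity (x4 * (J * j5 * j4) * v1); first by ring.
  rewrite f2; transitivity ((x4 * j3 * v1) * j6 * j1); first by ring.
  rewrite -h; transitivity (v3 * (j6 * v2) * j1 * 1); first by ring.
  by rewrite -gn -JJi; ring.
move=> /psX_inj; apply: (@unit_inj _ _ (Nv * Ji ^+ (11 * b) * Ji)).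
transitivity ((N * Nv) * (J ^+ (11 * b) * Ji ^+ (11 * b)) * (J * Ji)); first by ring.
by rewrite n1 jj JJi !mulr1.
Qed.

(** * Taylor expansion at z = 1 and functionals that extract moments *)

(* @@E *)
Section Psc.
Variable L : comNzRingType.
Fact psc_zmod_morphism : zmod_morphism (@psc L).
Proof. by move=> a b; apply: psP => n; rewrite psB /psc; case: ifP; rewrite ?subr0. Qed.
Fact psc_monoid_morphism : monoid_morphism (@psc L).
Proof.
split=> [|a b]; apply: psP => n; rewrite ?ps1 ?pscM /psc; case: eqP => // _.
by rewrite mulr0.
Qed.
HB.instance Definition _ := GRing.isZmodMorphism.Build L (ps L) (@psc L) psc_zmod_morphism.
HB.instance Definition _ := GRing.isMonoidMorphism.Build L (ps L) (@psc L) psc_monoid_morphism.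
End Psc.

(** Here the series variable is v = z - 1, so [zc M j] is the binomial coefficient (M choose j)
    modulo 11. *)
Definition zz : ps K := 1 + psX 1.
Definition zc (M j : nat) : K := (zz ^+ M) j.

(** Modulo v^121 a power of z depends on its exponent modulo 121 only; this also supplies negative
    powers. *)
Lemma zz121 : zz ^+ 121 = 1 + psX 121.
Proof.
have -> : zz ^+ 121 = zz ^+ 11 ^+ 11 by rewrite -exprM.
by rewrite /zz frobD psXX frobD psXX !expr1n.
Qed.
Lemma eqt_exp N (f g : ps K) a : eqt N f g -> eqt N (f ^+ a) (g ^+ a).
Proof.
move=> h; elim: a => [|a IH]; first exact: eqt_refl.
by rewrite (exprS f) (exprS g); exact: eqt_mul h IH.
Qed.
Lemma zz_per a M : eqt 120 (zz ^+ (121 * a + M)) (zz ^+ M).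
Proof.
have h : eqt 120 (zz ^+ 121) 1.
  move=> n hn; rewrite zz121 psD /psX; have -> : (n == 121) = false by lia.
  by rewrite addr0.
rewrite exprD exprM -[X in eqt _ _ X]mul1r; apply: eqt_mul; last exact: eqt_refl.
by rewrite -(expr1n _ a); apply: eqt_exp.
Qed.
Lemma zc_per M N j : (M = N %[mod 121])%N -> (j <= 120)%N -> zc M j = zc N j.
Proof.
move=> h hj; rewrite /zc (divn_eq M 121) (divn_eq N 121) h ![(_ * 121)%N]mulnC.
by rewrite !zz_per.
Qed.

Lemma zc0 M : zc M 0 = 1.
Proof. by rewrite /zc psX0 /zz psD ps1 /psX addr0 expr1n. Qed.
Lemma zc_pascal M j : zc M.+1 j.+1 = zc M j.+1 + zc M j.
Proof. by rewrite /zc exprS mulrDl mul1r psD psXM subn1. Qed.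
Lemma zc_0S j : zc 0 j.+1 = 0.
Proof. by rewrite /zc expr0 ps1. Qed.
Lemma zcS M j : j.+1%:R * zc M j.+1 = (M%:R - j%:R) * zc M j.
Proof.
elim: M j => [|M IH] [|j].
- by rewrite zc_0S subrr mulr0 mul0r.
- by rewrite !zc_0S !mulr0.
- by rewrite zc_pascal mulrDr IH !zc0 -(natr1 M); ring.
rewrite !zc_pascal mulrDr IH [RHS]mulrDr.
have := IH j; rewrite -!(natr1 M) -!(natr1 j.+1) -!(natr1 j) => h.
transitivity ((M%:R - (j%:R + 1)) * zc M j.+1 + (j%:R + 1) * zc M j.+1 + zc M j.+1); first by ring.
by rewrite h; ring.
Qed.

(** The equation z^2 (d/dz)^2 z^M = M(M-1) z^M in Taylor coefficients. *)
Lemma zc_heat M j : j.+2%:R * j.+1%:R * zc M j.+2 + 2%:R * j.+1%:R * j%:R * zc M j.+1 +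
  j%:R * (j%:R - 1) * zc M j = M%:R * (M%:R - 1) * zc M j.
Proof.
have h1 := zcS M j.+1; have h2 := zcS M j.
transitivity (j.+1%:R * (j.+2%:R * zc M j.+2) + 2%:R * j%:R * (j.+1%:R * zc M j.+1) +
  j%:R * (j%:R - 1) * zc M j); first by ring.
rewrite h1; transitivity ((M%:R - j.+1%:R + 2%:R * j%:R) * (j.+1%:R * zc M j.+1) +
  j%:R * (j%:R - 1) * zc M j); first by ring.
by rewrite h2 -(natr1 j); ring.
Qed.

Definition rnext (r : seq N) : seq N := take 14 (nadd r (0%num :: r)).
Definition zrow (M : nat) : seq N := iter M rnext [:: 1%num].

Lemma K11' : 11%:R = 0 :> K. Proof. exact: K11. Qed.
Lemma nth_nadd p r j :
  cN K (nth 0%num (nadd p r) j) = cN K (nth 0%num p j) + cN K (nth 0%num r j).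
Proof.
elim: p r j => [|a p IH] [|b r] [|j] //=; rewrite ?(add0r, addr0) //.
by rewrite (cN_rd K11) cND.
Qed.
Lemma zrowE M j : (j < 14)%N -> cN K (nth 0%num (zrow M) j) = zc M j.
Proof.
elim: M j => [|M IH] j hj.
  by case: j hj => [|j] _; rewrite ?zc0 ?zc_0S //= nth_nil.
rewrite /zrow iterS /rnext nth_take // nth_nadd IH //.
case: j hj => [|j] hj; first by rewrite !zc0 addr0.
by rewrite /= IH ?zc_pascal // ltnW.
Qed.

Definition lam (om : seq N) (f : ps K) : K := \sum_(j < 13) cN K (nth 0%num om j) * f j.
Fixpoint ndot (a b : seq N) : N :=
  if a is x :: a' then if b is y :: b' then rd (N.add (N.mul x y) (ndot a' b')) else 0%num
  else 0%num.
Lemma ndotE n a b : (size a <= n)%N ->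
  cN K (ndot a b) = \sum_(j < n) cN K (nth 0%num a j) * cN K (nth 0%num b j).
Proof.
elim: n a b => [|n IH] [|x a] b //= h; first by rewrite big_ord0.
  by rewrite big1 // => j _; rewrite nth_nil mul0r.
case: b => [|y b]; first by rewrite big1 // => j _; rewrite nth_nil mulr0.
by rewrite big_ord_recl /= (cN_rd K11) cND cNM (IH a b).
Qed.
Lemma lam_zz om M : (size om <= 13)%N -> lam om (zz ^+ M) = cN K (ndot om (zrow M)).
Proof.
move=> h; rewrite (ndotE _ h); apply: eq_bigr => j _; rewrite zrowE //.
by apply: leq_trans (ltn_ord j) _.
Qed.
Lemma lam_eqt om f g : eqt 120 f g -> lam om f = lam om g.
Proof. by move=> h; apply: eq_bigr => j _; rewrite h //; have := ltn_ord j; lia. Qed.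
Lemma lam_sum om (I : Type) (r : seq I) (c : I -> K) (F : I -> ps K) :
  lam om (\sum_(i <- r) psc (c i) * F i) = \sum_(i <- r) c i * lam om (F i).
Proof.
rewrite /lam (eq_bigr (fun j : 'I_13 => \sum_(i <- r) c i * (cN K (nth 0%num om j) * F i j))).
  by rewrite exchange_big; apply: eq_bigr => i _; rewrite mulr_sumr.
by move=> j _; rewrite ps_sum mulr_sumr; apply: eq_bigr => i _; rewrite pscM mulrCA.
Qed.

(* The functional [lam om] takes the value m^k on the contribution of the rank
   m to L_n(z), for every m and every n = r mod 11. *)
Definition om_check_at (r k : nat) (om : seq N) (M : nat) : bool :=
  let m := N.of_nat M in let r := N.of_nat r in
  N.eqb (rd (N.add (N.add
    (N.mul (N.add (N.mul 6 r) (N.mul m (N.succ m))) (ndot om (zrow M)))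
    (N.mul (N.add (N.add 2 (N.mul 10 r)) (N.mul 9 (N.mul m m))) (ndot om (zrow M.+1))))
    (N.mul (N.add (N.mul 6 r) (N.add (N.mul m m) (N.mul 10 m))) (ndot om (zrow M.+2)))))
    (rd (iter k (N.mul m) 1%num)).
Definition om_check r k om : bool :=
  (size om <= 13)%N && all (om_check_at r k om) (iota 0 121).

(** * Rank moments modulo 11 as functionals of L *)

(* @@E2 *)
Lemma cN_nat (R : comNzRingType) m : cN R (N.of_nat m) = m%:R.
Proof. by rewrite /cN Nat2N.id. Qed.

Lemma natK_eq m n : (m = n %[mod 11])%N -> m%:R = n%:R :> K.
Proof. by move=> h; rewrite -natK_mod h natK_mod. Qed.

Lemma om_checkP r k om n m : om_check r k om -> (n = r %[mod 11])%N ->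
  (6 * n + m * m.+1)%:R * lam om (zz ^+ m) +
  (2 + 10 * n + 9 * (m * m))%:R * lam om (zz ^+ m.+1) +
  (6 * n + (m * m + 10 * m))%:R * lam om (zz ^+ m.+2) = m%:R ^+ k.
Proof.
case/andP=> hs /allP hc hn; pose M := (m %% 121)%N.
have hM : (M < 121)%N by rewrite ltn_pmod.
have := hc M; rewrite mem_iota hM => /(_ isT)/N.eqb_spec/(congr1 (cN K)).
rewrite !(cN_rd K11) !cND !cNM !cND !cNM !cN_nat -!lam_zz // cNS !cN_nat.
have -> : cN K (iter k (N.mul (N.of_nat M)) 1%num) = M%:R ^+ k.
  by elim: k {hc} => // k IH; rewrite iterS cNM IH cN_nat exprS.
have mm : (m = m %/ 121 * 121 + M)%N := divn_eq m 121.
have eK : m%:R = M%:R :> K by apply: natK_eq; lia.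
have en : n%:R = r%:R :> K by apply: natK_eq.
have l d : lam om (zz ^+ (M + d)) = lam om (zz ^+ (m + d)).
  rewrite [in RHS]mm [(_ * 121)%N]mulnC -addnA; apply/esym/lam_eqt; exact: zz_per.
move: (l 0%N) (l 1%N) (l 2%N); rewrite !addn0 !addn1 !addn2 => -> -> ->.
move=> h; rewrite [in RHS]eK -h {h}.
have -> : (6 * n + m * m.+1)%:R = 6%:R * r%:R + M%:R * (M%:R + 1) :> K.
  by rewrite (natrD _ (6 * n)) (natrM _ 6) (natrM _ m) -(natr1 m) en eK.
have -> : (2 + 10 * n + 9 * (m * m))%:R = 2%:R + 10%:R * r%:R + 9%:R * (M%:R * M%:R) :> K.
  by rewrite (natrD _ (2 + 10 * n)) (natrD _ 2) (natrM _ 10) (natrM _ 9) (natrM _ m) en eK.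
have -> : (6 * n + (m * m + 10 * m))%:R = 6%:R * r%:R + (M%:R * M%:R + 10%:R * M%:R) :> K.
  by rewrite (natrD _ (6 * n)) (natrD _ (m * m)) (natrM _ 10) (natrM _ 6) (natrM _ m) en eK.
by [].
Qed.

Definition evz : {rmorphism {poly K} -> ps K} := (horner_eval zz \o map_poly (@psc K)).
Lemma evzX i : evz 'X^i = zz ^+ i.
Proof. by rewrite /evz /= map_polyXn /horner_eval hornerXn. Qed.
Lemma evzZ c p : evz (c *: p) = psc c * evz p.
Proof. by rewrite /evz /= map_polyZ /horner_eval hornerZ. Qed.

(* z^120 plays the role of 1/z, as z^121 = 1 + v^121. *)
Definition zi : ps K := zz ^+ 120.
(** The coefficient of q^n in L, expanded in v. The factor z^-n undoes the substitution b = q/z. *)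
Definition Lam (n : nat) : ps K := psmapu evz zi (lpol K) n.

Definition momK (k n : nat) : K :=
  \sum_(i < (2 * n).+1) (i%:Z - n%:Z)%:~R ^+ k * NrL K (i%:Z - n%:Z) n.

Lemma LamE n : Lam n =
  \sum_(i < (2 * n).+3) psc (lcoef K n (i%:Z - 1 - n%:Z)) * zz ^+ (i + 120 * n).
Proof.
rewrite /Lam /psmapu /lpol poly_def rmorph_sum mulr_sumr; apply: eq_bigr => i _.
by rewrite evzZ evzX mulrCA /zi -exprM -exprD addnC.
Qed.

Lemma intK_shift n (i : nat) : (i%:Z - n%:Z)%:~R = (i + 120 * n)%:R :> K.
Proof.
have h : (121 : nat)%:R = 0 :> K by rewrite (natrM _ 11 11) K11 mul0r.
rewrite natrD natrM rmorphB /= -!pmulrn.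
rewrite -[LHS]addr0 -(mul0r n%:R) -h -(natr1 120); ring.
Qed.

(** Rank m contributes (6n + m(m+1)) z^m + (2 - 12n - 2m^2) z^(m+1) + (6n + m(m-1)) z^(m+2) to L_n,
    and by [om_checkP] the functional sends this to m^k. *)
Lemma lam_Lam r k om n : om_check r k om -> (n = r %[mod 11])%N ->
  lam om (Lam n) = momK k n.
Proof.
move=> hc hn; rewrite LamE lam_sum.
(* The value of the functional on z^(d+1); adding 121 n makes the exponent non-negative in the
   relevant range. *)
pose H (d : int) := lam om (zz ^+ (absz (d + 1 + n%:Z) + 120 * n)).
pose f1 (e : int) := (6 * n%:Z + e * (e + 1))%:~R * NrL K e n * H (e - 1).
pose f2 (e : int) := (2 - 12 * n%:Z - 2 * e * e)%:~R * NrL K e n * H e.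
pose f3 (e : int) := (6 * n%:Z + e * (e - 1))%:~R * NrL K e n * H (e + 1).
rewrite (eq_bigr (fun i : 'I_(2 * n).+3 => f1 (i%:Z - 1 - n%:Z + 1) +
  f2 (i%:Z - 1 - n%:Z + 0) + f3 (i%:Z - 1 - n%:Z - 1))); last first.
  move=> i _; rewrite /lcoef /f1 /f2 /f3 addr0; set d := i%:Z - 1 - n%:Z.
  have -> : lam om (zz ^+ (i + 120 * n)) = H d.
    by rewrite /H; congr (lam _ (_ ^+ (_ + _))); rewrite /d; lia.
  have -> : d + 1 - 1 = d by ring. have -> : d - 1 + 1 = d by ring.
  have -> : d + 1 + 1 = d + 2 by ring. have -> : d - 1 - 1 = d - 2 by ring.
  by rewrite !mulrDl.
have N0 (g h : int -> K) : (forall d : int, n%:Z < d -> g d * NrL K d n * h d = 0) /\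
    (forall d : int, d < - n%:Z -> g d * NrL K d n * h d = 0).
  by split=> d hd; rewrite ?(NrL_big _ hd) ?(NrL_small _ hd) mulr0 mul0r.
rewrite !big_split !sum_window; try by [apply: (N0 _ _).1 | apply: (N0 _ _).2 | rewrite !inE].
rewrite -!big_split; apply: eq_bigr => i _ /=; rewrite /f1 /f2 /f3.
set e := i%:Z - n%:Z; set m := (i + 120 * n)%N.
have em : e%:~R = m%:R :> K by exact: intK_shift.
have -> : H (e - 1) = lam om (zz ^+ m).
  by rewrite /H; congr (lam _ (_ ^+ _)); rewrite /m /e; lia.
have -> : H e = lam om (zz ^+ m.+1).
  by rewrite /H; congr (lam _ (_ ^+ _)); rewrite /m /e; lia.
have -> : H (e + 1) = lam om (zz ^+ m.+2).
  by rewrite /H; congr (lam _ (_ ^+ _)); rewrite /m /e; lia.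
rewrite -[X in X ^+ k]/(e%:~R) em -(om_checkP m hc hn).
clearbody e.
have -> : (6 * n + m * m.+1)%:R = (6 * n%:Z + e * (e + 1))%:~R :> K.
  rewrite (natrD _ (6 * n)) (natrM _ 6) (natrM _ m) -(natr1 m) -em.
  by ring.
have -> : (2 + 10 * n + 9 * (m * m))%:R = (2 - 12 * n%:Z - 2 * e * e)%:~R :> K.
  rewrite (natrD _ (2 + 10 * n)) (natrD _ 2) (natrM _ 10) (natrM _ 9) (natrM _ m) -em.
  apply: (mod11 (W := 2%:R * n%:R + e%:~R * e%:~R) K11).
  by ring.
have -> : (6 * n + (m * m + 10 * m))%:R = (6 * n%:Z + e * (e - 1))%:~R :> K.
  rewrite (natrD _ (6 * n)) (natrD _ (m * m)) (natrM _ 10) (natrM _ 6) (natrM _ m) -em.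
  apply: (mod11 (W := e%:~R) K11).
  by ring.
by move: (NrL K e n) (lam _ _) (lam _ _) (lam _ _) => *; ring.
Qed.

(** * The heat equation for the Taylor coefficients of phi *)

(* @@E3 *)
Section Swap.
Variable L : comNzRingType.
(** Exchanges q and v, so that [PhS j] and [LS j] are the q-series multiplying v^j. *)
Definition swap (F : ps (ps L)) : ps (ps L) := fun j n => F n j.
Fact swap_zmod_morphism : zmod_morphism swap.
Proof. by []. Qed.
Fact swap_monoid_morphism : monoid_morphism swap.
Proof.
split=> [|F G]; apply: psP => j; apply: psP => n; rewrite /swap.
  by rewrite !ps1 !psnat; case: n j => [|n] [|j].
rewrite (psM F) (psM (swap F)) !ps_sum.
rewrite (eq_bigr (fun i : 'I_n.+1 => \sum_(a < j.+1) F i a * G (n - i)%N (j - a)%N)); last first.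
  by move=> i _; rewrite psM.
by rewrite exchange_big; apply: eq_bigr => a _; rewrite psM.
Qed.
HB.instance Definition _ := GRing.isZmodMorphism.Build (ps (ps L)) (ps (ps L)) swap swap_zmod_morphism.
HB.instance Definition _ := GRing.isMonoidMorphism.Build (ps (ps L)) (ps (ps L)) swap swap_monoid_morphism.
End Swap.

Definition PhS : ps (ps K) := swap (psmapu evz zi (phip K)).
Definition LS : ps (ps K) := swap (psmapu evz zi (lpol K)).
Local Notation phi := PhS.

Lemma PhS_LS j n : (j <= 120)%N ->
  (PhS ^+ 3 * LS) j n = 2%:R * zz j * (J ^+ 8) n.
Proof.
move=> hj; rewrite /PhS /LS -!rmorphXn -!rmorphM /=.
rewrite /swap /psmapu lpol_phip evzZ evzX mulrCA pscM /zi -exprM -exprD.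
have -> : (120 * n + n.+1 = 121 * n + 1)%N by lia.
by rewrite zz_per // expr1 -/J -mulr_natl; ring.
Qed.

(** The coefficient of v^j in z^-k + ... + z^k = (z^(k+1) - z^-k)/v. *)
Definition uk (k j : nat) : K := zc k.+1 j.+1 - zc (120 * k) j.+1.

Lemma phiE j n : (j < 120)%N ->
  phi j n = \sum_(k < n.+1 | tri k == n) (-1) ^+ k * uk k j.
Proof.
move=> hj; have -> : phi j n = (psX 1 * psmapu evz zi (phip K) n) j.+1.
  by rewrite psXM subn1.
have -> : psX 1 = zz - 1 :> ps K by rewrite /zz addrC addKr.
rewrite /psmapu /phip rmorph_sum !mulr_sumr ps_sum; apply: eq_bigr => k /eqP hk.
have kn : (k <= n)%N := leq_trans (tri_ge k) (eq_leq hk).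
rewrite rmorphM rmorphXn rmorphN1 rmorph_sum.
rewrite (eq_bigr (fun i : 'I_(k.*2.+1) => zz ^+ (n - k) * zz ^+ i)); last first.
  by move=> i _; rewrite evzX exprD.
rewrite -mulr_sumr.
have -> : (zz - 1) * (zi ^+ n * ((-1) ^+ k * (zz ^+ (n - k) * \sum_(i < k.*2.+1) zz ^+ i))) =
  (-1) ^+ k * (zz ^+ (121 * n + k.+1) - zz ^+ (121 * (n - k) + 120 * k)).
  have e := subrX1 zz k.*2.+1.
  transitivity ((-1) ^+ k * (zi ^+ n * zz ^+ (n - k)) * ((zz - 1) * \sum_(i < k.*2.+1) zz ^+ i)).
    by ring.
  rewrite -e /zi -exprM -exprD mulrBr mulr1 mulrBr -!mulrA -exprD.
  congr (_ * zz ^+ _ - _ * zz ^+ _); lia.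
by rewrite ps_signM psB !zz_per.
Qed.

Lemma uk_cong k m : (m = 120 * k %[mod 11])%N -> m%:R = - k%:R :> K.
Proof.
move=> h; apply/eqP; rewrite -addr_eq0 -natrD.
have -> : (m + k)%:R = 0%N%:R :> K by apply: natK_eq; lia.
by [].
Qed.

Lemma phi_0 : phi 0 = J ^+ 3.
Proof.
apply: eqt_all => N n hn; rewrite phiE // (jacobi_cube K (ltnSn n) (leqnn n)) ps_sum.
rewrite big_ord_recr /= [X in _ + X](_ : _ = 0); last first.
  rewrite -mulrA ps_signM ps_natM /psX; have := tri_ge n.+1.
  by case: eqP => [e|_ _]; [lia | rewrite !mulr0].
rewrite addr0 big_mkcond /=; apply: eq_bigr => k _.
rewrite -mulrA ps_signM ps_natM /psX eq_sym; case: eqP => _; last by rewrite !mulr0.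
rewrite mulr1 /uk; congr (_ * _).
have z1 M : zc M 1 = M%:R by have := zcS M 0; rewrite zc0 mul1r mulr1 subr0.
rewrite !z1 (@uk_cong k (120 * k)) // opprK -natrD; congr _%:R; lia.
Qed.

Lemma phi_1 : phi 1 = 0.
Proof.
apply: psP => n; rewrite phiE // big1 // => k _; rewrite /uk.
have h2 : 2%:R != 0 :> K by [].
have z2 M : 2%:R * zc M 2 = M%:R * (M%:R - 1).
  by have := zc_heat M 0; rewrite zc0 -[0%:R]/0 -[1%:R]/1 mulr0 !mul0r !addr0 !mulr1.
suff -> : zc k.+1 2 = zc (120 * k) 2 by rewrite subrr mulr0.
by apply: (mulfI h2); rewrite !z2 (@uk_cong k (120 * k)) // -natr1; ring.
Qed.

(** In v phi only z^(k+1) and z^-k multiply q^(k(k+1)/2). Both exponents M satisfy M(M-1) = k(k+1),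
    so z^2 (d/dz)^2 acts on v phi as 2 D. *)
Lemma phi_heat j : (j.+2 < 120)%N ->
  j.+3%:R * j.+2%:R * phi j.+2 + 2%:R * j.+2%:R * j.+1%:R * phi j.+1 +
  j.+1%:R * j%:R * phi j = 2%:R * D (phi j).
Proof.
move=> hj; apply: psP => n; rewrite !psD -!mulrA !ps_natM.
have -> : D (phi j) n = n%:R * phi j n by rewrite /psD1 mulr_natl.
rewrite !phiE; try lia.
rewrite !mulr_sumr -!big_split; apply: eq_bigr => k /eqP hk /=.
have e1 := zc_heat k.+1 j.+1; have e2 := zc_heat (120 * k) j.+1.
have ek : k.+1%:R - 1 = k%:R :> K by rewrite -natr1 addrK.
rewrite ek in e1; rewrite (@uk_cong k (120 * k)) // in e2.
have e3 : 2%:R * n%:R = k%:R * (k%:R + 1) :> K.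
  by rewrite -{1}(_ : tri k = n) // -natrM tri2 natrM -natr1.
have ej : j.+1%:R - 1 = j%:R :> K by rewrite -natr1 addrK.
rewrite ej in e1 e2; rewrite /uk.
move: ((-1) ^+ k) (zc k.+1 _) (zc k.+1 _) (zc k.+1 _) e1 => sg a1 a2 a3 e1.
move: (zc (120 * k) _) (zc (120 * k) _) (zc (120 * k) _) e2 => b1 b2 b3 e2.
transitivity (sg * ((2%:R * n%:R) * a1 - (2%:R * n%:R) * b1)); last by ring.
rewrite e3; rewrite -(natr1 k) in e1.
transitivity (sg * ((k%:R + 1) * k%:R * a1 - - k%:R * (- k%:R - 1) * b1)).
  by rewrite -e1 -e2; ring.
by ring.
Qed.
(** A functional that vanishes on every z^(k+1) - z^-k, hence on v phi. *)
Definition symv : seq N := [:: 0; 0; 1; 10; 1; 10; 1; 10; 1; 10; 1; 10; 2]%num.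
Lemma symv_check :
  all (fun k => N.eqb (ndot symv (zrow k.+1)) (ndot symv (zrow ((120 * k) %% 121)))) (iota 0 121).
Proof. by vm_compute. Qed.

Fact symv_solve (u : nat -> K) : \sum_(j < 13) cN K (nth 0%num symv j) * u j = 0 ->
  2%:R * u 12 = \sum_(i < 10) (-1) ^+ i.+1 * u i.+2.
Proof.
rewrite !big_ord_recr !big_ord0 /=.
have -> : cN K 0 = 0 by []. have -> : cN K 1 = 1 by []. have -> : cN K 2 = 2%:R by [].
have -> : cN K 10 = 10%:R by [].
move: (u 0%N) (u 1%N) (u 2%N) (u 3%N) (u 4%N) (u 5%N) (u 6%N) (u 7%N) (u 8%N) (u 9%N)
  (u 10%N) (u 11%N) (u 12%N) => a0 a1 a2 a3 a4 a5 a6 a7 a8 a9 aa ab ac h.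
apply: (mod11_mod (W := - (a3 + a5 + a7 + a9 + ab)) (c := 1) K11 h).
by ring.
Qed.

(* Invariance of phi under z -> 1/z. *)
Lemma phi_sym : 2%:R * phi 11 = \sum_(i < 10) (-1) ^+ i.+1 * phi i.+1.
Proof.
apply: psP => n; rewrite ps_natM ps_sum.
rewrite phiE // mulr_sumr.
rewrite [RHS](eq_bigr (fun i : 'I_10 => \sum_(k < n.+1 | tri k == n) (-1) ^+ k * ((-1) ^+ i.+1 * uk k i.+1))); last first.
  move=> i _; rewrite ps_signM phiE; last by have := ltn_ord i; lia.
  by rewrite mulr_sumr; apply: eq_bigr => k _; rewrite mulrCA.
rewrite exchange_big; apply: eq_bigr => k _ /=; rewrite -mulr_sumr mulrCA; congr (_ * _).
pose k0 := (k %% 121)%N; have hk0 : (k0 < 121)%N by rewrite ltn_pmod.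
have := allP symv_check k0; rewrite mem_iota hk0 => /(_ isT)/N.eqb_spec/(congr1 (cN K)).
rewrite -!lam_zz // => h.
have hh : lam symv (zz ^+ k.+1) = lam symv (zz ^+ (120 * k)).
  have -> : lam symv (zz ^+ k.+1) = lam symv (zz ^+ k0.+1).
    by apply: eq_bigr => j _; congr (_ * _); apply: zc_per; have := ltn_ord j; rewrite /k0; lia.
  by rewrite h; apply: eq_bigr => j _; congr (_ * _); apply: zc_per; have := ltn_ord j; rewrite /k0; lia.
have {hh} : \sum_(j < 13) cN K (nth 0%num symv j) * (zc k.+1 j - zc (120 * k) j) = 0.
  apply/eqP; move/eqP: hh; rewrite -subr_eq0 /lam -sumrB => /eqP hh; apply/eqP; rewrite -[RHS]hh.
  by apply: eq_bigr => j _; rewrite mulrBr.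
exact: (symv_solve (u := fun j => zc k.+1 j - zc (120 * k) j)).
Qed.

(** * Explicit Taylor coefficients of phi, up to one unknown *)

(* @@E4 *)
Definition lz : lp := (0%N, [::]).
Lemma ev_lz : ev lz = 0. Proof. by rewrite /lev mulr0. Qed.

(** The table of phi_j / J^3 for j <= 9, certified by [heat_checks]. *)
Definition flt : seq lp := [::
  (0%N, [:: 1]%num);
  (0%N, [::]);
  (2%N, [:: 9; 0; 5; 0; 0; 8]%num);
  (2%N, [:: 2; 0; 6; 0; 0; 3]%num);
  (4%N, [:: 2; 0; 1; 0; 1; 1; 0; 7; 0; 0; 10]%num);
  (4%N, [:: 7; 0; 7; 0; 3; 9; 0; 5; 0; 0; 2]%num);
  (6%N, [:: 6; 0; 1; 0; 2; 6; 8; 6; 0; 3; 6; 0; 5; 0; 0; 1]%num);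
  (6%N, [:: 4; 0; 7; 0; 5; 4; 10; 9; 0; 2; 4; 0; 2; 0; 0; 8]%num);
  (8%N, [:: 8; 0; 4; 0; 0; 1; 4; 4; 10; 0; 1; 6; 4; 0; 0; 3; 0; 8; 0; 0; 2]%num);
  (8%N, [:: 1; 0; 2; 0; 2; 7; 5; 2; 8; 1; 7; 2; 2; 0; 10; 10; 0; 4; 0; 0; 3]%num)].
Definition a11 : lp := (8%N, [:: 9; 0; 2; 0; 10; 8; 4; 2; 4; 5; 8; 6; 2; 0; 6; 2; 0; 4; 0; 0; 5]%num).
(** The Taylor coefficients of (1+v)/g^3, where g is phi / J^3 with the unknown set to 0; certified
    by [gw_check]. *)
Definition wlt : seq lp := [::
  (0%N, [:: 1]%num);
  (0%N, [:: 1]%num);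
  (2%N, [:: 6; 0; 7; 0; 0; 9]%num);
  (0%N, [::]);
  (4%N, [:: 7; 0; 3; 0; 8; 3; 0; 10; 0; 0; 2]%num);
  (4%N, [:: 4; 0; 8; 0; 3; 8; 0; 1; 0; 0; 9]%num);
  (6%N, [:: 3; 0; 9; 0; 1; 4; 2; 7; 0; 7; 4; 0; 1; 0; 0; 6]%num);
  (6%N, [:: 5; 0; 0; 0; 1; 3; 4; 0; 0; 7; 3; 0; 0; 0; 0; 10]%num);
  (8%N, [:: 10; 0; 10; 0; 7; 8; 6; 6; 4; 3; 0; 9; 6; 0; 2; 0; 0; 9; 0; 0; 8]%num);
  (8%N, [:: 3; 0; 7; 0; 3; 9; 0; 2; 7; 6; 0; 0; 2; 0; 4; 0; 0; 3; 0; 0; 9]%num);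
  (10%N, [:: 9; 0; 2; 0; 7; 9; 3; 6; 2; 0; 0; 4; 0; 3; 0; 5; 4; 0; 0; 3; 1; 0; 6; 0; 0; 2]%num);
  (10%N, [:: 8; 0; 0; 0; 6; 8; 8; 0; 0; 5; 4; 2; 0; 0; 5; 2; 7; 0; 0; 1; 7; 0; 0; 0; 0; 3]%num);
  (10%N, [:: 9; 0; 6; 7; 6; 9; 6; 2; 3; 1; 0; 3; 2; 10; 8; 5; 8; 1; 4; 1; 1; 0; 7; 9; 0; 2]%num)].

Definition fl (j : nat) : lp := nth lz flt j.

Lemma cNps_nat m : cN (ps K) (N.of_nat m) = m%:R.
Proof. exact: cN_nat. Qed.

Lemma natps_inj (c : nat) (a b : ps K) : (c %% 11 != 0)%N -> c%:R * a = c%:R * b -> a = b.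
Proof.
move=> hc e; apply: psP => n; have := congr1 (fun f : ps K => f n) e.
rewrite !ps_natM; apply: mulfI; apply: contraNneq hc => h.
by have := @natK_inj c 0 h; rewrite mod0n => ->.
Qed.

Definition heat_check (j : nat) : bool :=
  leqb (ladd (lscale (N.of_nat (j.+3 * j.+2)) (fl j.+2)) (ladd
         (lscale (N.of_nat (2 * j.+2 * j.+1)) (fl j.+1)) (lscale (N.of_nat (j.+1 * j)) (fl j))))
    (lscale 2 (lDk 3 (fl j))).
Lemma heat_checks : all heat_check (iota 0 8).
Proof. by vm_compute. Qed.

Lemma D_J3 a : D (J ^+ 3 * ev a) = J ^+ 3 * ev (lDk 3 a).
Proof. exact: (ev_lDk _ (DJk 3)). Qed.

Fact heat_solve (R : comNzRingType) (a b c d e m p q r s : R) :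
  e * p + q * (m * b) + r * (m * a) = s * (m * d) ->
  e * c + (q * b + r * a) = s * d -> e * p = e * (m * c).
Proof.
move=> h1 h2; transitivity (m * (s * d) - q * (m * b) - r * (m * a)); last by rewrite -h2; ring.
by rewrite mulrCA -h1; ring.
Qed.

Lemma phi_fl2 j : (j <= 8)%N ->
  phi j = J ^+ 3 * ev (fl j) /\ phi j.+1 = J ^+ 3 * ev (fl j.+1).
Proof.
elim: j => [|j IH] hj.
  rewrite phi_0 phi_1 [ev (fl 1)]ev_lz mulr0; split => //.
  by rewrite [ev (fl 0)](ev_eq (isT : leqb (fl 0) lone)) ev1 mulr1.
have [h0 h1] := IH (ltnW hj); split; first exact: h1.
have := phi_heat (_ : j.+2 < 120)%N; rewrite h0 h1 D_J3 => h.
have := allP heat_checks j; rewrite mem_iota => /(_ _)/ev_eq.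
rewrite !evD !evZ !cNps_nat !(natrM _ _ j) (natrM _ j.+3) (natrM _ (2 * j.+2)) (natrM _ 2) => e.
apply: (@natps_inj (j.+3 * j.+2)); first by move: hj; clear; case: j => [|[|[|[|[|[|[|[|]]]]]]]].
rewrite natrM.
have {}h := h ltac:(lia).
have {}e := e ltac:(lia).
rewrite -[cN (ps K) 2]/(2%:R) in e.
exact: heat_solve h e.
Qed.

Lemma phi_fl j : (j <= 9)%N -> phi j = J ^+ 3 * ev (fl j).
Proof. by case: j => [|j] hj; [case: (@phi_fl2 0) | case: (phi_fl2 hj)]. Qed.

(** The unknown phi_10 / J^3: the leading coefficient (j+3)(j+2) of the heat recursion vanishes
    modulo 11 for j = 8 and j = 9. Below, [Dt] is J^-3 D(J^3 tq). *)
Definition tq : ps K := Ji ^+ 3 * phi 10.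
Definition Dt : ps K := D tq + 18%:R * (e2 - 1) * tq.
Lemma phi_10 : phi 10 = J ^+ 3 * tq.
Proof. by rewrite /tq mulrA -exprMn JJi expr1n mul1r. Qed.

Lemma a11_check : leqb (lscale 2 a11)
  (foldr ladd lz [seq lscale (if odd j then 10 else 1)%num (fl j) | j <- iota 1 9]).
Proof. by vm_compute. Qed.

(** The heat recursion degenerates here, so the symmetry [phi_sym] is used instead; 6 is the inverse
    of 2. *)
Lemma phi_11 : phi 11 = J ^+ 3 * (ev a11 + 6%:R * tq).
Proof.
apply: (@natps_inj 2) => //; rewrite phi_sym.
have := etrans (esym (evZ 2 a11)) (ev_eq a11_check); rewrite ev_foldr ev_lz addr0 big_map => e.
rewrite big_ord_recr /= phi_10.
have -> : \sum_(i < 9) (-1) ^+ i.+1 * phi i.+1 = J ^+ 3 * (2%:R * ev a11).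
  rewrite -[2%:R]/(cN (ps K) 2) e mulr_sumr (iotaDl 1 0 9) big_map.
  rewrite -(big_mkord xpredT (fun i => (-1) ^+ i.+1 * phi i.+1)).
  apply: eq_big_seq => i; rewrite mem_index_iota => hi.
  rewrite (phi_fl (_ : i.+1 <= 9)%N) // mulrCA evZ add1n; congr (_ * (_ * _)).
  rewrite -signr_odd; case: (odd i.+1); last by rewrite expr0.
  by rewrite expr1; apply: (mod11 (W := - 1) c11); rewrite -[cN _ 10]/(10%:R); ring.
apply: (mod11 (W := - (J ^+ 3 * tq)) c11).
by ring.
Qed.

(** The heat equation at j = 10, where 13 times 12 is 2 and the two lower coefficients vanish modulo
    11. *)
Lemma phi_12 : phi 12 = J ^+ 3 * Dt.
Proof.
apply: (@natps_inj 2) => //.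
have := @phi_heat 10 isT; rewrite phi_10 psD1M DJk => h.
have -> : 2%:R * (J ^+ 3 * Dt) = 2%:R * ((6 * 3)%:R * J ^+ 3 * (e2 - 1) * tq + J ^+ 3 * D tq).
  by rewrite /Dt; ring.
rewrite -h.
apply: (mod11 (W := - (14%:R * phi 12 + 2%:R * 12%:R * phi 11 + 10%:R * (J ^+ 3 * tq))) c11).
by ring.
Qed.

(** * Solving the rank-crank equation for L up to order 12 *)

(* @@E5 *)
Definition sser (l : seq lp) : ps (ps K) := fun j => ev (nth lz l j).
Definition lconv (a b : seq lp) (n : nat) : lp :=
  foldr ladd lz [seq lmul (nth lz a i) (nth lz b (n - i)) | i <- iota 0 n.+1].
Definition sconv (a b : seq lp) : seq lp := [seq lconv a b n | n <- iota 0 13].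
Definition seqb (N : nat) (a b : seq lp) : bool :=
  all (fun j => leqb (nth lz a j) (nth lz b j)) (iota 0 N.+1).

Lemma seqbP N a b : seqb N a b -> eqt N (sser a) (sser b).
Proof. by move=> /allP h j hj; apply: ev_eq; apply: h; rewrite mem_iota. Qed.
Lemma ev_lconv a b n : ev (lconv a b n) = (sser a * sser b) n.
Proof.
rewrite /lconv ev_foldr ev_lz addr0 big_map psM.
rewrite -(big_mkord xpredT (fun i => sser a i * sser b (n - i)%N)).
by apply: eq_bigr => i _; exact: evM.
Qed.
Lemma sconvE a b : eqt 12 (sser (sconv a b)) (sser a * sser b).
Proof.
move=> j hj; rewrite -ev_lconv; congr (ev _).
by rewrite (nth_map 0%N) ?size_iota // nth_iota.
Qed.

(** The known part g of phi / J^3. Next, [hl] is (1+v)/g^4 up to v^2, with -4 written as 7. *)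
Definition gl : seq lp := flt ++ [:: lz; a11; lz].
Definition hl : seq lp := [:: lone; lone; lscale 7 (fl 2)].

Lemma gw_check : seqb 12 (sconv (sconv (sconv gl gl) gl) wlt) [:: lone; lone] &&
  seqb 2 (sconv (sconv gl gl) wlt) (sconv (sconv (sconv gl gl) gl) hl).
Proof. by vm_compute. Qed.

Definition tau : ps (ps K) := fun j =>
  match j with 0 => tq | 1 => 6%:R * tq | 2 => Dt | _ => 0 end.
Definition fser : ps (ps K) := sser gl + psX 10 * tau.
(** First-order expansion of (1+v)/(g + v^10 tau)^3. *)
Definition yser : ps (ps K) := sser wlt - 3%:R * (psX 10 * tau * sser hl).

Lemma phi_fser : eqt 12 phi (psc (J ^+ 3) * fser).
Proof.
move=> j hj; rewrite pscM /fser psD psXM.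
have c (i : nat) : (i <= 9)%N -> phi i = J ^+ 3 * (sser gl i + 0).
  move=> hi; rewrite addr0 (phi_fl hi); congr (_ * ev _).
  by rewrite nth_cat (hi : i < size flt)%N.
case: leqP => h; first exact: c.
have [->|->|->] : [\/ j = 10%N, j = 11%N | j = 12%N].
  by move: h hj; case: (ltngtP j 11) => h1 h2 h3; [constructor 1|constructor 3|constructor 2]; lia.
- by rewrite phi_10 /sser -[nth _ _ _]/lz ev_lz add0r.
- by rewrite phi_11.
by rewrite phi_12 /sser -[nth _ _ _]/lz ev_lz add0r.
Qed.

Lemma eqt_rem N (f g : ps (ps K)) : eqt N f g -> exists r, f = g + psX N.+1 * r.
Proof.
move=> h; exists (fun n => (f - g) (N.+1 + n)%N); apply: psP => n; rewrite psD psXM.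
case: leqP => hn; first by rewrite h // addr0.
by rewrite subnKC // psB addrC subrK.
Qed.
Lemma eqt_big N M (r f : ps (ps K)) : (N < M)%N -> eqt N (f + psX M * r) f.
Proof. by move=> h n hn; rewrite psD psXM leqNgt (leq_ltn_trans hn h) addr0. Qed.

Fact perturb (R : comNzRingType) (g w h t X Y r : R) :
  g ^+ 2 * w = g ^+ 3 * h + Y * r ->
  (g + X * t) ^+ 3 * (w - 3%:R * (X * t * h)) = g ^+ 3 * w + X * Y * (3%:R * t * r) +
   X * X * ((3%:R * g * t ^+ 2 + X * t ^+ 3) * (w - 3%:R * (X * t * h)) - 9%:R * g ^+ 2 * t ^+ 2 * h).
Proof.
move=> e; transitivity (g ^+ 3 * w + 3%:R * X * t * (g ^+ 2 * w) - 3%:R * (X * t * (g ^+ 3 * h)) +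
   X * X * ((3%:R * g * t ^+ 2 + X * t ^+ 3) * (w - 3%:R * (X * t * h)) - 9%:R * g ^+ 2 * t ^+ 2 * h)).
  by ring.
by rewrite e; ring.
Qed.

(** Quadratic terms in the unknown carry v^20, and the error in h carries v^13; neither is seen at
    order 12. *)
Lemma fy : eqt 12 (fser ^+ 3 * yser) (1 + psX 1).
Proof.
have /andP[/seqbP c1 /seqbP c2] := gw_check.
have g3 : eqt 12 (sser (sconv (sconv gl gl) gl)) (sser gl ^+ 3).
  rewrite 2!exprSr expr1; apply: eqt_trans (sconvE _ _) _.
  by apply: eqt_mul; [exact: sconvE | exact: eqt_refl].
have gw : eqt 12 (sser gl ^+ 3 * sser wlt) (1 + psX 1).
  apply: eqt_trans (_ : eqt 12 _ (sser [:: lone; lone])) _.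
    apply: eqt_trans c1; apply: eqt_sym; apply: eqt_trans (sconvE _ _) _.
    by apply: eqt_mul; [exact: g3 | exact: eqt_refl].
  move=> j _; rewrite psD ps1 /psX /sser.
  by case: j => [|[|j]] /=; rewrite ?ev1 ?addr0 ?add0r // nth_nil ev_lz.
have h2 : eqt 2 (sser gl ^+ 2 * sser wlt) (sser gl ^+ 3 * sser hl).
  apply: eqt_trans (_ : eqt 2 _ (sser (sconv (sconv gl gl) wlt))) _.
    apply: eqt_sym; apply: eqt_le (_ : 2 <= 12)%N _ => //.
    apply: eqt_trans (sconvE _ _) _; apply: eqt_mul; last exact: eqt_refl.
    by rewrite expr2; exact: sconvE.
  apply: eqt_trans c2 _; apply: eqt_le (_ : 2 <= 12)%N _ => //.
  apply: eqt_trans (sconvE _ _) _; apply: eqt_mul; last exact: eqt_refl.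
  exact: g3.
have [r hr] := eqt_rem h2.
rewrite /fser /yser (perturb _ _ hr) -!psXD.
apply: eqt_trans (eqt_big _ _ (isT : 12 < 10 + 10)%N) _.
exact: eqt_trans (eqt_big _ _ (isT : 12 < 10 + 3)%N) gw.
Qed.

Lemma eqt_expR (R : comNzRingType) N (f g : ps R) a : eqt N f g -> eqt N (f ^+ a) (g ^+ a).
Proof.
move=> h; elim: a => [|a IH]; first exact: eqt_refl.
by rewrite (exprS f) (exprS g); exact: eqt_mul h IH.
Qed.
Lemma eqt_of_eq (R : comNzRingType) N (f g : ps R) : f = g -> eqt N f g.
Proof. by move=> ->; exact: eqt_refl. Qed.
Lemma eqt_cancel (R : comNzRingType) N (u v a b : ps R) :
  v * u = 1 -> eqt N (u * a) (u * b) -> eqt N a b.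
Proof.
move=> h e; rewrite -[a]mul1r -[b]mul1r -h -!mulrA.
by apply: eqt_mul e; exact: eqt_refl.
Qed.

(** Division of phi^3 L = 2 z J^8 by phi^3 = J^9 f^3, using [fy] for (1+v)/f^3. *)
Lemma LSE j : (j <= 12)%N -> LS j = Ji * (2%:R * yser j).
Proof.
move=> hj; have F0 : (fser ^+ 3) 0%N = 1.
  rewrite psX0 /fser psD psM0 mul0r addr0 -[sser gl 0%N]/(ev lone) ev1.
  exact: expr1n.
have F1 : pinv (fser ^+ 3) * fser ^+ 3 = 1 by rewrite mulrC; exact: pinvP.
have e1 : eqt 12 (PhS ^+ 3 * LS) (psc (2%:R * J ^+ 8) * (1 + psX 1)).
  move=> i hi; apply: psP => n; rewrite PhS_LS; last by apply: leq_trans hi _.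
  rewrite pscM -(mulrA _ (J ^+ 8)) (ps_natM _ (_ * _)) -mulrA; congr (_ * _).
  by rewrite /zz !psD !ps1 /psX -!natrD (mulr_natr (J ^+ 8)) psMn mulr_natl.
have e2 : eqt 12 (psc (J ^+ 8) * (fser ^+ 3 * (psc J * LS)))
   (psc (J ^+ 8) * (fser ^+ 3 * (2%:R * yser))).
  apply: eqt_trans (_ : eqt 12 _ (PhS ^+ 3 * LS)) _.
    apply: (@eqt_trans _ _ _ ((psc (J ^+ 3) * fser) ^+ 3 * LS)).
      by rewrite (pscX J 8) (pscX J 3); move: (psc J) fser LS => a b c; apply: eqt_of_eq; ring.
    apply: eqt_mul; last exact: eqt_refl.
    by apply: eqt_expR; apply: eqt_sym; exact: phi_fser.
  apply: eqt_trans e1 _; apply: eqt_sym.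
  apply: (@eqt_trans _ _ _ (psc (2%:R * J ^+ 8) * (fser ^+ 3 * yser))).
    have -> : psc (2%:R * J ^+ 8) = 2%:R * psc (J ^+ 8) :> ps (ps K).
      by apply: psP => n; rewrite ps_natM /psc; case: ifP => // _; rewrite mulr0.
    by move: (psc (J ^+ 8)) fser yser => a b c; apply: eqt_of_eq; ring.
  by apply: eqt_mul; [exact: eqt_refl | exact: fy].
have J8 : psc (Ji ^+ 8) * psc (J ^+ 8) = 1.
  rewrite (pscX Ji) (pscX J) -exprMn.
  have -> : psc Ji * psc J = 1 by apply: psP => n; rewrite pscM ps1 /psc; case: ifP => _; rewrite ?mulr0 // mulrC JJi.
  exact: expr1n.
have e3 := eqt_cancel F1 (eqt_cancel J8 e2).
have := e3 _ hj; rewrite pscM => h.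
apply: (unit_inj (etrans (mulrC _ _) JJi)); rewrite h [RHS]mulrA JJi mul1r.
exact: (@ps_natM (ps K) 2 yser j).
Qed.

(** * From certificates to moments in an arithmetic progression *)

(* @@E6 *)
Lemma lam_LS om n : lam om (Lam n) =
  (Ji * \sum_(j < 13) cN (ps K) (nth 0%num om j) * (2%:R * yser j)) n.
Proof.
have -> : lam om (Lam n) = (\sum_(j < 13) cN (ps K) (nth 0%num om j) * LS j) n.
  by rewrite ps_sum; apply: eq_bigr => j _; rewrite ps_natM.
rewrite mulr_sumr; congr ((_ : ps K) n); apply: eq_bigr => j _.
by rewrite mulrCA LSE // -ltnS.
Qed.

Definition tauhl (j : nat) : ps K :=
  match j with
  | 10 => tq | 11 => 7%:R * tq | 12 => (7%:R * ev (fl 2) + 6%:R) * tq + Dt | _ => 0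
  end.
Lemma yserE j : (j <= 12)%N -> yser j = ev (nth lz wlt j) - 3%:R * tauhl j.
Proof.
move=> hj; rewrite /yser psB (@ps_natM (ps K)) -mulrA psXM; congr (_ - _ * _).
have h0 : sser hl 0%N = 1 by exact: ev1.
have h1 : sser hl 1%N = 1 by exact: ev1.
have h2 : sser hl 2 = 7%:R * ev (fl 2) by exact: evZ.
case: leqP => h.
  by move: h; clear; do 10!case: j => [|j] //.
have [->|->|->] : [\/ j = 10%N, j = 11%N | j = 12%N].
  by move: h hj; case: (ltngtP j 11) => e1 e2 e3; [constructor 1|constructor 3|constructor 2]; lia.
- by rewrite psM big_ord1 /= h0 mulr1.
- rewrite psM !big_ord_recr big_ord0 /= h0 h1 add0r !mulr1.
  by rewrite /tauhl; ring.
rewrite psM !big_ord_recr big_ord0 /= h0 h1 h2 add0r !mulr1.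
by rewrite /tauhl; move: tq Dt (ev _) => *; ring.
Qed.

Definition Fpoly (om : seq N) : lp :=
  foldr ladd lz [seq lscale (N.mul (nth 0%num om j) 2) (nth lz wlt j) | j <- iota 0 13].

Fact tauhl_sum (u : nat -> ps K) : \sum_(j < 13) u j * tauhl j =
  u 10 * tq + u 11 * (7%:R * tq) + u 12 * ((7%:R * ev (fl 2) + 6%:R) * tq + Dt).
Proof. by rewrite !big_ord_recr big_ord0 /= !mulr0 !add0r. Qed.

Lemma F_split om : \sum_(j < 13) cN (ps K) (nth 0%num om j) * (2%:R * yser j) =
  ev (Fpoly om) + 5%:R * (cN _ (nth 0%num om 10) * tq + cN _ (nth 0%num om 11) * (7%:R * tq) +
    cN _ (nth 0%num om 12) * ((7%:R * ev (fl 2) + 6%:R) * tq + Dt)).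
Proof.
rewrite /Fpoly ev_foldr ev_lz addr0 big_map -[iota 0 13]/(index_iota 0 13) big_mkord.
rewrite (eq_bigr (fun j : 'I_13 => ev (lscale (N.mul (nth 0%num om j) 2) (nth lz wlt j)) +
  5%:R * (cN _ (nth 0%num om j) * tauhl j))); last first.
  move=> j _; rewrite (yserE (ltn_ord j : (j <= 12)%N)) evZ cNM -[cN _ 2]/(2%:R).
  move: (cN _ _) (ev _) (tauhl _) => a b c.
  by apply: (mod11 (W := - (a * c)) c11); ring.
rewrite big_split -mulr_sumr; congr (_ + _ * _).
exact: (tauhl_sum (fun j => cN _ (nth 0%num om j))).
Qed.

Definition mon : Type := nat * nat * nat * seq nat * seq nat.
(** The moment k, the functional, a Laurent polynomial U for the part (D - r)(U/J) to be discarded,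
    and the coefficients of the answer modulo 11. *)
Definition cert : Type := nat * seq N * lp * seq N.
Definition mono_of (t : mon) : ps K := let: (s, a, b, pos, neg) := t in mono s a b pos neg.
Definition mon_check (r : nat) (u : mon * nat * lp) : bool :=
  let: ((s, a, b, pos, neg), m, B) := u in mono_cond r s a b pos neg B m.

Definition Gpoly (us : seq (mon * nat * lp)) (cs : seq N) : lp :=
  foldr ladd lz [seq lscale u.1 u.2.2 | u <- zip cs us].
Definition le1 : lp := ladd le2 (lscale 10 lone).
(** First test: the part free of the unknown is [Gp] plus J (D - r)(U/J). Second test: the part in
    [tq] is a constant times J (D - r)(tq/J). The weight 10 in [lDk] and the factor [10 * r] stand
    for -1 and -r, and 5 is 2 times -3. *)
Definition F_check (r : nat) (om : seq N) (U Gp : lp) : bool :=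
  let o j := nth 0%num om j in
  leqb (Fpoly om) (ladd Gp (ladd (lDk 10 U) (lscale (N.of_nat (10 * r)) U))) &&
  leqb (lscale 5 (ladd (lscale (N.add (o 10) (N.add (N.mul 7 (o 11)) (N.mul 6 (o 12)))) lone)
       (lscale (o 12) (ladd (lscale 7 (fl 2)) (lscale 18 le1)))))
    (lscale (N.mul 5 (o 12)) (ladd (lscale 60 le1) (lscale (N.of_nat (10 * r)) lone))).

Definition cert_check (r : nat) (us : seq (mon * nat * lp)) (c : cert) : bool :=
  let: (k, om, U, cs) := c in
  [&& om_check r k om, size cs == size us & F_check r om U (Gpoly us cs)].

(** D - r annihilates the coefficients in the progression n = r mod 11; this removes both [U] and
    the unknown. *)
Lemma D_coef r (f : ps K) n : (n = r %[mod 11])%N -> D f n + (10 * r)%:R * f n = 0.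
Proof.
move=> h; rewrite /psD1 -(mulr_natl (f n)) (natK_eq h) -mulrDl natrM.
have -> : r%:R + 10%:R * r%:R = 0 :> K by apply: (mod11 (W := r%:R) K11); ring.
exact: mul0r.
Qed.

Fact t_part (R : comNzRingType) (o10 o11 o12 t dt f e r : R) :
  5%:R * ((o10 + (7%:R * o11 + 6%:R * o12)) * 1 + o12 * (7%:R * f + 18%:R * e)) =
    5%:R * o12 * (60%:R * e + r * 1) ->
  5%:R * (o10 * t + o11 * (7%:R * t) + o12 * ((7%:R * f + 6%:R) * t + (dt + 18%:R * e * t))) =
  5%:R * o12 * (dt + 60%:R * e * t + r * t).
Proof.
move=> h; transitivity (5%:R * ((o10 + (7%:R * o11 + 6%:R * o12)) * 1 +
  o12 * (7%:R * f + 18%:R * e)) * t + 5%:R * o12 * dt); first by ring.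
by rewrite h; ring.
Qed.

Lemma F_checkP r om U Gp n : F_check r om U Gp -> (n = r %[mod 11])%N ->
  lam om (Lam n) = (Ji * ev Gp) n.
Proof.
case/andP=> /ev_eq h1 /ev_eq h2 hn; rewrite lam_LS F_split h1.
rewrite (evD Gp) (evD (lDk 10 U)) (evZ (N.of_nat (10 * r))) (cNps_nat (10 * r)).
rewrite (evZ 5) (evD (lscale _ _)) (evZ _ lone) (evZ (nth _ _ _)) (evD (lscale _ _)) (evZ 7) (evZ 18) in h2.
rewrite (evZ (N.mul _ _)) (evD (lscale _ _)) (evZ 60) (evZ _ lone) ev_sub1 ev1 !cND !cNM (cNps_nat (10 * r)) in h2.
rewrite -[cN _ 5]/(5%:R) -[cN _ 6]/(6%:R) -[cN _ 7]/(7%:R) -[cN _ 18]/(18%:R) -[cN _ 60]/(60%:R) in h2.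
rewrite /Dt (t_part _ _ h2).
have e1 : Ji * ev (lDk 10 U) = D (Ji * ev U) by rewrite (ev_lDk _ DJi).
have e3 : Ji * (D tq + 60%:R * (e2 - 1) * tq) = D (Ji * tq).
  by rewrite (psD1M Ji tq) DJi; move: Ji tq e2 (D tq) => a b c d; ring.
set c := 5%:R * _.
have -> : Ji * (ev Gp + (ev (lDk 10 U) + (10 * r)%:R * ev U) +
    c * (D tq + 60%:R * (e2 - 1) * tq + (10 * r)%:R * tq)) =
  Ji * ev Gp + (Ji * ev (lDk 10 U) + (10 * r)%:R * (Ji * ev U) +
    c * (Ji * (D tq + 60%:R * (e2 - 1) * tq) + (10 * r)%:R * (Ji * tq))).
  by clear; move: Ji (ev Gp) (ev U) (ev (lDk 10 U)) tq e2 (D tq) ((10 * r)%:R) c => *; ring.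
rewrite e1 e3.
have cE f : (c * f) n = 5%:R * cN K (nth 0%num om 12) * f n.
  by rewrite /c -mulrA ps_natM ps_natM mulrA.
rewrite !psD cE !psD !ps_natM !(D_coef _ hn) mulr0 !addr0.
by [].
Qed.

Lemma mono_frob (f : ps K) r m : (psX r * f ^+ 11) (11 * m + r)%N = f m.
Proof.
rewrite psXM leq_addl addnK frobE dvdn_mulr // mulKn //.
Qed.

(** Each term of [Gpoly] over J is q^r times a monomial at q^11, so its coefficient at 11m + r is
    the m-th coefficient of the monomial. *)
Lemma moment_mono r us k om U cs m :
  all (mon_check r) us -> cert_check r us (k, om, U, cs) ->
  momK k (11 * m + r) = (\sum_(u <- zip cs us) cN _ u.1 * mono_of u.2.1.1) m.
Proof.
move=> hu /and3P[h1 /eqP hs h2].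
have hn : (11 * m + r = r %[mod 11])%N by rewrite mulnC modnMDl.
rewrite -(lam_Lam h1 hn) (F_checkP h2 hn).
have -> : Ji * ev (Gpoly us cs) = \sum_(u <- zip cs us) cN _ u.1 * (psX r * mono_of u.2.1.1 ^+ 11).
  rewrite /Gpoly ev_foldr ev_lz addr0 big_map mulr_sumr.
  apply: eq_big_seq => -[c [[[[[[s a] b] pos] neg] q] B]] hin /=.
  rewrite evZ mulrCA; congr (_ * _); apply/esym/(@monoE _ _ _ _ _ _ _ q).
  have : (c, ((s, a, b, pos, neg), q, B)).2 \in unzip2 (zip cs us) by apply: map_f.
  by rewrite unzip2_zip ?hs // => /(allP hu).
by rewrite !ps_sum; apply: eq_bigr => u _; rewrite !ps_natM mono_frob.
Qed.

(** * Certificates: the monomials of each right-hand side with their Laurent polynomials, and the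
    data for each moment *)

Definition mons1 : seq (mon * nat * lp) := [::
  ((0, 2, 3, [:: 5; 4; 5; 5], [:: 2; 3]), 9, (34%N, [:: 9; 0; 8; 0; 6; 1; 3; 3; 8; 2; 1; 9; 0; 8; 8; 1; 8; 6; 6; 0; 4; 2; 5; 0; 2; 5; 8; 6; 4; 4; 8; 10; 5; 0; 0; 0; 7; 8; 2; 4; 4; 4; 10; 5; 0; 0; 0; 7; 8; 2; 4; 4; 4; 10; 5; 2; 0; 3; 7; 2; 1; 1; 1; 7; 8; 4; 2; 0; 3; 10; 7; 5; 9; 9; 4; 6; 3; 6; 0; 9; 2; 0; 7; 0; 0; 7]%num));
  ((2, 2, 3, [:: 5; 1; 1; 3], [:: 2; 3]), 9, (34%N, [:: 6; 0; 9; 0; 4; 8; 2; 2; 9; 5; 8; 1; 0; 7; 9; 1; 6; 6; 6; 9; 4; 2; 9; 0; 8; 5; 7; 4; 9; 9; 3; 6; 3; 7; 0; 5; 2; 8; 1; 4; 4; 3; 10; 5; 8; 0; 1; 7; 6; 9; 3; 3; 5; 2; 1; 0; 0; 0; 8; 6; 7; 3; 3; 3; 2; 1; 9; 0; 8; 8; 1; 8; 6; 6; 0; 4; 2; 4; 0; 6; 5; 0; 1; 0; 0; 1]%num));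
  ((1, 2, 3, [:: 5; 1; 4; 4], [:: 2; 3]), 9, (34%N, [:: 10; 0; 4; 0; 3; 6; 7; 7; 4; 1; 6; 7; 0; 5; 4; 4; 0; 2; 2; 1; 5; 8; 3; 0; 10; 9; 6; 5; 3; 3; 1; 2; 1; 7; 0; 5; 8; 7; 9; 9; 9; 8; 6; 3; 10; 0; 4; 2; 10; 5; 5; 5; 2; 7; 9; 9; 0; 8; 6; 5; 9; 8; 8; 2; 9; 10; 6; 0; 9; 3; 9; 1; 10; 10; 6; 3; 7; 3; 0; 10; 1; 0; 9; 0; 0; 9]%num));
  ((1, 2, 3, [:: 5; 2; 2; 5], [:: 2; 3]), 9, (34%N, [:: 7; 0; 5; 0; 1; 2; 6; 6; 5; 4; 2; 0; 0; 0; 5; 1; 3; 6; 6; 6; 4; 2; 6; 0; 9; 5; 5; 0; 8; 8; 4; 9; 10; 6; 0; 9; 3; 9; 1; 10; 10; 6; 3; 7; 2; 0; 3; 1; 3; 4; 7; 7; 2; 1; 6; 1; 0; 7; 4; 0; 3; 0; 0; 3; 0; 0; 10; 0; 4; 0; 3; 6; 7; 7; 4; 1; 6; 1; 0; 7; 4; 0; 3; 0; 0; 3]%num));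
  ((1, 2, 3, [:: 5; 2; 3; 3], [:: 2; 3]), 9, (34%N, [:: 8; 0; 1; 0; 9; 7; 10; 10; 1; 3; 7; 1; 0; 7; 1; 6; 10; 3; 3; 6; 2; 1; 2; 0; 3; 8; 0; 6; 0; 0; 6; 0; 0; 0; 0; 0; 0; 0; 0; 0; 0; 0; 0; 0; 0; 0; 0; 0; 0; 0; 0; 0; 0; 0; 0; 3; 0; 10; 0; 2; 4; 1; 1; 10; 8; 4; 10; 0; 4; 10; 5; 1; 8; 8; 5; 9; 10; 9; 0; 8; 3; 0; 5; 0; 0; 5]%num));
  ((1, 2, 3, [:: 2; 2; 4], [:: 1]), 9, (34%N, [:: 1; 0; 7; 0; 8; 5; 4; 4; 7; 10; 5; 8; 0; 1; 7; 6; 9; 3; 3; 5; 2; 1; 7; 0; 5; 8; 7; 9; 9; 9; 8; 6; 3; 9; 0; 8; 2; 2; 0; 1; 1; 6; 8; 4; 1; 0; 7; 10; 10; 0; 5; 5; 8; 7; 9; 4; 0; 6; 6; 9; 6; 10; 10; 0; 3; 7; 6; 0; 9; 1; 2; 2; 1; 1; 8; 8; 4; 8; 0; 1; 10; 0; 2; 0; 0; 2]%num))]%N.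
Definition certs1 : seq cert := [::
  (2%N, [:: 0; 0; 0; 2; 8; 9; 3; 4; 5; 1; 0; 10; 1]%num, (23%N, [:: 4; 0; 6; 0; 10; 9; 5; 5; 6; 7; 9; 9; 0; 3; 6; 6; 9; 5; 3; 8; 5; 6; 3; 2; 2; 5; 0; 0; 1; 4; 4; 10; 8; 10; 0; 7; 7; 3; 4; 7; 7; 1; 1; 6; 0; 0; 0; 4; 3; 9; 7; 7; 7; 1; 6; 1; 0; 7; 4; 0; 3; 0; 0; 3]%num),
   [:: 0; 10; 6; 7; 8; 9]%num);
  (4%N, [:: 0; 0; 0; 2; 4; 0; 0; 0; 0; 0; 0; 0; 0]%num, (12%N, [:: 4; 0; 6; 0; 10; 9; 5; 5; 6; 7; 3; 1; 5; 7; 7; 7; 7; 8; 8; 0; 9; 10; 9; 0; 8; 3; 0; 5; 0; 0; 5]%num),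
   [:: 0; 0; 0; 0; 0; 0]%num);
  (6%N, [:: 0; 0; 0; 2; 10; 5; 5; 10; 7; 8; 0; 3; 8]%num, (23%N, [:: 10; 0; 4; 0; 3; 6; 7; 7; 4; 1; 6; 6; 0; 9; 4; 9; 6; 8; 6; 1; 5; 10; 7; 10; 9; 4; 7; 1; 4; 7; 1; 6; 6; 0; 9; 0; 0; 1; 5; 0; 8; 1; 8; 3; 3; 0; 9; 10; 2; 4; 1; 1; 1; 8; 4; 8; 0; 1; 10; 0; 2; 0; 0; 2]%num),
   [:: 0; 10; 7; 2; 5; 3]%num);
  (8%N, [:: 0; 0; 0; 2; 1; 9; 0; 2; 3; 0; 0; 0; 0]%num, (21%N, [:: 4; 0; 6; 0; 10; 7; 5; 2; 6; 6; 7; 1; 4; 6; 4; 2; 9; 2; 9; 0; 8; 2; 6; 5; 1; 1; 10; 10; 2; 3; 6; 9; 0; 8; 1; 4; 6; 2; 2; 7; 5; 8; 5; 0; 2; 9; 0; 4; 0; 0; 4]%num),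
   [:: 0; 5; 1; 4; 7; 8]%num)].
Definition mons2 : seq (mon * nat * lp) := [::
  ((0, 2, 3, [:: 3; 4; 5; 5], [:: 1; 4]), 9, (34%N, [:: 7; 0; 4; 0; 9; 2; 8; 7; 9; 3; 2; 4; 0; 7; 1; 3; 2; 10; 6; 1; 1; 8; 4; 0; 7; 4; 6; 3; 9; 1; 9; 2; 5; 7; 0; 4; 8; 6; 1; 9; 1; 1; 2; 5; 7; 0; 4; 8; 6; 1; 9; 1; 1; 2; 5; 0; 0; 0; 8; 8; 10; 1; 5; 3; 10; 3; 3; 0; 8; 7; 3; 10; 10; 6; 0; 1; 8; 3; 0; 8; 4; 0; 9; 0; 0; 3]%num));
  ((2, 2, 3, [:: 3; 1; 1; 3], [:: 1; 4]), 9, (34%N, [:: 1; 0; 10; 0; 6; 5; 9; 1; 6; 2; 5; 0; 0; 0; 8; 8; 10; 1; 5; 3; 10; 3; 1; 0; 10; 7; 2; 0; 3; 4; 10; 8; 9; 5; 0; 6; 10; 7; 10; 5; 3; 9; 6; 4; 1; 0; 10; 2; 8; 2; 1; 5; 4; 10; 3; 8; 0; 3; 7; 0; 2; 0; 0; 8; 0; 0; 4; 0; 7; 0; 2; 9; 3; 4; 2; 8; 9; 2; 0; 9; 10; 0; 6; 0; 0; 2]%num));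
  ((1, 2, 3, [:: 3; 1; 4; 4], [:: 1; 4]), 9, (34%N, [:: 9; 0; 2; 0; 10; 1; 4; 9; 10; 7; 1; 7; 0; 4; 6; 4; 4; 6; 8; 3; 5; 7; 4; 0; 7; 9; 0; 1; 0; 0; 4; 0; 0; 0; 0; 0; 0; 0; 0; 0; 0; 0; 0; 0; 0; 0; 0; 0; 0; 0; 0; 0; 0; 0; 0; 2; 0; 9; 0; 1; 10; 7; 2; 1; 4; 10; 4; 0; 7; 5; 7; 7; 5; 3; 8; 6; 4; 7; 0; 4; 2; 0; 10; 0; 0; 7]%num));
  ((1, 2, 3, [:: 3; 2; 2; 5], [:: 1; 4]), 9, (34%N, [:: 3; 0; 8; 0; 7; 4; 5; 3; 7; 6; 4; 5; 0; 6; 2; 10; 0; 4; 9; 6; 7; 1; 6; 0; 5; 6; 9; 10; 8; 7; 8; 3; 2; 4; 0; 7; 1; 3; 2; 10; 6; 1; 1; 8; 5; 0; 6; 4; 1; 8; 7; 2; 4; 4; 10; 6; 0; 5; 5; 8; 6; 1; 5; 9; 10; 3; 9; 0; 2; 7; 6; 7; 9; 1; 3; 2; 5; 6; 0; 5; 8; 0; 7; 0; 0; 6]%num));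
  ((1, 2, 3, [:: 3; 2; 3; 3], [:: 1; 4]), 9, (34%N, [:: 5; 0; 6; 0; 8; 3; 1; 5; 8; 10; 3; 3; 0; 8; 7; 3; 10; 10; 6; 0; 1; 8; 1; 0; 10; 4; 10; 10; 4; 9; 2; 7; 1; 0; 0; 0; 6; 6; 2; 9; 1; 5; 2; 5; 0; 0; 0; 8; 8; 10; 1; 5; 3; 10; 3; 6; 0; 5; 7; 10; 3; 4; 9; 7; 7; 1; 8; 0; 3; 6; 10; 9; 4; 9; 9; 7; 1; 10; 0; 1; 6; 0; 8; 0; 0; 10]%num));
  ((3, 2, 3, [:: 1; 1; 2], [:: 5]), 9, (34%N, [:: 8; 0; 3; 0; 4; 7; 6; 8; 4; 5; 7; 1; 0; 10; 9; 4; 8; 6; 8; 8; 5; 7; 3; 0; 8; 9; 5; 7; 2; 10; 9; 9; 6; 2; 0; 9; 3; 4; 0; 6; 8; 9; 5; 7; 6; 0; 5; 9; 1; 0; 7; 2; 5; 4; 10; 10; 0; 1; 5; 10; 4; 4; 9; 0; 7; 1; 9; 0; 2; 6; 5; 3; 2; 10; 4; 9; 6; 5; 0; 6; 3; 0; 4; 0; 0; 5]%num))]%N.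
Definition certs2 : seq cert := [::
  (2%N, [:: 0; 0; 0; 1; 0; 6; 1; 5; 3; 3; 10; 10; 1]%num, (23%N, [:: 1; 0; 10; 0; 6; 5; 9; 1; 6; 2; 5; 4; 0; 5; 8; 10; 8; 9; 1; 0; 5; 1; 0; 6; 7; 6; 1; 7; 9; 8; 5; 3; 5; 9; 0; 1; 1; 0; 3; 0; 0; 9; 0; 0; 6; 0; 5; 0; 3; 8; 10; 6; 3; 1; 8; 3; 0; 8; 4; 0; 9; 0; 0; 3]%num),
   [:: 2; 2; 8; 7; 4; 10]%num);
  (4%N, [:: 0; 0; 0; 1; 4; 5; 10; 6; 8; 8; 1; 1; 10]%num, (23%N, [:: 10; 0; 1; 0; 5; 6; 2; 10; 5; 9; 6; 2; 0; 8; 3; 7; 0; 5; 8; 9; 8; 5; 1; 10; 5; 2; 9; 5; 1; 4; 5; 5; 1; 5; 0; 6; 9; 0; 6; 0; 0; 4; 0; 0; 5; 0; 6; 0; 8; 3; 1; 5; 8; 10; 3; 8; 0; 3; 7; 0; 2; 0; 0; 8]%num),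
   [:: 2; 5; 10; 0; 3; 1]%num);
  (6%N, [:: 0; 0; 0; 1; 9; 10; 3; 0; 0; 0; 0; 0; 0]%num, (12%N, [:: 9; 0; 0; 0; 1; 1; 3; 0; 0; 4; 7; 0; 10; 5; 5; 6; 7; 1; 4; 9; 10; 8; 5; 9; 0; 1; 7; 7; 10; 2; 4; 0; 2; 3; 0; 5; 0; 0; 9]%num),
   [:: 2; 4; 9; 2; 5; 3]%num);
  (8%N, [:: 0; 0; 0; 1; 7; 1; 10; 7; 6; 3; 10; 10; 1]%num, (23%N, [:: 1; 0; 3; 0; 2; 5; 0; 8; 9; 8; 7; 6; 7; 5; 9; 10; 4; 4; 7; 9; 0; 4; 4; 4; 1; 10; 10; 10; 0; 5; 7; 3; 6; 3; 2; 8; 7; 8; 9; 7; 6; 6; 5; 5; 7; 0; 7; 9; 3; 0; 10; 6; 7; 1; 8; 3; 0; 8; 4; 0; 9; 0; 0; 3]%num),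
   [:: 2; 10; 2; 4; 1; 5]%num)].
Definition mons3 : seq (mon * nat * lp) := [::
  ((0, 2, 3, [:: 2; 4; 5; 5], [:: 1; 3]), 9, (34%N, [:: 5; 0; 10; 0; 10; 3; 3; 1; 7; 7; 3; 3; 0; 6; 6; 2; 0; 5; 9; 7; 8; 5; 2; 0; 4; 10; 1; 7; 8; 10; 6; 4; 8; 4; 0; 8; 5; 1; 2; 8; 10; 5; 4; 8; 4; 0; 8; 5; 1; 2; 8; 10; 5; 4; 8; 10; 0; 9; 5; 2; 10; 5; 9; 9; 8; 5; 1; 0; 2; 10; 10; 2; 3; 1; 9; 7; 3; 2; 0; 4; 6; 0; 6; 0; 0; 10]%num));
  ((2, 2, 3, [:: 2; 1; 1; 3], [:: 1; 3]), 9, (34%N, [:: 7; 0; 3; 0; 3; 2; 2; 8; 1; 1; 2; 9; 0; 7; 4; 8; 2; 9; 3; 2; 10; 9; 6; 0; 1; 7; 0; 7; 0; 0; 8; 0; 0; 0; 0; 0; 0; 0; 0; 0; 0; 0; 0; 0; 0; 0; 0; 0; 0; 0; 0; 0; 0; 0; 0; 4; 0; 8; 0; 8; 9; 9; 3; 10; 10; 9; 2; 0; 4; 7; 3; 9; 2; 8; 9; 1; 2; 5; 0; 10; 4; 0; 4; 0; 0; 3]%num));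
  ((1, 2, 3, [:: 2; 1; 4; 4], [:: 1; 3]), 9, (34%N, [:: 8; 0; 5; 0; 5; 7; 7; 6; 9; 9; 7; 9; 0; 7; 3; 5; 10; 7; 6; 3; 9; 7; 5; 0; 10; 3; 8; 1; 9; 3; 4; 10; 9; 7; 0; 3; 7; 2; 1; 5; 9; 5; 8; 5; 10; 0; 9; 10; 6; 3; 4; 5; 4; 2; 4; 0; 0; 0; 8; 2; 2; 5; 9; 3; 8; 5; 4; 0; 8; 10; 5; 6; 7; 6; 0; 9; 7; 1; 0; 2; 3; 0; 3; 0; 0; 5]%num));
  ((1, 2, 3, [:: 2; 2; 2; 5], [:: 1; 3]), 9, (34%N, [:: 10; 0; 9; 0; 9; 6; 6; 2; 3; 3; 6; 7; 0; 3; 1; 6; 5; 4; 5; 0; 2; 4; 7; 0; 3; 8; 5; 4; 7; 6; 4; 9; 7; 0; 0; 0; 3; 9; 9; 6; 2; 8; 3; 6; 0; 0; 0; 1; 3; 3; 2; 8; 10; 1; 2; 1; 0; 2; 4; 3; 6; 2; 8; 4; 1; 2; 4; 0; 8; 4; 9; 10; 6; 2; 6; 3; 6; 4; 0; 8; 1; 0; 1; 0; 0; 9]%num));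
  ((1, 2, 3, [:: 2; 2; 3; 3], [:: 1; 3]), 9, (34%N, [:: 2; 0; 4; 0; 4; 10; 10; 7; 5; 5; 10; 0; 0; 0; 9; 5; 5; 7; 6; 2; 9; 7; 7; 0; 3; 3; 1; 0; 8; 10; 9; 4; 8; 6; 0; 1; 5; 5; 1; 7; 6; 10; 9; 7; 8; 0; 5; 3; 3; 5; 2; 8; 6; 1; 2; 5; 0; 10; 4; 0; 4; 0; 0; 3; 0; 0; 2; 0; 4; 0; 4; 10; 10; 7; 5; 5; 10; 3; 0; 6; 9; 0; 9; 0; 0; 4]%num));
  ((1, 2, 3, [:: 3; 3; 5], [:: 4]), 9, (34%N, [:: 5; 0; 10; 0; 10; 3; 3; 1; 7; 7; 3; 6; 0; 1; 6; 8; 4; 9; 3; 9; 10; 9; 10; 0; 9; 7; 8; 5; 9; 3; 7; 10; 9; 9; 0; 7; 7; 6; 0; 4; 5; 10; 2; 4; 4; 0; 8; 8; 10; 0; 3; 1; 2; 7; 3; 9; 0; 7; 6; 3; 8; 2; 8; 0; 1; 2; 10; 0; 9; 4; 10; 7; 3; 1; 10; 7; 3; 2; 0; 4; 6; 0; 6; 0; 0; 10]%num))]%N.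
Definition certs3 : seq cert := [::
  (2%N, [:: 0; 0; 0; 8; 7; 8; 7; 2; 6; 5; 9; 10; 1]%num, (23%N, [:: 9; 0; 7; 0; 7; 1; 1; 4; 6; 6; 1; 8; 0; 8; 2; 10; 2; 5; 9; 8; 0; 8; 6; 6; 8; 9; 0; 10; 8; 0; 4; 2; 8; 9; 0; 2; 8; 5; 8; 7; 6; 4; 9; 7; 8; 0; 5; 3; 3; 5; 2; 8; 6; 1; 2; 5; 0; 10; 4; 0; 4; 0; 0; 3]%num),
   [:: 8; 0; 8; 1; 7; 3]%num);
  (4%N, [:: 0; 0; 0; 8; 1; 6; 8; 7; 10; 1; 4; 2; 9]%num, (23%N, [:: 4; 0; 8; 0; 8; 9; 9; 3; 10; 10; 9; 0; 0; 6; 7; 3; 10; 6; 4; 7; 4; 0; 7; 8; 9; 6; 1; 8; 6; 5; 7; 10; 5; 4; 0; 10; 7; 1; 6; 8; 10; 1; 4; 8; 6; 0; 1; 5; 5; 1; 7; 6; 10; 9; 7; 1; 0; 2; 3; 0; 3; 0; 0; 5]%num),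
   [:: 10; 7; 2; 5; 4; 5]%num);
  (6%N, [:: 0; 0; 0; 8; 10; 2; 7; 9; 5; 6; 2; 1; 10]%num, (23%N, [:: 2; 0; 4; 0; 4; 10; 10; 7; 5; 5; 10; 3; 0; 1; 9; 8; 9; 2; 4; 1; 6; 0; 6; 6; 9; 4; 2; 4; 8; 5; 4; 2; 5; 8; 9; 10; 9; 8; 0; 3; 0; 5; 2; 1; 6; 0; 7; 8; 8; 4; 9; 3; 5; 10; 9; 6; 0; 1; 7; 0; 7; 0; 0; 8]%num),
   [:: 7; 0; 3; 3; 9; 5]%num);
  (8%N, [:: 0; 0; 0; 8; 2; 0; 3; 4; 9; 5; 9; 10; 1]%num, (23%N, [:: 9; 0; 0; 0; 4; 1; 9; 0; 4; 5; 0; 7; 7; 0; 0; 1; 7; 8; 2; 2; 5; 8; 4; 6; 10; 8; 7; 4; 2; 6; 6; 7; 7; 9; 4; 2; 4; 5; 10; 8; 1; 8; 3; 1; 5; 0; 9; 1; 3; 7; 2; 8; 10; 1; 2; 5; 0; 10; 4; 0; 4; 0; 0; 3]%num),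
   [:: 6; 2; 0; 4; 6; 5]%num)].
Definition mons5 : seq (mon * nat * lp) := [::
  ((0, 2, 3, [:: 4; 4; 5; 5], [:: 2; 5]), 9, (34%N, [:: 8; 0; 9; 0; 3; 7; 8; 2; 5; 1; 7; 0; 0; 0; 4; 9; 4; 2; 6; 7; 3; 10; 2; 0; 5; 1; 3; 0; 8; 2; 3; 1; 7; 6; 0; 4; 4; 3; 1; 8; 2; 8; 1; 7; 6; 0; 4; 4; 3; 1; 8; 2; 8; 1; 7; 9; 0; 6; 4; 0; 5; 0; 0; 3; 0; 0; 6; 0; 4; 0; 5; 8; 6; 7; 1; 9; 8; 4; 0; 10; 3; 0; 1; 0; 0; 5]%num));
  ((2, 2, 3, [:: 4; 1; 1; 3], [:: 2; 5]), 9, (34%N, [:: 9; 0; 6; 0; 2; 1; 9; 5; 7; 8; 1; 9; 0; 6; 10; 8; 0; 3; 9; 8; 10; 4; 10; 0; 3; 7; 3; 2; 8; 2; 2; 1; 7; 4; 0; 10; 4; 5; 2; 6; 7; 4; 9; 8; 3; 0; 2; 3; 1; 7; 10; 8; 3; 4; 6; 7; 0; 1; 5; 7; 7; 4; 1; 9; 6; 9; 3; 0; 2; 2; 7; 6; 4; 1; 4; 6; 9; 10; 0; 3; 2; 0; 8; 0; 0; 7]%num));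
  ((1, 2, 3, [:: 4; 1; 4; 4], [:: 2; 5]), 9, (34%N, [:: 4; 0; 10; 0; 7; 9; 4; 1; 8; 6; 9; 1; 0; 8; 2; 9; 7; 2; 6; 0; 3; 10; 9; 0; 6; 1; 7; 2; 4; 1; 6; 6; 9; 0; 0; 0; 2; 10; 2; 1; 3; 9; 7; 5; 0; 0; 0; 6; 8; 6; 3; 9; 5; 10; 4; 7; 0; 1; 7; 6; 9; 5; 4; 7; 2; 3; 10; 0; 3; 8; 8; 3; 3; 9; 1; 10; 4; 2; 0; 5; 7; 0; 6; 0; 0; 8]%num));
  ((1, 2, 3, [:: 4; 2; 2; 5], [:: 2; 5]), 9, (34%N, [:: 5; 0; 7; 0; 6; 3; 5; 4; 10; 2; 3; 6; 0; 4; 8; 1; 5; 10; 8; 4; 4; 6; 3; 0; 2; 5; 0; 9; 0; 0; 1; 0; 0; 0; 0; 0; 0; 0; 0; 0; 0; 0; 0; 0; 0; 0; 0; 0; 0; 0; 0; 0; 0; 0; 0; 6; 0; 4; 0; 5; 8; 6; 7; 1; 9; 8; 5; 0; 7; 3; 10; 6; 1; 3; 7; 7; 5; 8; 0; 9; 6; 0; 2; 0; 0; 10]%num));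
  ((1, 2, 3, [:: 4; 2; 3; 3], [:: 2; 5]), 9, (34%N, [:: 1; 0; 8; 0; 10; 5; 1; 3; 2; 7; 5; 6; 0; 4; 6; 2; 3; 9; 5; 6; 8; 1; 8; 0; 9; 10; 9; 6; 2; 6; 6; 3; 10; 4; 0; 10; 1; 1; 10; 10; 8; 7; 4; 6; 9; 0; 6; 5; 5; 6; 6; 7; 2; 9; 8; 0; 0; 0; 3; 4; 3; 7; 10; 8; 5; 2; 10; 0; 3; 9; 2; 4; 9; 5; 0; 8; 1; 6; 0; 4; 10; 0; 7; 0; 0; 2]%num));
  ((1, 2, 3, [:: 1; 5; 5], [:: 3]), 9, (34%N, [:: 2; 0; 5; 0; 9; 10; 2; 6; 4; 3; 10; 4; 0; 10; 1; 1; 10; 10; 8; 7; 4; 6; 5; 0; 7; 5; 9; 8; 2; 6; 5; 3; 10; 2; 0; 5; 1; 3; 0; 8; 2; 3; 1; 7; 8; 0; 9; 4; 1; 0; 10; 8; 1; 4; 6; 8; 0; 9; 5; 6; 1; 5; 4; 0; 2; 3; 3; 0; 2; 8; 4; 1; 7; 10; 9; 5; 2; 1; 0; 8; 9; 0; 3; 0; 0; 4]%num))]%N.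
Definition certs5 : seq cert := [::
  (2%N, [:: 0; 0; 0; 7; 1; 0; 3; 6; 5; 9; 7; 10; 1]%num, (23%N, [:: 3; 0; 2; 0; 8; 4; 3; 9; 6; 10; 4; 3; 0; 1; 7; 7; 0; 4; 5; 1; 0; 5; 4; 3; 5; 0; 6; 7; 1; 4; 1; 9; 6; 5; 0; 5; 3; 6; 1; 5; 4; 4; 2; 3; 4; 0; 10; 8; 3; 6; 8; 2; 0; 1; 7; 9; 0; 6; 4; 0; 5; 0; 0; 3]%num),
   [:: 9; 5; 1; 10; 4; 6]%num);
  (4%N, [:: 0; 0; 0; 7; 0; 0; 10; 9; 2; 8; 5; 4; 7]%num, (23%N, [:: 10; 0; 3; 0; 1; 6; 10; 8; 9; 4; 6; 10; 0; 0; 5; 4; 0; 2; 9; 0; 7; 4; 3; 10; 5; 2; 1; 6; 5; 4; 6; 8; 1; 8; 0; 10; 10; 9; 3; 2; 6; 6; 3; 10; 6; 0; 4; 1; 10; 9; 1; 3; 0; 7; 5; 8; 0; 9; 6; 0; 2; 0; 0; 10]%num),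
   [:: 7; 3; 8; 5; 7; 9]%num);
  (6%N, [:: 0; 0; 0; 7; 7; 10; 2; 9; 2; 8; 5; 4; 7]%num, (23%N, [:: 10; 0; 3; 0; 1; 6; 10; 8; 9; 4; 6; 10; 0; 3; 5; 6; 0; 10; 6; 0; 4; 8; 4; 2; 3; 0; 0; 3; 7; 8; 4; 2; 3; 8; 9; 1; 1; 4; 8; 1; 5; 9; 3; 6; 9; 0; 8; 1; 10; 7; 1; 3; 0; 7; 5; 8; 0; 9; 6; 0; 2; 0; 0; 10]%num),
   [:: 6; 2; 10; 0; 2; 1]%num);
  (8%N, [:: 0; 0; 0; 7; 2; 8; 5; 6; 10; 6; 1; 3; 8]%num, (23%N, [:: 2; 0; 9; 0; 8; 10; 9; 2; 8; 10; 7; 7; 7; 4; 4; 0; 9; 2; 8; 2; 9; 8; 1; 8; 10; 10; 5; 8; 0; 8; 9; 2; 2; 3; 8; 3; 3; 6; 1; 7; 2; 5; 10; 9; 10; 0; 6; 7; 2; 4; 9; 5; 4; 8; 1; 6; 0; 4; 10; 0; 7; 0; 0; 2]%num),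
   [:: 4; 0; 9; 2; 5; 8]%num)].
Definition mons6 : seq (mon * nat * lp) := [::
  ((2, 6, 2, [::], [:: 4; 5; 5]), 29, (34%N, [:: 2; 0; 0; 0; 0; 10; 0; 0; 0; 0; 8; 8; 0; 0; 0; 4; 7; 0; 0; 0; 8; 10; 7; 0; 0; 10; 5; 2; 0; 0; 2; 10; 6; 2; 0; 0; 7; 3; 10; 0; 0; 8; 6; 8; 10; 0; 0; 2; 4; 6; 0; 0; 7; 8; 7; 4; 0; 0; 10; 9; 9; 0; 0; 2; 7; 5; 0; 0; 0; 6; 8; 0; 0; 0; 10; 5; 0; 0; 0; 0; 9; 0; 0; 0; 0; 4]%num));
  ((0, 6, 2, [::], [:: 1; 1; 3]), 29, (34%N, [:: 3; 0; 0; 0; 0; 4; 0; 0; 0; 0; 1; 9; 0; 0; 0; 6; 1; 0; 0; 0; 1; 3; 9; 0; 0; 4; 7; 1; 0; 0; 3; 3; 3; 9; 0; 0; 1; 7; 1; 0; 0; 9; 3; 3; 9; 0; 0; 1; 7; 1; 0; 0; 9; 3; 3; 6; 0; 0; 1; 7; 8; 0; 0; 9; 3; 2; 0; 0; 0; 1; 1; 0; 0; 0; 9; 2; 0; 0; 0; 0; 8; 0; 0; 0; 0; 6]%num));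
  ((1, 6, 2, [::], [:: 1; 4; 4]), 29, (34%N, [:: 4; 0; 0; 0; 0; 9; 0; 0; 0; 0; 5; 4; 0; 0; 0; 8; 9; 0; 0; 0; 5; 5; 5; 0; 0; 9; 8; 3; 0; 0; 4; 5; 9; 9; 0; 0; 9; 10; 1; 0; 0; 4; 9; 3; 3; 0; 0; 3; 7; 4; 0; 0; 5; 3; 1; 8; 0; 0; 1; 6; 7; 0; 0; 9; 1; 10; 0; 0; 0; 4; 5; 0; 0; 0; 3; 10; 0; 0; 0; 0; 7; 0; 0; 0; 0; 8]%num));
  ((1, 6, 2, [::], [:: 2; 2; 5]), 29, (34%N, [:: 1; 0; 0; 0; 0; 5; 0; 0; 0; 0; 4; 5; 0; 0; 0; 2; 3; 0; 0; 0; 4; 9; 1; 0; 0; 5; 10; 5; 0; 0; 1; 9; 4; 9; 0; 0; 3; 2; 1; 0; 0; 5; 4; 3; 4; 0; 0; 5; 7; 9; 0; 0; 1; 3; 5; 2; 0; 0; 1; 8; 10; 0; 0; 9; 5; 8; 0; 0; 0; 9; 4; 0; 0; 0; 4; 8; 0; 0; 0; 0; 10; 0; 0; 0; 0; 2]%num));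
  ((1, 6, 2, [::], [:: 2; 3; 3]), 29, (34%N, [:: 5; 0; 0; 0; 0; 3; 0; 0; 0; 0; 9; 1; 0; 0; 0; 10; 5; 0; 0; 0; 9; 4; 3; 0; 0; 3; 2; 4; 0; 0; 5; 4; 1; 9; 0; 0; 5; 6; 1; 0; 0; 1; 1; 3; 5; 0; 0; 4; 7; 3; 0; 0; 3; 3; 9; 10; 0; 0; 1; 10; 6; 0; 0; 9; 9; 7; 0; 0; 0; 3; 9; 0; 0; 0; 5; 7; 0; 0; 0; 0; 6; 0; 0; 0; 0; 10]%num))]%N.
Definition certs6 : seq cert := [::
  (2%N, [:: 0; 0; 0; 4; 1; 8; 1; 4; 2; 0; 1; 9; 2]%num, (10%N, [:: 2; 0; 0; 0; 2; 0; 9; 0; 5; 6; 9; 10; 2; 2; 0; 1; 1; 7; 0; 9; 9; 0; 0; 0; 8; 2; 0; 0; 0; 5; 2; 0; 0; 0; 9; 1; 0; 0; 0; 4; 2; 0; 0; 0; 0; 8; 0; 0; 0; 0; 6]%num),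
   [:: 7; 3; 1; 5; 9]%num);
  (4%N, [:: 0; 0; 0; 4; 10; 4; 6; 2; 1; 0; 6; 10; 1]%num, (12%N, [:: 7; 0; 1; 0; 0; 2; 1; 0; 10; 0; 8; 3; 0; 5; 8; 4; 0; 6; 6; 6; 2; 10; 10; 0; 0; 8; 4; 1; 0; 0; 6; 8; 1; 0; 0; 0; 10; 6; 0; 0; 0; 2; 1; 0; 0; 0; 0; 4; 0; 0; 0; 0; 3]%num),
   [:: 9; 7; 6; 8; 10]%num);
  (6%N, [:: 0; 0; 0; 4; 2; 6; 8; 9; 10; 0; 5; 1; 10]%num, (12%N, [:: 6; 0; 10; 0; 0; 8; 10; 0; 9; 0; 3; 8; 9; 9; 3; 0; 0; 5; 3; 5; 8; 1; 1; 7; 0; 10; 7; 10; 10; 0; 2; 3; 10; 3; 0; 0; 1; 5; 9; 0; 0; 9; 10; 0; 0; 0; 0; 7; 0; 0; 0; 0; 8]%num),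
   [:: 1; 5; 6; 4; 2]%num);
  (8%N, [:: 0; 0; 0; 4; 3; 0; 10; 5; 10; 0; 9; 4; 7]%num, (21%N, [:: 4; 0; 0; 0; 0; 7; 0; 0; 0; 2; 3; 7; 0; 0; 10; 2; 0; 8; 0; 1; 7; 3; 9; 7; 0; 4; 9; 8; 8; 10; 8; 4; 9; 0; 7; 3; 7; 5; 0; 8; 6; 7; 7; 0; 0; 2; 9; 10; 0; 0; 7; 7; 0; 0; 0; 0; 6; 0; 0; 0; 0; 10]%num),
   [:: 6; 6; 1; 9; 9]%num)].
Definition mons8 : seq (mon * nat * lp) := [::
  ((1, 2, 3, [:: 1; 4; 5; 5], [:: 4; 5]), 9, (34%N, [:: 10; 0; 5; 0; 4; 6; 8; 6; 1; 5; 6; 3; 0; 7; 9; 2; 8; 4; 3; 10; 8; 3; 10; 0; 5; 10; 0; 8; 0; 0; 2; 0; 0; 0; 0; 0; 0; 0; 0; 0; 0; 0; 0; 0; 0; 0; 0; 0; 0; 0; 0; 0; 0; 0; 0; 1; 0; 6; 0; 7; 5; 3; 5; 10; 6; 5; 8; 0; 4; 2; 9; 3; 7; 8; 1; 3; 8; 1; 0; 6; 1; 0; 3; 0; 0; 9]%num));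
  ((3, 2, 3, [:: 1; 1; 1; 3], [:: 4; 5]), 9, (34%N, [:: 3; 0; 7; 0; 10; 4; 9; 4; 8; 7; 4; 5; 0; 8; 6; 4; 2; 8; 6; 0; 5; 6; 3; 0; 7; 9; 2; 8; 4; 3; 10; 8; 3; 0; 0; 0; 10; 7; 2; 3; 5; 1; 6; 5; 0; 0; 0; 2; 8; 7; 5; 1; 9; 10; 1; 8; 0; 4; 7; 7; 4; 3; 5; 7; 6; 5; 6; 0; 3; 2; 6; 4; 1; 9; 3; 2; 9; 8; 0; 4; 8; 0; 2; 0; 0; 6]%num));
  ((2, 2, 3, [:: 1; 1; 4; 4], [:: 4; 5]), 9, (34%N, [:: 5; 0; 8; 0; 2; 3; 4; 3; 6; 8; 3; 0; 0; 0; 10; 7; 2; 3; 5; 1; 6; 5; 3; 0; 7; 2; 7; 0; 3; 5; 6; 6; 5; 5; 0; 8; 2; 10; 10; 9; 4; 4; 7; 4; 4; 0; 2; 6; 8; 8; 5; 1; 1; 10; 1; 7; 0; 9; 7; 0; 10; 0; 0; 8; 0; 0; 3; 0; 7; 0; 10; 4; 9; 4; 8; 7; 4; 6; 0; 3; 6; 0; 7; 0; 0; 10]%num));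
  ((2, 2, 3, [:: 1; 2; 2; 5], [:: 4; 5]), 9, (34%N, [:: 9; 0; 10; 0; 8; 1; 5; 1; 2; 10; 1; 8; 0; 4; 7; 7; 4; 3; 5; 7; 6; 5; 10; 0; 5; 2; 1; 2; 2; 7; 10; 4; 7; 4; 0; 2; 5; 4; 10; 8; 6; 2; 5; 6; 5; 0; 8; 9; 5; 7; 10; 2; 8; 9; 2; 0; 0; 0; 3; 1; 5; 2; 7; 8; 4; 7; 6; 0; 3; 5; 7; 9; 3; 5; 0; 6; 5; 2; 0; 1; 2; 0; 6; 0; 0; 7]%num));
  ((2, 2, 3, [:: 1; 2; 3; 3], [:: 4; 5]), 9, (34%N, [:: 4; 0; 2; 0; 6; 9; 1; 9; 7; 2; 9; 1; 0; 6; 8; 6; 0; 1; 9; 2; 2; 9; 7; 0; 9; 8; 4; 8; 8; 6; 7; 5; 6; 4; 0; 2; 9; 9; 2; 7; 8; 9; 3; 8; 9; 0; 10; 1; 1; 10; 2; 7; 1; 4; 7; 8; 0; 4; 5; 10; 8; 9; 4; 9; 7; 4; 4; 0; 2; 6; 8; 8; 5; 1; 1; 10; 1; 7; 0; 9; 7; 0; 10; 0; 0; 8]%num));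
  ((0, 2, 3, [:: 3; 4; 4], [:: 2]), 9, (34%N, [:: 7; 0; 9; 0; 5; 2; 10; 2; 4; 9; 2; 9; 0; 10; 3; 9; 6; 7; 8; 10; 3; 8; 9; 0; 10; 1; 1; 10; 2; 7; 1; 4; 7; 2; 0; 1; 5; 1; 0; 2; 7; 4; 4; 7; 2; 0; 1; 5; 1; 0; 2; 7; 4; 4; 7; 6; 0; 3; 5; 7; 9; 3; 5; 0; 6; 5; 4; 0; 2; 2; 3; 5; 6; 10; 5; 1; 10; 4; 0; 2; 4; 0; 1; 0; 0; 3]%num))]%N.
Definition certs8 : seq cert := [::
  (2%N, [:: 0; 0; 0; 3; 3; 8; 5; 4; 8; 4; 4; 10; 1]%num, (23%N, [:: 5; 0; 8; 0; 2; 3; 4; 3; 6; 8; 3; 0; 0; 8; 10; 1; 2; 9; 9; 3; 5; 8; 10; 0; 7; 1; 6; 2; 0; 7; 7; 8; 5; 4; 0; 10; 10; 7; 1; 3; 5; 1; 6; 5; 4; 0; 2; 2; 3; 5; 6; 10; 5; 1; 10; 4; 0; 2; 4; 0; 1; 0; 0; 3]%num),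
   [:: 10; 7; 10; 5; 8; 7]%num);
  (4%N, [:: 0; 0; 0; 3; 5; 10; 9; 5; 10; 5; 5; 7; 4]%num, (23%N, [:: 9; 0; 10; 0; 8; 1; 5; 1; 2; 10; 1; 5; 0; 2; 7; 9; 0; 5; 0; 3; 7; 1; 0; 0; 3; 3; 4; 4; 4; 5; 4; 2; 2; 4; 0; 0; 8; 6; 1; 1; 9; 2; 2; 9; 5; 0; 8; 8; 1; 9; 2; 7; 9; 4; 7; 5; 0; 8; 5; 0; 4; 0; 0; 1]%num),
   [:: 8; 5; 6; 8; 9; 6]%num);
  (6%N, [:: 0; 0; 0; 3; 2; 10; 3; 0; 0; 0; 0; 0; 0]%num, (12%N, [:: 6; 0; 3; 0; 9; 8; 7; 8; 2; 3; 7; 7; 0; 9; 0; 9; 2; 7; 3; 6; 9; 10; 3; 9; 4; 6; 8; 7; 10; 8; 7; 0; 6; 3; 0; 3; 0; 0; 9]%num),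
   [:: 3; 4; 3; 8; 1; 3]%num);
  (8%N, [:: 0; 0; 0; 3; 1; 4; 7; 10; 8; 8; 8; 9; 2]%num, (23%N, [:: 10; 0; 9; 0; 6; 6; 3; 2; 2; 2; 2; 5; 7; 10; 3; 6; 9; 10; 4; 3; 3; 1; 0; 4; 5; 6; 6; 6; 5; 4; 7; 9; 2; 0; 3; 9; 4; 6; 1; 10; 4; 1; 6; 7; 7; 0; 4; 2; 6; 7; 1; 9; 3; 2; 9; 8; 0; 4; 8; 0; 2; 0; 0; 6]%num),
   [:: 0; 2; 10; 5; 10; 5]%num)].

Lemma mons_check : [&& all (mon_check 1) mons1, all (mon_check 2) mons2, all (mon_check 3) mons3,
  all (mon_check 5) mons5, all (mon_check 6) mons6 & all (mon_check 8) mons8].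
Proof. by vm_compute. Qed.
Lemma certs_check : [&& all (cert_check 1 mons1) certs1, all (cert_check 2 mons2) certs2,
  all (cert_check 3 mons3) certs3, all (cert_check 5 mons5) certs5,
  all (cert_check 6 mons6) certs6 & all (cert_check 8 mons8) certs8].
Proof. by vm_compute. Qed.

(** * Reduction of the integer series modulo 11 and assembly *)

(* @@Z *)
Lemma pinvM (L : comNzRingType) (f g : ps L) :
  f 0%N = 1 -> g 0%N = 1 -> pinv (f * g) = pinv f * pinv g.
Proof.
move=> f0 g0; have h0 : (f * g) 0%N = 1 by rewrite psM0 f0 g0 mulr1.
apply: (@unit_inj _ (f * g) (pinv (f * g))); first by rewrite mulrC pinvP.
rewrite pinvP // mulrACA !pinvP // mulr1 //.
Qed.

(** Reduction modulo 11, compatible with all the operations on integer series used in the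
    statement. *)
Definition mu (f : series) : ps K := fun n => (f n)%:~R.

Lemma mu_add f g : mu (sadd f g) = mu f + mu g.
Proof. by apply: psP => n; rewrite /mu /sadd intrD. Qed.
Lemma mu_mul f g : mu (smul f g) = mu f * mu g.
Proof.
apply: psP => n; rewrite /mu /smul psM big_mkord rmorph_sum.
by apply: eq_bigr => i _; exact: intrM.
Qed.
Lemma mu_one : mu sone = 1.
Proof. by apply: psP => -[|n]; rewrite ps1. Qed.
Lemma mu_zero : mu szero = 0. Proof. by []. Qed.
Lemma mu_scale c f : mu (sscale c f) = psc c%:~R * mu f.
Proof. by apply: psP => n; rewrite pscM /mu /sscale intrM. Qed.
Lemma mu_shift k f : mu (sshift k f) = psX k * mu f.
Proof. by apply: psP => n; rewrite psXM /mu /sshift; case: ifP. Qed.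
Lemma mu_pow f k : mu (spow f k) = mu f ^+ k.
Proof.
by elim: k => [|k IH]; rewrite ?mu_one // /spow iterS mu_mul -/(spow f k) IH exprS.
Qed.
Lemma mu_inv f : mu (sinv f) = pinv (mu f).
Proof.
have nmap s i : nth 0 (map (fun z : int => z%:~R : K) s) i = (nth 0 s i)%:~R.
  by case: (ltnP i (size s)) => h; [rewrite (nth_map 0) | rewrite !nth_default ?size_map].
have h n : pinv_seq (mu f) n = map (fun z : int => z%:~R : K) (sinv_seq f n).
  elim: n => [|n IH] //=; rewrite map_rcons -IH; congr rcons.
  rewrite rmorphN rmorph_sum; congr (- _); apply: eq_bigr => i _.
  by rewrite [RHS]intrM -nmap -IH.
by apply: psP => n; rewrite /mu /sinv /pinv h nmap.
Qed.
Lemma mu_onemq k : (0 < k)%N -> mu (onemq k) = 1 - psX k.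
Proof.
move=> hk; apply: psP => n; rewrite psB ps1 /psX /mu /onemq.
case: (eqVneq n 0%N) => [->|_]; first by case: eqP hk => [<-|_] //; rewrite subr0.
by case: eqP => _; rewrite ?subr0 // sub0r rmorphN1.
Qed.
Lemma mu_qpoch a m : (0 < a)%N -> mu (qpoch a m) = prodq K a m.
Proof.
move=> ha; apply: psP => n; rewrite {1}/mu /qpoch /prodq.
have -> : \prod_(i < n.+1) (1 - psX (a + m * i)) =
    mu (\big[smul/sone]_(0 <= i < n.+1) onemq (a + m * i)).
  rewrite -(big_mkord xpredT (fun i => 1 - psX (a + m * i))).
  elim/big_rec2: _ => [|i x y _ e]; first by rewrite mu_one.
  by rewrite mu_mul -e mu_onemq // addn_gt0 ha.
by [].
Qed.

Lemma mu_P i : (0 < i < 11)%N -> mu (Defs.P i) = PK i.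
Proof.
move=> h; rewrite /Defs.P /Jam !mu_mul !mu_qpoch //; lia.
Qed.
Lemma mu_J11 : mu (Jm 11) = J ^+ 11.
Proof. by rewrite /Jm mu_qpoch // J11E. Qed.
Lemma mu_J1 : mu (Jm 1) = J.
Proof. by rewrite /Jm mu_qpoch. Qed.

Lemma pinvX (L : comNzRingType) (f : ps L) k : f 0%N = 1 -> pinv (f ^+ k) = pinv f ^+ k.
Proof.
move=> f0; apply: (@unit_inj _ (f ^+ k) (pinv (f ^+ k))).
  by rewrite mulrC pinvP // psX0 f0 expr1n.
by rewrite pinvP ?psX0 ?f0 ?expr1n // -exprMn pinvP // expr1n.
Qed.

Lemma mu_pref : mu pref = (J ^+ 11) ^+ 2 * Ji ^+ 3.
Proof. by rewrite /pref /sdiv mu_mul mu_inv !mu_pow mu_J11 mu_J1 pinvX ?J0. Qed.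

Definition mon_sum (cs : seq int) (us : seq (mon * nat * lp)) : ps K :=
  \sum_(u <- zip cs us) psc u.1%:~R * mono_of u.2.1.1.

Definition mu_Ps := (@mu_P 1 isT, @mu_P 2 isT, @mu_P 3 isT, @mu_P 4 isT, @mu_P 5 isT).
Definition mu_all := (mu_Ps, mu_pref, mu_J11, mu_J1, (mu_add, mu_scale, mu_mul, mu_shift, mu_pow, mu_inv)).

Lemma psX0_1 (L : comNzRingType) (f : ps L) k : f 0%N = 1 -> (f ^+ k) 0%N = 1.
Proof. by move=> f0; rewrite psX0 f0 expr1n. Qed.

(** Turns the P_i, their inverses, J_11, 1/J and q into atoms, so that matching a right-hand side
    with its monomials is an identity for [ring]. *)
Ltac expand_monomials :=
  rewrite /mon_sum [zip _ _]/= !big_cons big_nil /mono_of /mono /= !big_cons !big_nil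
    (psX_0 K) -?(psXX _ 1 2) -?(psXX _ 1 3);
  move: (@PK0 1 isT) (@PK0 2 isT) (@PK0 3 isT) (@PK0 4 isT) (@PK0 5 isT);
  let p1 := fresh "p" in let p2 := fresh "p" in let p3 := fresh "p" in
  let p4 := fresh "p" in let p5 := fresh "p" in
  move: (PK 1) (PK 2) (PK 3) (PK 4) (PK 5) => p1 p2 p3 p4 p5 ? ? ? ? ?;
  rewrite !(pinvM, pinvX); try by [|apply: psX0_1];
  move: (pinv p1) (pinv p2) (pinv p3) (pinv p4) (pinv p5) => ? ? ? ? ?;
  move: (J ^+ 11) Ji (psX 1) => ? ? ?; ring.

Lemma mu_br1 a b c d e f : mu (br1 a b c d e f) = mon_sum [:: a; b; c; d; e; f] mons1.
Proof. by rewrite /br1 /br /sdiv !mu_all /mons1; expand_monomials. Qed.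
Lemma mu_br2 a b c d e f : mu (br2 a b c d e f) = mon_sum [:: a; b; c; d; e; f] mons2.
Proof. by rewrite /br2 /br /sdiv !mu_all /mons2; expand_monomials. Qed.
Lemma mu_br3 a b c d e f : mu (br3 a b c d e f) = mon_sum [:: a; b; c; d; e; f] mons3.
Proof. by rewrite /br3 /br /sdiv !mu_all /mons3; expand_monomials. Qed.
Lemma mu_br5 a b c d e f : mu (br5 a b c d e f) = mon_sum [:: a; b; c; d; e; f] mons5.
Proof. by rewrite /br5 /br /sdiv !mu_all /mons5; expand_monomials. Qed.
Lemma mu_br8 a b c d e f : mu (br8 a b c d e f) = mon_sum [:: a; b; c; d; e; f] mons8.
Proof. by rewrite /br8 /br /sdiv !mu_all /mons8; expand_monomials. Qed.
Lemma mu_Theta a b c d e : mu (Theta a b c d e) = mon_sum [:: a; b; c; d; e] mons6.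
Proof.
rewrite /Theta /sdiv !mu_all pinvX ?J0 // -[pinv J]/Ji /mons6; expand_monomials.
Qed.

Lemma intK_dvd (z : int) : (11 %| z)%Z = (z%:~R == 0 :> K).
Proof.
have h (n : nat) : (11 %| n%:Z)%Z = (n%:R == 0 :> K).
  rewrite dvdzE /=; apply/idP/eqP => [/dvdnP[q ->]|/(@natK_inj n 0)].
    by rewrite natrM K11 mulr0.
  by rewrite mod0n => /eqP.
case: z => n; first exact: h.
by rewrite NegzE rmorphN oppr_eq0 -[RHS]h !dvdzE abszN.
Qed.

Lemma mu_T k r m : (T k r m)%:~R = momK k (11 * m + r).
Proof.
rewrite /T /Nmom /momK big_mkord rmorph_sum; apply: eq_bigr => i _ /=.
by rewrite intrM rmorphXn.
Qed.

Definition same11 (c : N) (z : int) : bool := (11 %| (N.to_nat c)%:Z - z)%Z.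
Lemma same11P c z : same11 c z -> cN (ps K) c = psc z%:~R.
Proof.
rewrite /same11 intK_dvd rmorphB subr_eq0 => /eqP h.
apply: psP => n; rewrite /cN psnat /psc; case: ifP => // _; exact: h.
Qed.

Lemma mon_sum_eq cs cz us : all2 same11 cs cz ->
  \sum_(u <- zip cs us) cN (ps K) u.1 * mono_of u.2.1.1 = mon_sum cz us.
Proof.
rewrite /mon_sum; elim: cs cz us => [|c cs IH] [|z cz] [|u us] //=; rewrite ?big_nil // => /andP[h hs].
by rewrite !big_cons (same11P h) (IH _ _ hs).
Qed.

Definition cert_match (certs : seq cert) (i k : nat) (cz : seq int) : bool :=
  if drop i certs is (k', om, U, cs) :: _ then (k == k') && all2 same11 cs cz else false.

(** Entry [i] of a certificate list proves one congruence; [cert_match] compares its residues with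
    the signed coefficients of the statement. *)
Lemma cert_cong (i k r : nat) us certs cz f :
  all (mon_check r) us -> all (cert_check r us) certs -> mu f = mon_sum cz us ->
  cert_match certs i k cz -> cong11 (T k r) f.
Proof.
move=> hu; rewrite -{1}(cat_take_drop i certs) all_cat /cert_match => /andP[_].
case: (drop i certs) => [|[[[k' om] U] cs] l] //= /andP[hc _] hf /andP[/eqP -> hz] n.
rewrite intK_dvd rmorphB subr_eq0 /= mu_T (moment_mono n hu hc) (mon_sum_eq us hz) -hf.
exact: eqxx.
Qed.

Lemma mu_zero1 : mu szero = mon_sum (nseq 6 0) mons1.
Proof.
rewrite /mon_sum; have z : psc (0 : int)%:~R = 0 :> ps K by apply: psP => -[|n].
by rewrite /mons1 /= !big_cons big_nil /= !z !mul0r !addr0.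
Qed.

Theorem theorem2p8 :
  (* residue 1 *)
  cong11 (T 2 1) (br1 0 (-1) (-5) (-4) (-3) (-2)) /\
  cong11 (T 4 1) szero /\
  cong11 (T 6 1) (br1 0 (-1) (-4) 2 5 3) /\
  cong11 (T 8 1) (br1 0 5 1 4 (-4) (-3)) /\
  (* residue 2 *)
  cong11 (T 2 2) (br2 2 2 (-3) (-4) 4 (-1)) /\
  cong11 (T 4 2) (br2 2 5 (-1) 0 3 1) /\
  cong11 (T 6 2) (br2 2 4 (-2) 2 5 3) /\
  cong11 (T 8 2) (br2 2 (-1) 2 4 1 5) /\
  (* residue 3 *)
  cong11 (T 2 3) (br3 (-3) 0 (-3) 1 (-4) 3) /\
  cong11 (T 4 3) (br3 (-1) (-4) 2 5 4 5) /\
  cong11 (T 6 3) (br3 (-4) 0 3 3 (-2) 5) /\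
  cong11 (T 8 3) (br3 (-5) 2 0 4 (-5) 5) /\
  (* residue 5 *)
  cong11 (T 2 5) (br5 (-2) 5 1 (-1) 4 (-5)) /\
  cong11 (T 4 5) (br5 (-4) 3 (-3) 5 (-4) (-2)) /\
  cong11 (T 6 5) (br5 (-5) 2 (-1) 0 2 1) /\
  cong11 (T 8 5) (br5 4 0 (-2) 2 5 (-3)) /\
  (* residue 6 *)
  cong11 (T 2 6) (Theta (-4) 3 1 5 (-2)) /\
  cong11 (T 4 6) (Theta (-2) (-4) (-5) (-3) (-1)) /\
  cong11 (T 6 6) (Theta 1 5 (-5) 4 2) /\
  cong11 (T 8 6) (Theta (-5) (-5) 1 (-2) (-2)) /\
  (* residue 8 *)
  cong11 (T 2 8) (br8 (-1) (-4) (-1) 5 (-3) (-4)) /\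
  cong11 (T 4 8) (br8 (-3) 5 (-5) (-3) (-2) (-5)) /\
  cong11 (T 6 8) (br8 3 4 3 (-3) 1 3) /\
  cong11 (T 8 8) (br8 0 2 (-1) 5 (-1) 5).
Proof.
have /and5P[m1 m2 m3 m5 /andP[m6 m8]] := mons_check.
have /and5P[t1 t2 t3 t5 /andP[t6 t8]] := certs_check.
split; first (refine (cert_cong (i := 0) m1 t1 (mu_br1 _ _ _ _ _ _) _); exact isT).
split; first (refine (cert_cong (i := 1) m1 t1 mu_zero1 _); exact isT).
split; first (refine (cert_cong (i := 2) m1 t1 (mu_br1 _ _ _ _ _ _) _); exact isT).
split; first (refine (cert_cong (i := 3) m1 t1 (mu_br1 _ _ _ _ _ _) _); exact isT).
split; first (refine (cert_cong (i := 0) m2 t2 (mu_br2 _ _ _ _ _ _) _); exact isT).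
split; first (refine (cert_cong (i := 1) m2 t2 (mu_br2 _ _ _ _ _ _) _); exact isT).
split; first (refine (cert_cong (i := 2) m2 t2 (mu_br2 _ _ _ _ _ _) _); exact isT).
split; first (refine (cert_cong (i := 3) m2 t2 (mu_br2 _ _ _ _ _ _) _); exact isT).
split; first (refine (cert_cong (i := 0) m3 t3 (mu_br3 _ _ _ _ _ _) _); exact isT).
split; first (refine (cert_cong (i := 1) m3 t3 (mu_br3 _ _ _ _ _ _) _); exact isT).
split; first (refine (cert_cong (i := 2) m3 t3 (mu_br3 _ _ _ _ _ _) _); exact isT).
split; first (refine (cert_cong (i := 3) m3 t3 (mu_br3 _ _ _ _ _ _) _); exact isT).
split; first (refine (cert_cong (i := 0) m5 t5 (mu_br5 _ _ _ _ _ _) _); exact isT).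
split; first (refine (cert_cong (i := 1) m5 t5 (mu_br5 _ _ _ _ _ _) _); exact isT).
split; first (refine (cert_cong (i := 2) m5 t5 (mu_br5 _ _ _ _ _ _) _); exact isT).
split; first (refine (cert_cong (i := 3) m5 t5 (mu_br5 _ _ _ _ _ _) _); exact isT).
split; first (refine (cert_cong (i := 0) m6 t6 (mu_Theta _ _ _ _ _) _); exact isT).
split; first (refine (cert_cong (i := 1) m6 t6 (mu_Theta _ _ _ _ _) _); exact isT).
split; first (refine (cert_cong (i := 2) m6 t6 (mu_Theta _ _ _ _ _) _); exact isT).
split; first (refine (cert_cong (i := 3) m6 t6 (mu_Theta _ _ _ _ _) _); exact isT).
split; first (refine (cert_cong (i := 0) m8 t8 (mu_br8 _ _ _ _ _ _) _); exact isT).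
split; first (refine (cert_cong (i := 1) m8 t8 (mu_br8 _ _ _ _ _ _) _); exact isT).
split; first (refine (cert_cong (i := 2) m8 t8 (mu_br8 _ _ _ _ _ _) _); exact isT).
refine (cert_cong (i := 3) m8 t8 (mu_br8 _ _ _ _ _ _) _); exact isT.
Qed.
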